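(* Let $W$ be a symplectic manifold with symplectic form $\sigma$. Suppose the dynamical Lagrangian distribution $(\vec{\mathcal H},\mathcal D)$ on $W$ is monotone increasing and the Hamiltonian $\mathcal H$ admits a tuple $\mathcal G=(g_1,\dots,g_s)$ of $s$ involutive first integrals such that, at a point $\lambda\in W$, $$\mathcal D_\lambda\cap\mathrm{span}\bigl(\vec g_1(\lambda),\dots,\vec g_s(\lambda)\bigr)=0.$$ Then on the space $\Bigl(\bigcap_{i=1}^s\ker d_\lambda g_i\Bigr)\cap\mathcal D_\lambda$ the curvature form of the $\mathcal G$-reduction of $(\vec{\mathcal H},\mathcal D)$ is not less than the curvature form of $(\vec{\mathcal H},\mathcal D)$ itself. Moreover, on this space the difference $$r^{(\vec{\mathcal H},\mathcal D^{\mathcal G})}_\lambda-r^{(\vec{\mathcal H},\mathcal D)}_\lambda$$ is a non-negative definite quadratic form of rank not greater than $s$.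
   Context: All objects are $C^\infty$. **Curves in the Lagrange Grassmannian.** Let $\Sigma$ be a $2n$-dimensional linear symplectic space with form $\sigma$ and $L(\Sigma)$ its Lagrange Grassmannian. The velocity $\dot\Lambda(t)$ of a curve $\Lambda(\cdot)$ in $L(\Sigma)$ is identified with the quadratic form on $\Lambda(t)$ given by $l\mapsto\sigma(\frac{d}{dt}l(t),l)$, where $l(\cdot)$ is any smooth curve with $l(\cdot)\in\Lambda(\cdot)$, $l(t)=l$; also with the corresponding symmetric bilinear form and the self-adjoint map $\dot\Lambda(t):\Lambda(t)\to\Lambda(t)^*$. The curve is regular if $\dot\Lambda(t)$ is nondegenerate for all $t$. For $\Lambda\in L(\Sigma)$ let $B_\Lambda:\Sigma\to\Lambda^*$, $B_\Lambda(w)(v)=\sigma(w,v)$, and $\Lambda^{\pitchfork}=\{\Gamma\in L(\Sigma):\Gamma\cap\Lambda=0\}$. For $\Gamma\in\Lambda^\pitchfork$, $B_\Lambda|_\Gamma:\Gamma\to\Lambda^*$ is an isomorphism, with inverse $I_\Gamma$. The set $\Lambda^\pitchfork$ is an affine space over the space $\mathrm{Quad}(\Lambda^* )$ of quadratic forms on $\Lambda^*$, with subtraction $(\Gamma-\Delta)(l)=\sigma(I_\Gamma l,I_\Delta l)$. The curve $\Lambda(\cdot)$ is ample at $\tau$ if $\Lambda(t)\in\Lambda(\tau)^\pitchfork$ for $t\ne\tau$ near $\tau$ and $t\mapsto\Lambda(t)-\Delta\in\mathrm{Quad}(\Lambda(\tau)^* )$ has a pole at $t=\tau$ (for some, equivalently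 any, $\Delta\in\Lambda(\tau)^\pitchfork$). Then the derivative subspace $\Lambda^\circ(\tau)\in\Lambda(\tau)^\pitchfork$ is the unique subspace such that the free term of the Laurent expansion at $\tau$ of $t\mapsto\Lambda(t)-\Lambda^\circ(\tau)$ is zero. A regular curve is ample at every point and has a smooth derivative curve $\tau\mapsto\Lambda^\circ(\tau)$. Identify $\Lambda^\circ(\tau)\cong\Lambda(\tau)^*$ by $B_{\Lambda(\tau)}|_{\Lambda^\circ(\tau)}$ and $\Lambda(\tau)\cong\Lambda^\circ(\tau)^*$ by $B_{\Lambda^\circ(\tau)}|_{\Lambda(\tau)}$. The curvature operator is $R_\Lambda(\tau)=-\dot\Lambda^\circ(\tau)\circ\dot\Lambda(\tau):\Lambda(\tau)\to\Lambda(\tau)$, and the curvature form is $r_\Lambda(\tau)(v)=\bigl(\dot\Lambda(\tau)R_\Lambda(\tau)v\bigr)(v)$. **Reduction of curves.** Let $\ell=(l_1,\dots,l_s)$ with $\sigma(l_i,l_j)=0$ for all $i,j$, and $(\mathrm{span}\,\ell)^\angle=\{v\in\Sigma:\sigma(v,l_i)=0\ \forall i\}$. Put $\Lambda^\ell=\Lambda\cap(\mathrm{span}\,\ell)^\angle+\mathrm{span}\,\ell$ and $\overline{\Lambda^\ell}=\Lambda^\ell/\mathrm{span}\,\ell$, a Lagrangian subspace of the symplectic space $(\mathrm{span}\,\ell)^\angle/\mathrm{span}\,\ell$. The $\ell$-reduction of $\Lambda(\cdot)$ is $\Lambda(\cdot)^\ell$. With $\phi:\Sigma\to\Sigma/\mathrm{span}\,\ell$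 the projection, its curvature operator and curvature form at $\tau$ are, for $v\in\Lambda(\tau)^\ell$, $R_{\Lambda^\ell}(\tau)(v)=\bigl(\phi|_{\Lambda(\tau)\cap(\mathrm{span}\,\ell)^\angle}\bigr)^{-1}\circ R_{\overline{\Lambda^\ell}}(\tau)\circ\phi(v)$ and $r_{\Lambda^\ell}(\tau)(v)=\frac{d}{d\tau}\bigl(\Lambda(\tau)^\ell\bigr)\bigl(R_{\Lambda^\ell}(\tau)v,v\bigr)$ (velocity of the curve $\Lambda(\cdot)^\ell$ as a bilinear form). **Dynamical Lagrangian distributions.** A Lagrangian distribution $\mathcal D$ on $W$ is a smooth subbundle of $TW$ whose fibers $\mathcal D_\lambda$ are Lagrangian subspaces of $T_\lambda W$. For $\mathcal H\in C^\infty(W)$, $\vec{\mathcal H}$ is defined by $d\mathcal H(\cdot)=\sigma(\cdot,\vec{\mathcal H})$ and $e^{t\vec{\mathcal H}}$ is its flow; similarly $\vec g_i$ for $g_i$. A dynamical Lagrangian distribution is a pair $(\vec{\mathcal H},\mathcal D)$. $[v_1,v_2]=v_1\circ v_2-v_2\circ v_1$ is the Lie bracket. The symmetric bilinear form $Q^{(\vec{\mathcal H},\mathcal D)}_\lambda$ on $\mathcal D_\lambda$ is $Q_\lambda(v,w)=\sigma_\lambda([\vec{\mathcal H},Y],Z)$ for any sections $Y,Z$ of $\mathcal D$ with $Y(\lambda)=v$, $Z(\lambda)=w$. The pair is monotone increasing if $v\mapsto Q_\lambda(v,v)$ is positive definite for every $\lambda$. The Jacobi curve attached at $\lambda$ is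 the curve $J_\lambda(t)=(e^{-t\vec{\mathcal H}})_*\mathcal D_{e^{t\vec{\mathcal H}}\lambda}$ in $L(T_\lambda W)$. The curvature operator and the curvature form $r^{(\vec{\mathcal H},\mathcal D)}_\lambda$ of $(\vec{\mathcal H},\mathcal D)$ at $\lambda$ (on $\mathcal D_\lambda$) are those of $J_\lambda(\cdot)$ at $t=0$. **Reduction by first integrals.** $\mathcal G=(g_1,\dots,g_s)$ is a tuple of involutive first integrals if $\{\mathcal H,g_i\}=0$ and $\{g_i,g_j\}=0$ for all $i,j$, where $\{h,g\}=dg(\vec h)$. The $\mathcal G$-reduction of $(\vec{\mathcal H},\mathcal D)$ is $(\vec{\mathcal H},\mathcal D^{\mathcal G})$ with $\mathcal D^{\mathcal G}_\lambda=\bigl(\bigcap_i\ker d_\lambda g_i\bigr)\cap\mathcal D_\lambda+\mathrm{span}(\vec g_1(\lambda),\dots,\vec g_s(\lambda))$. Its Jacobi curve at $\lambda$ is the $(\vec g_1(\lambda),\dots,\vec g_s(\lambda))$-reduction of $J_\lambda(\cdot)$, and its curvature operator and curvature form $r^{(\vec{\mathcal H},\mathcal D^{\mathcal G})}_\lambda$ at $\lambda$ are by definition those of this reduction of the curve at $t=0$. *)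

(* Defs.v *)
From HB Require Import structures.
From mathcomp Require Import all_boot all_order all_algebra.
From mathcomp Require Import all_classical all_reals all_analysis.

Set Implicit Arguments.
Unset Strict Implicit.
Unset Printing Implicit Defensive.

Import Order.TTheory GRing.Theory Num.Theory numFieldNormedType.Exports.
Local Open Scope classical_set_scope.
Local Open Scope ring_scope.

(* C^oo on an open set [A]: all iterated directional derivatives are (Frechet)
   differentiable at every point of [A]. *)
Definition smooth_on (R : realType) (U V : normedModType R) (A : set U)
    (f : U -> V) : Prop :=
  forall (vs : seq U) (x : U), A x ->
    differentiable (foldr (fun v g => fun y => derive g y v) f vs) x.

Definition smooth_near (R : realType) (V : normedModType R) (f : R -> V)
    (t : R) : Prop :=
  exists A : set R^o, [/\ open A, A t & smooth_on A (f : R^o -> V)].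

(** * Quadratic forms *)

Section QuadraticForms.
Variables (R : realType) (V : vectType R).
Implicit Types (E : {vspace V}) (q : V -> R).

Definition polar q (v w : V) : R := (q (v + w) - q v - q w) / 2.

Definition quadratic_on E q : Prop :=
  (forall (a : R) (v : V), v \in E -> q (a *: v) = a ^+ 2 * q v) /\
  (forall (a : R) (u v w : V), u \in E -> v \in E -> w \in E ->
     polar q (a *: u + v) w = a * polar q u w + polar q v w).

Definition quad_rank E q : nat :=
  \rank (\matrix_(i < \dim E, j < \dim E)
           polar q (vbasis E)`_i (vbasis E)`_j).

End QuadraticForms.

(** * Curves of Lagrangian subspaces *)

(* A symplectic space is a subspace [S] of a vector space [V] with a form
   [sg : V -> V -> R] whose restriction to [S] is symplectic ([S] is all of [V]
   for a tangent space of a symplectic manifold, and the image of the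
   skew-orthogonal complement of [span l] in [V / span l] for a reduction).
   A curve is a function [R -> {vspace V}]; only its germ at the time considered
   is relevant. Objects that exist and are unique for the curves at hand are
   picked by [xget], with a dummy default. *)
Section Curves.
Variables (R : realType) (V : vectType R) (S : {vspace V}) (sg : V -> V -> R).
Implicit Types (L G D : {vspace V}) (C : R -> {vspace V}).

Definition lagrangian L : Prop :=
  (L <= S)%VS /\
  forall v, v \in S -> (v \in L <-> forall w, w \in L -> sg v w = 0).

Definition smooth_curve_near (l : R -> V) (t : R) : Prop :=
  forall i, smooth_near (fun s => coord (vbasis fullv) i (l s) : R^o) t.

Definition vderiv (l : R -> V) (t : R) : V :=
  \sum_i derive1 (fun s => coord (vbasis fullv) i (l s) : R^o) t
            *: (vbasis (@fullv R V))`_i.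

Definition section_at C t (v : V) : set (R -> V) :=
  [set l | [/\ smooth_curve_near l t, \forall s \near t, l s \in C s & l t = v]].

Definition velocity C t (v : V) : R :=
  let l := xget (fun=> 0) (section_at C t v) in sg (vderiv l t) v.

Definition dual L := 'Hom(subvs_of L, R^o).

Definition velocity_map C t (v : V) : dual (C t) :=
  linfun (fun w : subvs_of (C t) => polar (velocity C t) v (vsval w) : R^o).

Definition Bmap L (x : V) : dual L :=
  linfun (fun v : subvs_of L => sg x (vsval v) : R^o).

Definition Imap L G (f : dual L) : V :=
  xget 0 [set x | x \in G /\ Bmap L x = f].

(* [G - D] as a quadratic form on the dual of [L] *)
Definition affine_diff L G D (f : dual L) : R := sg (Imap G f) (Imap D f).

Definition transversal L G : Prop := lagrangian G /\ (G :&: L)%VS = 0%VS.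

(* [f] has at [t0] a Laurent expansion, with a pole of order at most [k],
   whose free term is [c] *)
Definition laurent_free_term (f : R -> R) (t0 c : R) : Prop :=
  exists (k : nat) (g : R -> R^o),
    [/\ smooth_near g t0,
        \forall t \near t0^', f t = g t / (t - t0) ^+ k
      & c = derive1n k g t0 / k`!%:R].

Definition is_derivative_subspace C t D : Prop :=
  [/\ \forall s \near t^', transversal (C t) (C s),
      transversal (C t) D
    & forall f : dual (C t),
        laurent_free_term (fun s => affine_diff (C s) D f) t 0].

Definition derivative_curve C t : {vspace V} :=
  xget 0%VS (is_derivative_subspace C t).

Definition curvature_operator C t (v : V) : V :=
  let C' := derivative_curve C in
  - Imap (C t) (velocity_map C' t (Imap (C' t) (velocity_map C t v))).

Definition curvature_form C t (v : V) : R :=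
  polar (velocity C t) (curvature_operator C t v) v.

End Curves.

(** * Quotient vector spaces *)

(* [V / U] is modelled on the complement [U^C] of [U]; [quot_proj] is the
   canonical surjection, with kernel [U]. *)
Section Quotient.
Variables (R : realType) (V : vectType R).

Definition quotv (U : {vspace V}) : vectType R := subvs_of (U^C)%VS.

Definition quot_proj (U : {vspace V}) : 'Hom(V, quotv U) :=
  (linfun (vsproj (U^C)%VS) \o daddv_pi (U^C)%VS U)%VF.

Let capCv (U : {vspace V}) : (U^C :&: U)%VS = 0%VS.
Proof. by rewrite capvC capv_compl. Qed.

Lemma lker_quot_proj (U : {vspace V}) : lker (quot_proj U) = U.
Proof.
apply/vspaceP => v; rewrite memv_ker comp_lfunE lfunE /=.
have vE : daddv_pi (U^C)%VS U v + daddv_pi U (U^C)%VS v = v.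
  by rewrite daddv_pi_add ?capCv // addvC addv_complf memvf.
apply/eqP/idP => [p0|vU].
  have p1 : daddv_pi (U^C)%VS U v = 0.
    by rewrite -(vsprojK (memv_pi (U^C)%VS U v)) p0 linear0.
  by rewrite -vE p1 add0r memv_pi.
rewrite (daddv_pi_id (capv_compl U) vU) in vE.
by rewrite -[daddv_pi _ _ _](addrK v) vE subrr linear0.
Qed.

Lemma limg_quot_proj (U : {vspace V}) : limg (quot_proj U) = fullv.
Proof.
apply/vspaceP => w; rewrite memvf; apply/memv_imgP.
exists (vsval w); first exact: memvf.
by rewrite comp_lfunE lfunE /= daddv_pi_id ?capCv ?subvsP // vsvalK.
Qed.

End Quotient.

(** * Reduction of curves *)

Section Reduction.
Variables (R : realType) (V : vectType R) (sg : V -> V -> R) (l : seq V).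
Implicit Type C : R -> {vspace V}.

Definition sorth : {vspace V} :=
  (\bigcap_(u <- l) lker (linfun (fun v => sg v u : R^o)))%VS.

Definition reduced_curve C (t : R) : {vspace V} := (C t :&: sorth + span l)%VS.

Definition red_proj : 'Hom(V, quotv (span l)) := quot_proj (span l).

Definition red_space : {vspace quotv (span l)} := (red_proj @: sorth)%VS.

Definition red_lift (a : quotv (span l)) : V :=
  xget 0 [set u | u \in sorth /\ red_proj u = a].

(* the symplectic form induced on [red_space] *)
Definition red_form (a b : quotv (span l)) : R := sg (red_lift a) (red_lift b).

Definition quotient_curve C (t : R) : {vspace quotv (span l)} :=
  (red_proj @: reduced_curve C t)%VS.

Definition reduced_curvature_operator C t (v : V) : V :=
  xget 0 [set u | u \in (C t :&: sorth)%VS /\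
    red_proj u =
      curvature_operator red_space red_form (quotient_curve C) t (red_proj v)].

Definition reduced_curvature_form C t (v : V) : R :=
  polar (velocity sg (reduced_curve C) t) (reduced_curvature_operator C t v) v.

End Reduction.

(** * Smooth manifolds *)

Record chart (R : realType) (W : topologicalType) (m : nat) := Chart {
  cdom : set W;
  cmap : W -> 'rV[R]_m;
  cinv : 'rV[R]_m -> W;
  cdom_open : open cdom;
  cimg_open : open (cmap @` cdom);
  cmapK : forall x, cdom x -> cinv (cmap x) = x;
  cmap_continuous : forall x, cdom x -> {for x, continuous cmap};
  cinv_continuous : forall x, cdom x -> {for cmap x, continuous cinv}
}.

Definition cimg (R : realType) (W : topologicalType) (m : nat)
  (c : chart R W m) (U : set W) : set 'rV[R]_m := cmap c @` (cdom c `&` U).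

(* A preferred chart [chart_at x] is fixed around each point [x]; the tangent
   space at [x] is ['rV[R]_m], a tangent vector being given by its coordinates
   in [chart_at x]. *)
Record manifold (R : realType) (m : nat) := Manifold {
  mspace :> topologicalType;
  mspace_hausdorff : hausdorff_space mspace;
  mspace_second_countable : @second_countable mspace;
  atlas : set (chart R mspace m);
  chart_at : mspace -> chart R mspace m;
  chart_at_atlas : forall x, atlas (chart_at x);
  chart_at_dom : forall x, cdom (chart_at x) x;
  atlas_smooth : forall c d, atlas c -> atlas d ->
    smooth_on (cimg c (cdom d)) (cmap d \o cinv c)
}.

Section Manifolds.
Variables (R : realType) (m : nat) (W : manifold R m).
Implicit Types (x y : W) (U : set W) (X Y : W -> 'rV[R]_m).

Definition coord_at x : 'rV[R]_m := cmap (chart_at x) x.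

Definition smooth_fun U (f : W -> R) : Prop :=
  forall c, atlas c -> smooth_on (cimg c U) (f \o cinv c : 'rV[R]_m -> R^o).

Definition dfun (f : W -> R) x : 'rV[R]_m -> R^o :=
  'd (f \o cinv (chart_at x) : 'rV[R]_m -> R^o) (coord_at x).

Definition tmap (F : W -> W) x : 'rV[R]_m -> 'rV[R]_m :=
  'd (cmap (chart_at (F x)) \o F \o cinv (chart_at x)) (coord_at x).

(* coordinates in the chart [c] of a tangent vector at [x] *)
Definition to_chart (c : chart R W m) x : 'rV[R]_m -> 'rV[R]_m :=
  'd (cmap c \o cinv (chart_at x)) (coord_at x).

(* tangent vector at [cinv c y] with given coordinates in the chart [c] *)
Definition from_chart (c : chart R W m) (y : 'rV[R]_m) : 'rV[R]_m -> 'rV[R]_m :=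
  'd (cmap (chart_at (cinv c y)) \o cinv c) y.

Definition smooth_field U X : Prop :=
  forall c, atlas c ->
    smooth_on (cimg c U) (fun y : 'rV[R]_m => to_chart c (cinv c y) (X (cinv c y))).

Definition app_field X (f : W -> R) : W -> R := fun y => dfun f y (X y).

Definition lie_bracket X Y x : 'rV[R]_m :=
  xget 0 [set z | forall (U : set W) (f : W -> R),
    open U -> U x -> smooth_fun U f ->
    dfun f x z = app_field X (app_field Y f) x - app_field Y (app_field X f) x].

(* [Phi] is a smooth flow of [X] on the flow domain [Om], an open neighbourhood
   of [{0} x W] whose time slices are intervals; its values outside [Om] are
   irrelevant. *)
Record is_flow X (Om : set (R^o * W)) (Phi : R -> W -> W) : Prop := IsFlow {
  flow_open : open Om;
  flow_dom0 : forall x, Om (0, x);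
  flow_dom_interval : forall t u x,
    Om (t, x) -> 0 <= u <= 1 -> Om (u * t, x);
  flow_continuous : forall p, Om p ->
    {for p, continuous (fun p : R^o * W => Phi p.1 p.2)};
  flow_smooth : forall c d, atlas c -> atlas d ->
    smooth_on
      [set p : R^o * 'rV[R]_m | [/\ cimg c setT p.2, Om (p.1, cinv c p.2)
                                  & cdom d (Phi p.1 (cinv c p.2))]]
      (fun p => cmap d (Phi p.1 (cinv c p.2)));
  flow0 : forall x, Phi 0 x = x;
  flowD : forall s t x, Om (s, x) -> Om (t, Phi s x) -> Om (s + t, x) ->
    Phi t (Phi s x) = Phi (s + t) x;
  flow_derive : forall t x, Om (t, x) ->
    is_derive (t : R^o) (1 : R^o)
      (fun s : R^o => cmap (chart_at (Phi t x)) (Phi s x)) (X (Phi t x))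
}.

Definition smooth_subbundle (D : W -> {vspace 'rV[R]_m}) : Prop :=
  forall x, exists (U : set W) (k : nat) (Y : 'I_k -> W -> 'rV[R]_m),
    [/\ open U, U x, forall i, smooth_field U (Y i)
      & forall y, U y -> basis_of (D y) [tuple Y i y | i < k]].

End Manifolds.

(** * Symplectic manifolds and dynamical Lagrangian distributions *)

Definition mxform (R : realType) (m : nat) (A : 'M[R]_m) (u v : 'rV[R]_m) : R :=
  (u *m A *m v^T) 0 0.

Definition form_in_chart (R : realType) (m : nat) (W : manifold R m)
    (om : W -> 'M[R]_m) (c : chart R W m) (u v : 'rV[R]_m) : 'rV[R]_m -> R^o :=
  fun y => mxform (om (cinv c y)) (from_chart c y u) (from_chart c y v).

(* [omega x] is the Gram matrix of the form on the tangent space at [x];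
   closedness is [d omega = 0] evaluated on constant coordinate fields. *)
Record symplectic_manifold (R : realType) (m : nat) := SymplecticManifold {
  smanifold :> manifold R m;
  omega : smanifold -> 'M[R]_m;
  omega_skew : forall x, (omega x)^T = - omega x;
  omega_nondegenerate : forall x, omega x \in unitmx;
  omega_smooth : forall c, atlas c -> forall u v,
    smooth_on (cimg c setT) (form_in_chart omega c u v);
  omega_closed : forall c, atlas c -> forall (u v w y : 'rV[R]_m),
    cimg c setT y ->
    derive (form_in_chart omega c v w) y u
    + derive (form_in_chart omega c w u) y v
    + derive (form_in_chart omega c u v) y w = 0
}.

Section Hamiltonian.
Variables (R : realType) (m : nat) (W : symplectic_manifold R m).
Implicit Types (x : W) (h g : W -> R) (D : W -> {vspace 'rV[R]_m}).

Definition sform x : 'rV[R]_m -> 'rV[R]_m -> R := mxform (omega x).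

Definition ham h x : 'rV[R]_m :=
  xget 0 [set w | forall v, dfun h x v = sform x v w].

Definition poisson h g x : R := dfun g x (ham h x).

Definition lagrangian_distribution D : Prop :=
  smooth_subbundle D /\ forall x, lagrangian fullv (sform x) (D x).

(* (germs at [x] of) sections of [D] with value [v] at [x] *)
Definition dsection D x (v : 'rV[R]_m) : set (W -> 'rV[R]_m) :=
  [set Y | Y x = v /\ exists U : set W,
     [/\ open U, U x, smooth_field U Y & forall y, U y -> Y y \in D y]].

Definition Qform h D x (v w : 'rV[R]_m) : R :=
  let Y := xget (fun=> 0) (dsection D x v) in
  sform x (lie_bracket (ham h) Y x) w.

Definition monotone_increasing h D : Prop :=
  forall x v, v \in D x -> v != 0 -> 0 < Qform h D x v v.

Definition jacobi_curve (Phi : R -> W -> W) D x (t : R) : {vspace 'rV[R]_m} :=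
  (linfun (tmap (Phi (- t)) (Phi t x)) @: D (Phi t x))%VS.

(* [Phi] stands for the flow of [ham h]. *)
Definition dist_curvature_form (Phi : R -> W -> W) D x : 'rV[R]_m -> R :=
  curvature_form fullv (sform x) (jacobi_curve Phi D x) 0.

Definition involutive_first_integrals h (s : nat) (g : 'I_s -> W -> R) : Prop :=
  [/\ forall i, smooth_fun setT (g i),
      forall i x, poisson h (g i) x = 0
    & forall i j x, poisson (g i) (g j) x = 0].

Definition ham_tuple (s : nat) (g : 'I_s -> W -> R) x : s.-tuple 'rV[R]_m :=
  [tuple ham (g i) x | i < s].

(* The Jacobi curve of the reduction of [(ham h, D)] by [g] is the reduction of
   the Jacobi curve by [ham_tuple g x]; its curvature form is the one of the
   reduced curve. *)
Definition reduced_dist_curvature_form (Phi : R -> W -> W) D (s : nat)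
    (g : 'I_s -> W -> R) x : 'rV[R]_m -> R :=
  reduced_curvature_form (sform x) (ham_tuple g x) (jacobi_curve Phi D x) 0.

Definition common_ker (s : nat) (g : 'I_s -> W -> R) x : {vspace 'rV[R]_m} :=
  (\bigcap_(i < s) lker (linfun (dfun (g i) x)))%VS.

End Hamiltonian.

(* Main.v *)
(* In Darboux coordinates whose vertical space contains span l, the Jacobi curve
   is the graph of a smooth curve G of symmetric matrices with G(0) = 0, and
   monotonicity says that G' is positive definite at 0. Expanding
   (G(t) - G(0))^-1 at 0 gives the derivative curve, and then the matrix of the
   curvature form, G'''/2 - (3/4) G'' (G')^-1 G''. The reduced curve is the graph
   of io G io^T, where the rows of io span the annihilator of span l. Subtracting
   the two curvature formulas,
     r^G - r = (3/4) io G'' K G'' io^T,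
     K = (G')^-1 - io^T (io G' io^T)^-1 io.
   The matrix K is symmetric with K G' K = K, so it is nonnegative, and
   io G' K = 0 bounds its rank by the dimension of span l.
   Smoothness and isotropy of the Jacobi curve come from the invariance of the
   symplectic form under the flow; the derivative at 0 of the pull-back of a
   section Y of D by the flow is the Lie bracket of the Hamiltonian field with Y,
   which turns G'(0) into the form Q of the monotonicity hypothesis. *)

From HB Require Import structures.
Require Import Defs.
From mathcomp Require Import all_boot all_order all_algebra.
From mathcomp Require Import all_classical all_reals all_analysis.
From mathcomp Require Import ring lra.
Import Order.TTheory GRing.Theory Num.Theory numFieldNormedType.Exports.
Set Implicit Arguments.
Unset Strict Implicit.
Unset Printing Implicit Defensive.
Local Open Scope classical_set_scope.
Local Open Scope ring_scope.

(** * Smooth functions *)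

(** A Lagrangian complement of [D x] containing [span l] exists because the isotropic space [span l]
    meets [D x] only in zero. With this complement as vertical space, skew-orthogonality to [l]
    constrains the horizontal component alone, so reduction restricts the quadratic forms G(t) to a
    subspace that does not move with t. The third derivative enters the curvature linearly and
    commutes with this restriction, hence drops out of the difference; inverting G' does not commute
    with it, and K is the defect. The definitions pick velocities, derivative subspaces, lifts,
    sections and Lie brackets among all solutions of a defining property, so each computation must
    hold for an arbitrary choice. The recurrent device for sections: two sections of a family of
    isotropic spaces have zero pairing, and differentiating this identity shows that the pairing of
    the derivative of a section with its value depends on that value only. *)

Lemma near_eq_differentiable (R : numFieldType) (U V : normedModType R)
    (f g : U -> V) (x : U) :
  (\near x, f x = g x) -> differentiable f x -> differentiable g x.
Proof.
move=> fg df.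
have fgx : f x = g x by exact: nbhs_singleton fg.
have key : continuous ('d f x) /\ g \o shift x = cst (g x) + 'd f x +o_ 0 id.
  split; first exact: diff_continuous.
  apply/eqaddoP => _ /posnumP[e].
  have /eqaddoP/(_ e%:num) := diff_locally df.
  move=> /(_ [gt0 of e%:num]).
  apply: filter_app.
  have : \forall h \near (0 : U), f (h + x) = g (h + x).
    by move: fg; rewrite (near_shift 0) /= subr0.
  apply: filter_app; near=> h.
  by rewrite /= !fctE /= fgx => ->.
(* Differentiability is a statement about the differential selected by ['d], so the differential of
   [g] must first be identified with that of [f]. *)
have dg := diff_unique key.1 key.2.
by apply/diff_locallyP; rewrite dg.
Unshelve. all: by end_near.
Qed.

Section SmoothOn.
Variables (R : realType) (U V : normedModType R) (A : set U).
Implicit Types f g : U -> V.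

Lemma smooth_on_differentiable f x : smooth_on A f -> A x -> differentiable f x.
Proof. by move=> fA Ax; exact: (fA [::]). Qed.

Lemma smooth_on_derive f v : smooth_on A f -> smooth_on A (fun x => 'D_v f x).
Proof. by move=> fA vs x Ax; have := fA (rcons vs v) x Ax; rewrite foldr_rcons. Qed.

Lemma smooth_onS (B : set U) f : B `<=` A -> smooth_on A f -> smooth_on B f.
Proof. by move=> BA fA vs x /BA; exact: fA. Qed.

(** Since [A] is open, values on [A] determine derivatives on [A], so a class of differentiable
    functions need be stable under directional derivatives only up to equality on [A]. This replaces
    an induction over lists of directions for each operation. *)
Lemma smooth_on_coind (P : (U -> V) -> Prop) :
  open A ->
  (forall f, P f -> forall x, A x -> differentiable f x) ->
  (forall f v, P f -> exists2 g, P g & forall x, A x -> 'D_v f x = g x) ->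
  forall f, P f -> smooth_on A f.
Proof.
move=> Ao Pd PD f Pf vs.
suff [g Pg fg] : exists2 g, P g & forall x, A x ->
    foldr (fun v g => fun y => derive g y v) f vs x = g x.
  move=> x Ax; apply: (near_eq_differentiable _ (Pd g Pg x Ax)).
  near=> y; apply/esym/fg; near: y; exact: open_nbhs_nbhs.
elim: vs => [|v vs [g Pg fg]] /=; first by exists f.
have [h Ph gh] := PD g v Pg; exists h => // x Ax.
rewrite -gh //; apply: near_eq_derive.
by near=> y; apply/fg; near: y; exact: open_nbhs_nbhs.
Unshelve. all: by end_near.
Qed.

Lemma eq_smooth_on f g : open A -> (forall x, A x -> f x = g x) ->
  smooth_on A f -> smooth_on A g.
Proof.
move=> Ao fg fA.
apply: (@smooth_on_coind (fun h => exists2 k, smooth_on A k & forall x, A x -> k x = h x)) => //.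
- move=> h [k kA kh] x Ax; apply: (near_eq_differentiable _ (smooth_on_differentiable kA Ax)).
  near=> y; apply/kh; near: y; exact: open_nbhs_nbhs.
- move=> h v [k kA kh]; exists (fun x => 'D_v k x).
    by exists (fun x => 'D_v k x) => //; exact: smooth_on_derive.
  move=> x Ax; apply: near_eq_derive.
  by near=> y; apply/esym/kh; near: y; exact: open_nbhs_nbhs.
- by exists f.
Unshelve. all: by end_near.
Qed.

Lemma smooth_on_cst (c : V) : open A -> smooth_on A (fun=> c).
Proof.
move=> Ao; apply: (@smooth_on_coind (fun h => exists c, h = fun=> c)) => //.
- by move=> _ [k ->] x _; exact: differentiable_cst.
- by move=> _ v [k ->]; exists (fun=> 0); [exists 0|move=> x _; exact: derive_cst].
- by exists c.
Qed.

End SmoothOn.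

Section SmoothAlgebra.
Variables (R : realType) (U : normedModType R) (A : set U).

(* This class is stable under directional derivatives, so that its members are
   smooth: this treats products, inverses and composites simultaneously. *)
Inductive salg : (U -> R^o) -> Prop :=
| salg_smooth f of smooth_on A f : salg f
| salgD f g of salg f & salg g : salg (fun x => f x + g x)
| salgM f g of salg f & salg g : salg (fun x => f x * g x)
| salgV f of (forall x, A x -> f x != 0) & salg f : salg (fun x => (f x)^-1)
| salg_comp (V : normedModType R) (B : set V) (h : V -> R^o) n (b : 'I_n -> V)
    (g : 'I_n -> U -> R^o) of smooth_on B h
  & (forall x, A x -> B (\sum_i g i x *: b i)) & (forall i, salg (g i)) :
    salg (fun x => h (\sum_i g i x *: b i)).

Hypothesis Ao : open A.

Lemma salg_sum n (g : 'I_n -> U -> R^o) :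
  (forall i, salg (g i)) -> salg (fun x => \sum_i g i x).
Proof.
elim: n g => [|n IHn] g gA.
  apply: salg_smooth; rewrite (_ : (fun x => _) = fun=> 0).
    exact: smooth_on_cst.
  by apply/funext => x; rewrite big_ord0.
rewrite (_ : (fun x => _) = fun x => (\sum_(i < n) g (widen_ord (leqnSn n) i) x) + g ord_max x).
  by apply: salgD => //; exact: IHn.
by apply/funext => x; rewrite big_ord_recr.
Qed.

(** Leibniz, quotient and chain rules stay inside the class. Composites take their inner map as a
    combination of fixed vectors [b i] so that the chain rule becomes the sum of ['D_(b i) h] at the
    inner map times the derivative of [g i]: the first factor is again a composite with a smooth
    outer function, the second belongs to the class by induction. *)
Lemma salg_diff f : salg f ->
  (forall x, A x -> differentiable f x) /\
  (forall v, exists2 g, salg g & forall x, A x -> 'D_v f x = g x).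
Proof.
elim=> {f} [f fA|f g Sf [df Df] Sg [dg Dg]|f g Sf [df Df] Sg [dg Dg]|f f0 Sf [df Df]|V B h n b g hB gB Sg IH].
- split=> [x|v]; first exact: smooth_on_differentiable.
  by exists (fun x => 'D_v f x) => //; apply: salg_smooth; exact: smooth_on_derive.
- split=> [x Ax|v]; first exact: differentiableD (df _ Ax) (dg _ Ax).
  have [f' Sf' ff'] := Df v; have [g' Sg' gg'] := Dg v.
  exists (fun x => f' x + g' x); first exact: salgD.
  move=> x Ax; rewrite -ff' // -gg' //; apply: deriveD; apply: diff_derivable; [exact: df|exact: dg].
- split=> [x Ax|v]; first exact: differentiableM (df _ Ax) (dg _ Ax).
  have [f' Sf' ff'] := Df v; have [g' Sg' gg'] := Dg v.
  exists (fun x => f x * g' x + g x * f' x).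
    by apply: salgD; exact: salgM.
  move=> x Ax; rewrite -ff' // -gg' //; apply: deriveM; apply: diff_derivable; [exact: df|exact: dg].
- split=> [x Ax|v]; first exact: differentiableV (df _ Ax) (f0 _ Ax).
  have [f' Sf' ff'] := Df v.
  exists (fun x => -1 * ((f x)^-1 * (f x)^-1) * f' x).
    apply: salgM => //; apply: salgM; first exact/salg_smooth/smooth_on_cst.
    by apply: salgM; exact: salgV.
  move=> x Ax; rewrite -ff' //; rewrite deriveV ?f0 //; last by apply: diff_derivable; exact: df.
  by rewrite /GRing.scale /= mulN1r expr2 invfM.
- have dG x : A x -> differentiable (fun x => \sum_i g i x *: b i) x.
    move=> Ax; rewrite (_ : (fun x => _) = \sum_i (fun x => g i x *: b i)).
      apply: differentiable_sum => i; apply: differentiableZl.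
      by have [+ _] := IH i; exact.
    by apply/funext => y; rewrite fct_sumE.
  split=> [x Ax|v].
    by apply: (@differentiable_comp _ _ _ _ _ h); [exact: dG|apply: smooth_on_differentiable hB _; exact: gB].
  have /choice[g' g'P] : forall i, exists g', salg g' /\ forall x, A x -> 'D_v (g i) x = g' x.
    by move=> i; have [_ /(_ v)[g' ? ?]] := IH i; exists g'.
  exists (fun x => \sum_i ('D_(b i) h (\sum_j g j x *: b j)) * g' i x).
    apply: salg_sum => i; apply: salgM; last by have [] := g'P i.
    by apply: (salg_comp (h := fun y => 'D_(b i) h y)) gB Sg; exact: smooth_on_derive.
  move=> x Ax.
  have dh : differentiable h (\sum_j g j x *: b j) by apply: smooth_on_differentiable hB _; exact: gB.
  rewrite deriveE; last first.
    by apply: (@differentiable_comp _ _ _ _ _ h); [exact: dG|].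
  rewrite (@diff_comp _ _ _ _ _ h) //=; last exact: dG.
  have -> : 'd (fun x0 => \sum_i g i x0 *: b i) x v = \sum_i g' i x *: b i.
    rewrite -deriveE; last exact: dG.
    rewrite (_ : (fun x => _) = \sum_i (fun x => g i x *: b i)); last first.
      by apply/funext => y; rewrite fct_sumE.
    have gd i : differentiable (g i) x by have [+ _] := IH i; exact.
    rewrite derive_sum => [|i]; last first.
      by apply: diff_derivable; apply: differentiableZl.
    apply: eq_bigr => i _; rewrite deriveE; last exact: differentiableZl.
    by rewrite diffZl // -deriveE //; have [_ ->] := g'P i.
  rewrite linear_sum; apply: eq_bigr => i _.
  by rewrite linearZ /= -deriveE // mulrC.
Qed.

Lemma smooth_on_salg f : salg f -> smooth_on A f.
Proof.
apply: smooth_on_coind => // {}f; first by move=> /salg_diff[].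
by move=> v /salg_diff[].
Qed.

Lemma smooth_onD (f g : U -> R^o) : smooth_on A f -> smooth_on A g ->
  smooth_on A (fun x => f x + g x : R^o).
Proof. by move=> fA gA; apply/smooth_on_salg/salgD; exact: salg_smooth. Qed.

Lemma smooth_onM (f g : U -> R^o) : smooth_on A f -> smooth_on A g ->
  smooth_on A (fun x => f x * g x : R^o).
Proof. by move=> fA gA; apply/smooth_on_salg/salgM; exact: salg_smooth. Qed.

Lemma smooth_onV (f : U -> R^o) : (forall x, A x -> f x != 0) ->
  smooth_on A f -> smooth_on A (fun x => (f x)^-1 : R^o).
Proof. by move=> f0 fA; apply/smooth_on_salg/salgV => //; exact: salg_smooth. Qed.

Lemma smooth_onN (f : U -> R^o) : smooth_on A f -> smooth_on A (fun x => - f x : R^o).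
Proof.
move=> fA; under eq_fun do rewrite -mulN1r.
by apply: smooth_onM => //; exact: smooth_on_cst.
Qed.

Lemma smooth_onB (f g : U -> R^o) : smooth_on A f -> smooth_on A g ->
  smooth_on A (fun x => f x - g x : R^o).
Proof. by move=> fA gA; apply: smooth_onD => //; exact: smooth_onN. Qed.

Lemma smooth_on_sum (I : Type) (r : seq I) (P : pred I) (g : I -> U -> R^o) :
  (forall i, smooth_on A (g i)) -> smooth_on A (fun x => \sum_(i <- r | P i) g i x : R^o).
Proof.
move=> gA; elim: r => [|i r IHr].
  by under eq_fun do rewrite big_nil; exact: smooth_on_cst.
under eq_fun do rewrite big_cons; case: (P i) => //.
exact: smooth_onD.
Qed.

Lemma smooth_on_prod (I : Type) (r : seq I) (P : pred I) (g : I -> U -> R^o) :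
  (forall i, smooth_on A (g i)) -> smooth_on A (fun x => \prod_(i <- r | P i) g i x : R^o).
Proof.
move=> gA; elim: r => [|i r IHr].
  by under eq_fun do rewrite big_nil; exact: smooth_on_cst.
under eq_fun do rewrite big_cons; case: (P i) => //.
exact: smooth_onM.
Qed.

Lemma smooth_on_comp (V : normedModType R) (B : set V) (h : V -> R^o) n
    (b : 'I_n -> V) (g : 'I_n -> U -> R^o) :
  smooth_on B h -> (forall x, A x -> B (\sum_i g i x *: b i)) ->
  (forall i, smooth_on A (g i)) -> smooth_on A (fun x => h (\sum_i g i x *: b i) : R^o).
Proof.
move=> hB gB gA; apply: smooth_on_salg; apply: (salg_comp hB gB) => i.
exact: salg_smooth.
Qed.

End SmoothAlgebra.

(** * Functions of one real variable: Taylor quotients and Laurent free terms *)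

Section Smooth1.
Variables (R : realType) (A : set R^o).
Hypothesis Ao : open A.
Implicit Types (F f : R^o -> R^o) (t : R).

Lemma smooth_on_derive1 F : smooth_on A F -> smooth_on A (derive1 F : R^o -> R^o).
Proof.
by move=> FA; rewrite (_ : derive1 F = fun x => 'D_1 F x); [exact: smooth_on_derive|apply/funext => x; rewrite derive1E].
Qed.

Lemma smooth_on_derive1n F k : smooth_on A F -> smooth_on A (derive1n k F : R^o -> R^o).
Proof. by elim: k F => // k IH F FA; rewrite derive1nS; apply: smooth_on_derive1; exact: IH. Qed.

Lemma smooth_on_is_derive F t : smooth_on A F -> A t -> is_derive (t : R) (1 : R) (F : R -> R) (derive1 F t).
Proof.
move=> FA At; rewrite derive1E; apply: DeriveDef => //.
by apply: diff_derivable; exact: smooth_on_differentiable At.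
Qed.

Lemma smooth_on_continuous F t : smooth_on A F -> A t -> {for t, continuous F}.
Proof.
by move=> FA At; apply: differentiable_continuous; exact: smooth_on_differentiable At.
Qed.

Lemma smooth_on_id : smooth_on A (fun s : R^o => s : R^o).
Proof.
apply: (@smooth_on_coind _ _ _ _ (fun h => h = id \/ exists c, h = fun=> c)) => //; last by left.
- move=> h [->|[c ->]] x _; first exact: ex_diff.
  exact: differentiable_cst.
- move=> h v [->|[c ->]].
    by exists (fun=> v); [right; exists v|move=> x _; rewrite derive_id].
  by exists (fun=> 0); [right; exists 0|move=> x _; rewrite derive_cst].
Qed.

(** L'Hopital's rule on each side of [t] lowers the exponent by one and replaces [F] by [derive1 F];
    the factors [k.+1] collected on the way build up the factorial. *)
Lemma taylor_lim F t k : smooth_on A F -> A t ->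
  (forall j, (j < k)%N -> derive1n j F t = 0) ->
  F s / (s - t) ^+ k @[s --> t^'] --> derive1n k F t / k`!%:R.
Proof.
move=> FA At; elim: k F FA => [|k IH] F FA F0.
  rewrite fact0 divr1 /=; under eq_fun do rewrite expr0 divr1.
  apply: cvg_within_filter; exact: (smooth_on_continuous FA At).
have /nbhs_ballP[e /= e0 eA] : nbhs t A by exact: open_nbhs_nbhs.
have inA x : `|x - t| < e -> A x by move=> xt; apply: eA; rewrite /ball /= distrC.
have F0t : F t = 0 by exact: (F0 0%N).
have Fc : F s @[s --> t] --> (0 : R) by rewrite -[X in _ --> X]F0t; exact: (smooth_on_continuous FA At).
have dG x : is_derive (x : R) (1 : R) (fun s : R => (s - t) ^+ k.+1) (k.+1%:R * (x - t) ^+ k).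
  rewrite (_ : (fun s : R => _) = (id - cst t) ^+ k.+1); last by apply/funext => y; rewrite exprfctE.
  by apply: is_derive_eq; rewrite /GRing.scale /= subr0 mulr1 mulr_natl.
have Gc : (s - t) ^+ k.+1 @[s --> t] --> (0 : R).
  rewrite -[X in _ --> X](_ : (t - t) ^+ k.+1 = 0); last by rewrite subrr expr0n.
  apply: (@differentiable_continuous _ _ _ t (fun s : R => (s - t) ^+ k.+1)).
  exact/derivable1_diffP/ex_derive.
have IHk : derive1 F s / (s - t) ^+ k @[s --> t^'] --> derive1n k.+1 F t / k`!%:R.
  rewrite derive1Sn; apply: IH; first exact: smooth_on_derive1.
  by move=> j jk; rewrite -derive1Sn F0.
have L : derive1 F s / (k.+1%:R * (s - t) ^+ k) @[s --> t^'] --> derive1n k.+1 F t / k.+1`!%:R.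
  rewrite factS natrM invfM mulrCA.
  under eq_fun do rewrite invfM mulrCA.
  by apply: cvgMl_tmp.
apply: (@cvg_at_right_left_dnbhs _ R^o).
- apply: (@lhopital_at_right R F (derive1 F) (fun s => (s - t) ^+ k.+1) (fun x => k.+1%:R * (x - t) ^+ k) t (t + e)).
  + by rewrite ltrDl.
  + move=> x; rewrite in_itv /= => /andP[tx xe]; apply: smooth_on_is_derive => //.
    by apply: inA; rewrite gtr0_norm ?subr_gt0 // ltrBlDl.
  + exact: cvg_at_right_filter.
  + exact: cvg_at_right_filter.
  + move=> x; rewrite in_itv /= => /andP[tx xe].
    by rewrite mulf_neq0 ?pnatr_eq0 // expf_neq0 // subr_eq0 gt_eqF.
  + exact: cvg_dnbhs_at_right.
- apply: (@lhopital_at_left R F (derive1 F) (fun s => (s - t) ^+ k.+1) (fun x => k.+1%:R * (x - t) ^+ k) (t - e) t).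
  + by rewrite ltrBlDr ltrDl.
  + move=> x; rewrite in_itv /= => /andP[ex xt]; apply: smooth_on_is_derive => //.
    by apply: inA; rewrite ltr0_norm ?subr_lt0 // opprB ltrBlDr -ltrBlDl.
  + exact: cvg_at_left_filter.
  + exact: cvg_at_left_filter.
  + move=> x; rewrite in_itv /= => /andP[ex xt].
    by rewrite mulf_neq0 ?pnatr_eq0 // expf_neq0 // subr_eq0 lt_eqF.
  + exact: cvg_dnbhs_at_left.
Qed.

(** The quotient of Hadamard's lemma: when [F] vanishes to order [k] at [t], the value put at [t] is
    the Taylor coefficient that makes the quotient continuous. *)
Definition hadamard t k F : R^o -> R^o :=
  fun s => if s == t then derive1n k F t / k`!%:R else F s / (s - t) ^+ k.

(* The derivative of [hadamard t k F] is
   [hadamard t k.+1 (hadamard_next t k F)]. *)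
Definition hadamard_next t k F : R^o -> R^o :=
  fun s => (s - t) * derive1 F s - k%:R * F s.

Lemma hadamard_next_smooth t k F : smooth_on A F -> smooth_on A (hadamard_next t k F).
Proof.
move=> FA; apply: smooth_onB => //; apply: smooth_onM => //.
- by apply: smooth_onB => //; [exact: smooth_on_id|exact: smooth_on_cst].
- exact: smooth_on_derive1.
- exact: smooth_on_cst.
Qed.

(** At [s = t] only [(j - k) F^(j)(t)] survives. For [j <= k] it vanishes as soon as [F] vanishes to
    order [k], so the new numerator vanishes to order [k.+1] and the quotient construction can be
    iterated; for [j = k.+1] it is the next derivative of [F]. *)
Lemma derive1n_hadamard_next t k F j s : smooth_on A F -> A s ->
  derive1n j (hadamard_next t k F) s =
  (s - t) * derive1n j.+1 F s + (j%:R - k%:R) * derive1n j F s.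
Proof.
move=> FA; elim: j s => [|j IH] s As.
  by rewrite /= sub0r mulNr.
rewrite derive1nS derive1E (@near_eq_derive _ _ _ _ (fun s =>
  (s - t) * derive1n j.+1 F s + (j%:R - k%:R) * derive1n j F s)); last first.
  by near=> y; apply: IH; near: y; exact: open_nbhs_nbhs.
have d1 := smooth_on_is_derive (smooth_on_derive1n j.+1 FA) As.
have d2 := smooth_on_is_derive (smooth_on_derive1n j FA) As.
rewrite -/(derive1n j.+1 F) in d2.
have d3 : is_derive (s : R) (1 : R) ((id - cst t) * derive1n j.+1 F + (cst (j%:R - k%:R)) * derive1n j F : R -> R)
    ((s - t) * derive1n j.+2 F s + (j.+1%:R - k%:R) * derive1n j.+1 F s).
  apply: is_derive_eq; rewrite /GRing.scale /= !fctE -!derive1nS.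
  by rewrite -[j.+1]addn1 natrD; ring.
exact: derive_val.
Unshelve. all: by end_near.
Qed.

Lemma hadamard_continuous t k F : smooth_on A F -> A t ->
  (forall j, (j < k)%N -> derive1n j F t = 0) ->
  hadamard t k F s @[s --> t] --> hadamard t k F t.
Proof.
move=> FA At F0; apply/continuous_withinNx.
rewrite [X in _ --> X]/hadamard eqxx.
apply: cvg_trans (taylor_lim FA At F0); apply: near_eq_cvg.
near=> s; rewrite /hadamard ifF //; apply/negbTE; near: s.
exact: nbhs_dnbhs_neq.
Unshelve. all: by end_near.
Qed.

Lemma hadamard_off t k F s : smooth_on A F -> A s -> s != t ->
  is_derive (s : R) (1 : R) (hadamard t k F) (hadamard t k.+1 (hadamard_next t k F) s).
Proof.
move=> FA As st; rewrite /hadamard (negbTE st).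
apply: (@near_eq_is_derive _ _ _ (fun s => F s / (s - t) ^+ k)).
  near=> y; rewrite ifF //; apply/negbTE; near: y.
  by apply: open_nbhs_nbhs; split => //; exact: open_neq.
have d1 := smooth_on_is_derive FA As.
have st0 : s - t != 0 by rewrite subr_eq0.
have d2 : is_derive (s : R) (1 : R) ((id - cst t) ^+ k : R -> R) (k%:R * (s - t) ^+ k.-1).
  case: k => [|k]; first by rewrite mul0r expr0; exact: is_derive_cst.
  by apply: is_derive_eq; rewrite /GRing.scale /= subr0 mulr1 mulr_natl.
have d3 : is_derive (s : R) (1 : R) (fun s => ((s - t) ^+ k)^-1) (- ((s - t) ^+ k) ^-2 * (k%:R * (s - t) ^+ k.-1)).
  have e : (fun s : R => (s - t) ^+ k) = (id - cst t) ^+ k :> (R -> R) by apply/funext => y; rewrite exprfctE.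
  rewrite -e in d2.
  apply: DeriveDef; first by apply: derivableV; rewrite ?expf_neq0.
  by rewrite deriveV ?expf_neq0 // derive_val.
have d4 : is_derive (s : R) (1 : R) (F * (fun s => ((s - t) ^+ k)^-1) : R -> R) (F s * (- ((s - t) ^+ k) ^-2 * (k%:R * (s - t) ^+ k.-1)) + ((s - t) ^+ k)^-1 * derive1 F s).
  exact: is_deriveM.
apply: is_derive_eq d4 _; rewrite /hadamard_next.
case: k {d2 d3} => [|k]; first by rewrite !expr0 expr1; field.
by rewrite /= !exprS; field; rewrite st0 expf_neq0.
Unshelve. all: by end_near.
Qed.

Lemma hadamard_is_derive t k F s : smooth_on A F -> A t -> A s ->
  (forall j, (j < k)%N -> derive1n j F t = 0) ->
  is_derive (s : R) (1 : R) (hadamard t k F) (hadamard t k.+1 (hadamard_next t k F) s).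
Proof.
move=> FA At As F0.
have [->|st] := eqVneq s t; last exact: hadamard_off.
set h := hadamard t k F; set d := hadamard _ _ _ _.
have dE : d = derive1n k.+1 F t / k.+1`!%:R.
  rewrite /d /hadamard eqxx derive1n_hadamard_next // subrr mul0r add0r.
  by rewrite -[k.+1 in X in X%:R - _]addn1 natrD addrAC subrr add0r mul1r.
have G0 j : (j < k.+1)%N -> derive1n j (hadamard_next t k F) t = 0.
  rewrite ltnS leq_eqVlt derive1n_hadamard_next // subrr mul0r add0r => /orP[/eqP->|/F0->].
    by rewrite subrr mul0r.
  by rewrite mulr0.
have /nbhs_ballP[e /= e0 eA] : nbhs t A by exact: open_nbhs_nbhs.
have inA x : x \in `]t - e, t + e[ -> A x.
  rewrite in_itv /= => /andP[tx xt]; apply: eA.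
  by rewrite /ball /= distrC ltr_norml ltrBrDl tx /= ltrBlDl.
(* Off [t] the derivative of [h] is the next Hadamard quotient, which is continuous at [t];
   L'Hopital's rule turns its limit into the derivative of [h] at [t]. *)
have L : (h s - h t) / (s - t) @[s --> t^'] --> d.
  apply: (@lhopital R (fun s => h s - h t) (hadamard t k.+1 (hadamard_next t k F)) (fun s => s - t) (fun=> 1) (t - e) (t + e) t).
  - by rewrite in_itv /= ltrBlDr !ltrDl e0.
  - move=> x; rewrite inE => -[/= xI /eqP xt].
    rewrite -[hadamard _ _ _ _]subr0.
    apply: is_deriveB; apply: hadamard_off => //; exact: inA.
  - by move=> x _; rewrite -[X in is_derive _ _ _ X]subr0; apply: is_deriveB.
  - by rewrite -[X in _ --> X](subrr (h t)); apply: cvgB; [exact: hadamard_continuous|exact: cvg_cst].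
  - by rewrite -[X in _ --> X](subrr t); apply: cvgB; [exact: cvg_id|exact: cvg_cst].
  - by move=> x _; rewrite oner_neq0.
  - under eq_fun do rewrite divr1.
    apply: hadamard_continuous => //; exact: hadamard_next_smooth.
have L' : x^-1 *: (h (x%:A + t) - h t) @[x --> 0^'] --> d.
  have sh : (x + t) @[x --> (0 : R)^'] --> t^'.
    move=> B tB.
    have : \forall x \near (0 : R), x + t != t -> B (x + t).
      have : \forall x \near (t : R), x != t -> B x by exact: tB.
      by rewrite (near_shift (0 : R)) subr0.
    apply: filter_app; near=> x => xB x0; apply: xB.
    by rewrite -subr_eq0 addrK.
  have := @cvg_comp _ _ _ (fun x => x + t) (fun s => (h s - h t) / (s - t)) _ _ _ sh L; apply: cvg_trans; apply: near_eq_cvg; near=> x.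
  by rewrite /= addrK mulrC [x%:A]mulr1.
by apply: DeriveDef; [apply/cvg_ex; exists d|exact/cvg_lim].
Unshelve. all: by end_near.
Qed.

(** Coinduction on scalar multiples of Hadamard quotients: differentiating one gives the next, and
    the scalar absorbs the direction of differentiation. *)
Lemma hadamard_smooth t k F : smooth_on A F -> A t ->
  (forall j, (j < k)%N -> derive1n j F t = 0) -> smooth_on A (hadamard t k F).
Proof.
move=> FA At F0.
apply: (@smooth_on_coind _ _ _ _ (fun h => exists a k F, [/\ smooth_on A F,
  forall j, (j < k)%N -> derive1n j F t = 0 & h = fun s => a * hadamard t k F s])) => //.
- move=> _ [a [l [G [GA G0 ->]]]] x Ax; apply/derivable1_diffP.
  have := hadamard_is_derive GA At Ax G0 => -[dh _].
  exact: (@derivableZ _ _ _ (hadamard t l G) a).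
- move=> _ v [a [l [G [GA G0 ->]]]].
  exists (fun s => (v * a) * hadamard t l.+1 (hadamard_next t l G) s).
    exists (v * a), l.+1, (hadamard_next t l G); split => //.
      exact: hadamard_next_smooth.
    move=> j; rewrite ltnS leq_eqVlt derive1n_hadamard_next // subrr mul0r add0r => /orP[/eqP->|/G0->].
      by rewrite subrr mul0r.
    by rewrite mulr0.
  move=> x Ax; have := hadamard_is_derive GA At Ax G0 => -[dh hE].
  have df : differentiable (fun s => a * hadamard t l G s : R^o) x.
    exact/derivable1_diffP/(@derivableZ _ _ _ (hadamard t l G) a).
  rewrite deriveE // -[v]mulr1 [v * 1]/(v *: 1) linearZ /= -deriveE // mulr1 -mulrA; congr (_ * _).
  by rewrite [LHS](@deriveZ _ _ _ (hadamard t l G) a) // hE.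
- by exists 1, k, F; split => //; apply/funext => s; rewrite mul1r.
Qed.

Lemma derive1n_mulX t F j s : smooth_on A F -> A s ->
  derive1n j.+1 (fun s => (s - t) * F s) s =
  (s - t) * derive1n j.+1 F s + j.+1%:R * derive1n j F s.
Proof.
move=> FA; elim: j s => [|j IH] s As.
  have d1 := smooth_on_is_derive FA As.
  have d2 : is_derive (s : R) (1 : R) ((id - cst t) * F : R -> R)
    ((s - t) * derive1 F s + 1 * F s).
    by apply: is_derive_eq; rewrite /GRing.scale /= !fctE; ring.
  by rewrite /= derive1E; exact: derive_val.
rewrite derive1nS derive1E (@near_eq_derive _ _ _ _ (fun s =>
  (s - t) * derive1n j.+1 F s + j.+1%:R * derive1n j F s)); last first.
  by near=> y; apply: IH; near: y; exact: open_nbhs_nbhs.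
have d1 := smooth_on_is_derive (smooth_on_derive1n j.+1 FA) As.
have d2 := smooth_on_is_derive (smooth_on_derive1n j FA) As.
rewrite -/(derive1n j.+1 F) in d2.
have d3 : is_derive (s : R) (1 : R) ((id - cst t) * derive1n j.+1 F + (cst j.+1%:R) * derive1n j F : R -> R)
    ((s - t) * derive1n j.+2 F s + j.+2%:R * derive1n j.+1 F s).
  apply: is_derive_eq; rewrite /GRing.scale /= !fctE -!derive1nS.
  by rewrite -[j.+2]addn1 natrD; ring.
exact: derive_val.
Unshelve. all: by end_near.
Qed.

End Smooth1.

Lemma near_eq_derive1n (R : realType) (f g : R -> R^o) (t : R) k :
  (\forall s \near t, f s = g s) -> derive1n k f t = derive1n k g t.
Proof.
move=> fg; suff : \forall s \near t, derive1n k f s = derive1n k g s by exact: nbhs_singleton.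
elim: k => // k /near_join; apply: filter_app; near=> s => fgs.
rewrite !derive1nS !derive1E; exact: near_eq_derive.
Unshelve. all: by end_near.
Qed.

(** The definition leaves the pole order and the numerator free. Two numerators differ by a factor
    [(s - t) ^+ d], away from [t] by division and at [t] by continuity, and each factor [s - t]
    shifts the Taylor coefficients by one place. *)
Lemma laurent_free_term_unique (R : realType) (f : R -> R) (t c1 c2 : R) :
  laurent_free_term f t c1 -> laurent_free_term f t c2 -> c1 = c2.
Proof.
move=> [k1 [g1 [[A1 [oA1 A1t sg1]] fg1 ->]]] [k2 [g2 [[A2 [oA2 A2t sg2]] fg2 ->]]].
wlog le12 : k1 k2 g1 g2 A1 A2 oA1 A1t sg1 fg1 oA2 A2t sg2 fg2 / (k1 <= k2)%N.
  move=> wl; have [le12|/ltnW le21] := leqP k1 k2.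
    exact: wl oA1 A1t sg1 fg1 oA2 A2t sg2 fg2 le12.
  by apply/esym; exact: wl oA2 A2t sg2 fg2 oA1 A1t sg1 fg1 le21.
rewrite -(subnKC le12); move: (k2 - k1)%N (subnKC le12) => d kd; rewrite -kd in fg2.
have powS (g : R^o -> R^o) n : smooth_on A1 g -> smooth_on A1 (fun s => (s - t) ^+ n * g s).
  move=> sg; apply: smooth_onM => //; elim: n => [|n IH].
    by under eq_fun do rewrite expr0; exact: smooth_on_cst.
  under eq_fun do rewrite exprS; apply: smooth_onM => //.
  by apply: smooth_onB => //; [exact: smooth_on_id|exact: smooth_on_cst].
have gE : \forall s \near t, g2 s = (s - t) ^+ d * g1 s.
  have g12 : \forall s \near t^', g2 s = (s - t) ^+ d * g1 s.
    near=> s.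
    have st : s - t != 0 by rewrite subr_eq0; near: s; exact: nbhs_dnbhs_neq.
    have e1 : f s = g1 s / (s - t) ^+ k1 by near: s.
    have e2 : f s = g2 s / (s - t) ^+ (k1 + d) by near: s.
    have := e1; rewrite e2 => /(congr1 (fun y => y * (s - t) ^+ (k1 + d))).
    rewrite divfK ?expf_neq0 // => ->; rewrite exprD mulrA divfK ?expf_neq0 //.
    exact: mulrC.
  have gt : g2 t = (t - t) ^+ d * g1 t.
    have cg2 : g2 s @[s --> t^'] --> g2 t.
      by apply: cvg_within_filter; exact: (smooth_on_continuous sg2).
    have cg1 : (s - t) ^+ d * g1 s @[s --> t^'] --> (t - t) ^+ d * g1 t.
      apply: cvg_within_filter; exact: (smooth_on_continuous (powS _ d sg1)).
    apply: (@cvg_unique _ _ (g2 s @[s --> t^'])) => //.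
    by apply: cvg_trans cg1; apply: near_eq_cvg; apply: filterS g12 => s ->.
  move: g12; rewrite near_withinE; apply: filter_app; near=> s => h.
  by have [->|/h] := eqVneq s t.
rewrite (near_eq_derive1n _ gE) {gE fg2 kd le12 fg1 sg2 k2 g2}.
elim: d => [|d IH].
  rewrite addn0 (_ : (fun s => _) = g1) //.
  by apply/funext => s; rewrite expr0 mul1r.
rewrite IH addnS.
rewrite (_ : (fun s => (s - t) ^+ d.+1 * g1 s) = fun s => (s - t) * ((s - t) ^+ d * g1 s)); last first.
  by apply/funext => s; rewrite exprS mulrA.
rewrite (derive1n_mulX oA1 _ _ (powS _ d sg1)) // subrr mul0r add0r factS natrM invfM.
by rewrite mulrACA divff ?pnatr_eq0 // mul1r.
Unshelve. all: by end_near.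
Qed.

(** * Smooth matrix-valued functions and their derivatives *)

Definition msmooth (R : realType) (U : normedModType R) (A : set U) m n
    (M : U -> 'M[R]_(m, n)) : Prop :=
  forall i j, smooth_on A (fun x => M x i j : R^o).

Section MatrixSmooth.
Variables (R : realType) (U : normedModType R) (A : set U).
Hypothesis Ao : open A.

Lemma msmooth_cst m n (M : 'M[R]_(m, n)) : msmooth A (fun=> M).
Proof. by move=> i j; exact: smooth_on_cst. Qed.

Lemma msmoothD m n (M N : U -> 'M[R]_(m, n)) :
  msmooth A M -> msmooth A N -> msmooth A (fun x => M x + N x).
Proof. by move=> sM sN i j; under eq_fun do rewrite mxE; exact: smooth_onD. Qed.

Lemma msmoothN m n (M : U -> 'M[R]_(m, n)) :
  msmooth A M -> msmooth A (fun x => - M x).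
Proof. by move=> sM i j; under eq_fun do rewrite mxE; exact: smooth_onN. Qed.

Lemma msmoothZ m n (a : R) (M : U -> 'M[R]_(m, n)) :
  msmooth A M -> msmooth A (fun x => a *: M x).
Proof.
move=> sM i j; under eq_fun do rewrite mxE; apply: smooth_onM => //.
exact: smooth_on_cst.
Qed.

Lemma msmooth_tr m n (M : U -> 'M[R]_(m, n)) :
  msmooth A M -> msmooth A (fun x => (M x)^T).
Proof. by move=> sM i j; under eq_fun do rewrite mxE; exact: sM. Qed.

Lemma msmoothM m n p (M : U -> 'M[R]_(m, n)) (N : U -> 'M[R]_(n, p)) :
  msmooth A M -> msmooth A N -> msmooth A (fun x => M x *m N x).
Proof.
move=> sM sN i j; under eq_fun do rewrite mxE; apply: smooth_on_sum => // k.
exact: smooth_onM.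
Qed.

Lemma smooth_on_det n (M : U -> 'M[R]_n) :
  msmooth A M -> smooth_on A (fun x => \det (M x) : R^o).
Proof.
move=> sM; apply: smooth_on_sum => // s; apply: smooth_onM => //.
  exact: smooth_on_cst.
exact: smooth_on_prod.
Qed.

Lemma msmooth_inv n (M : U -> 'M[R]_n) : msmooth A M ->
  (forall x, A x -> M x \in unitmx) -> msmooth A (fun x => invmx (M x)).
Proof.
move=> sM uM i j.
apply: (@eq_smooth_on _ _ _ _ (fun x => (\det (M x))^-1 * \adj (M x) i j)) => //.
  by move=> x Ax; rewrite /invmx uM // [RHS]mxE.
apply: smooth_onM => //.
  apply: smooth_onV => //; last exact: smooth_on_det.
  by move=> x /uM; rewrite unitmxE unitfE.
under eq_fun do rewrite mxE.
apply: smooth_onM => //; first exact: smooth_on_cst.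
by apply: smooth_on_det => k l; under eq_fun do rewrite !mxE; exact: sM.
Qed.

End MatrixSmooth.

Definition mderive (R : realType) m n (M : R^o -> 'M[R]_(m, n)) (s : R^o) :
    'M[R]_(m, n) :=
  \matrix_(i, j) derive1 (fun s => M s i j : R^o) s.

Section MatrixDerive.
Variables (R : realType) (A : set R^o).
Hypothesis Ao : open A.

Lemma msmooth_derive m n (M : R^o -> 'M[R]_(m, n)) :
  msmooth A M -> msmooth A (mderive M).
Proof. by move=> sM i j; under eq_fun do rewrite mxE; exact: smooth_on_derive1. Qed.

Lemma near_eq_mderive m n (M N : R^o -> 'M[R]_(m, n)) s :
  (\forall u \near s, M u = N u) -> mderive M s = mderive N s.
Proof.
move=> MN; apply/matrixP => i j; rewrite !mxE !derive1E; apply: near_eq_derive.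
by apply: filterS MN => u ->.
Qed.

Variable s : R^o.
Hypothesis As : A s.

Lemma msmooth_is_derive m n (M : R^o -> 'M[R]_(m, n)) i j : msmooth A M ->
  is_derive (s : R) (1 : R) (fun s => M s i j) (mderive M s i j).
Proof.
move=> sM; rewrite mxE.
exact: (smooth_on_is_derive (sM i j) As).
Qed.

Lemma mderive_cst m n (M : 'M[R]_(m, n)) : mderive (fun=> M) s = 0.
Proof. by apply/matrixP => i j; rewrite !mxE derive1_cst. Qed.

Lemma mderiveD m n (M N : R^o -> 'M[R]_(m, n)) : msmooth A M -> msmooth A N ->
  mderive (fun s => M s + N s) s = mderive M s + mderive N s.
Proof.
move=> sM sN; apply/matrixP => i j; rewrite mxE [RHS]mxE derive1E.
under eq_fun do rewrite mxE.
have dM := msmooth_is_derive i j sM; have dN := msmooth_is_derive i j sN.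
by rewrite (@deriveD _ _ _ (fun s => M s i j) (fun s => N s i j)) // !derive_val.
Qed.

Lemma mderiveM m n p (M : R^o -> 'M[R]_(m, n)) (N : R^o -> 'M[R]_(n, p)) :
  msmooth A M -> msmooth A N ->
  mderive (fun s => M s *m N s) s = mderive M s *m N s + M s *m mderive N s.
Proof.
move=> sM sN; apply/matrixP => i j; rewrite mxE [RHS]mxE derive1E !mxE.
under eq_fun do rewrite mxE.
rewrite (_ : (fun u : R => \sum_k M u i k * N u k j) =
  \sum_k ((fun u => M u i k) * (fun u => N u k j))); last first.
  by apply/funext => u; rewrite fct_sumE.
have dM k := msmooth_is_derive i k sM; have dN k := msmooth_is_derive k j sN.
rewrite derive_sum; last by move=> k; apply: derivableM.
rewrite -big_split; apply: eq_bigr => k _ /=.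
rewrite deriveM // !derive_val addrC; congr (_ + _).
by rewrite [LHS]mulrC.
Qed.

Lemma mderiveN m n (M : R^o -> 'M[R]_(m, n)) : msmooth A M ->
  mderive (fun s => - M s) s = - mderive M s.
Proof.
move=> sM; apply/matrixP => i j; rewrite mxE [RHS]mxE derive1E.
under eq_fun do rewrite mxE.
have dM := msmooth_is_derive i j sM.
by rewrite (@deriveN _ _ _ (fun s => M s i j)) // derive_val.
Qed.

Lemma mderiveB m n (M N : R^o -> 'M[R]_(m, n)) : msmooth A M -> msmooth A N ->
  mderive (fun s => M s - N s) s = mderive M s - mderive N s.
Proof. by move=> sM sN; rewrite mderiveD ?mderiveN //; exact: msmoothN. Qed.

Lemma mderiveZ m n (a : R) (M : R^o -> 'M[R]_(m, n)) : msmooth A M ->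
  mderive (fun s => a *: M s) s = a *: mderive M s.
Proof.
move=> sM; apply/matrixP => i j; rewrite mxE [RHS]mxE derive1E.
under eq_fun do rewrite mxE.
have dM := msmooth_is_derive i j sM.
by rewrite (@deriveZ _ _ _ (fun s => M s i j)) // derive_val.
Qed.

Lemma mderive_tr m n (M : R^o -> 'M[R]_(m, n)) :
  mderive (fun s => (M s)^T) s = (mderive M s)^T.
Proof. by apply/matrixP => i j; rewrite !mxE; under eq_fun do rewrite mxE. Qed.

Lemma mderive_inv n (M : R^o -> 'M[R]_n) : msmooth A M ->
  (forall x, A x -> M x \in unitmx) ->
  mderive (fun s => invmx (M s)) s = - (invmx (M s) *m mderive M s *m invmx (M s)).
Proof.
move=> sM uM; have sV := msmooth_inv Ao sM uM.
have : mderive (fun s => invmx (M s) *m M s) s = 0.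
  rewrite -(mderive_cst 1%:M); apply: near_eq_mderive.
  by near=> u; rewrite mulVmx // uM //; near: u; exact: open_nbhs_nbhs.
rewrite mderiveM // => /eqP; rewrite addr_eq0 => /eqP/(congr1 (mulmx^~ (invmx (M s)))).
by rewrite mulmxK ?uM // mulNmx.
Unshelve. all: by end_near.
Qed.

End MatrixDerive.

(** * Curves in the Lagrange Grassmannian *)

Section Dot.
Variables (R : realType).

Definition dot n (a b : 'rV[R]_n) : R := (a *m b^T) 0 0.

Lemma dotE n (a b : 'rV[R]_n) : dot a b = \sum_i a 0 i * b 0 i.
Proof. by rewrite /dot mxE; apply: eq_bigr => i _; rewrite mxE. Qed.

Lemma dotC n (a b : 'rV[R]_n) : dot a b = dot b a.
Proof. by rewrite !dotE; apply: eq_bigr => i _; rewrite mulrC. Qed.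

Lemma dotDl n (a b c : 'rV[R]_n) : dot (a + b) c = dot a c + dot b c.
Proof. by rewrite /dot mulmxDl mxE. Qed.

Lemma dotDr n (a b c : 'rV[R]_n) : dot c (a + b) = dot c a + dot c b.
Proof. by rewrite dotC dotDl !(dotC _ c). Qed.

Lemma dotZl n k (a c : 'rV[R]_n) : dot (k *: a) c = k * dot a c.
Proof. by rewrite /dot -scalemxAl mxE. Qed.

Lemma dotZr n k (a c : 'rV[R]_n) : dot c (k *: a) = k * dot c a.
Proof. by rewrite dotC dotZl dotC. Qed.

Lemma dotNl n (a c : 'rV[R]_n) : dot (- a) c = - dot a c.
Proof. by rewrite -scaleN1r dotZl mulN1r. Qed.

Lemma dotBl n (a b c : 'rV[R]_n) : dot (a - b) c = dot a c - dot b c.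
Proof. by rewrite dotDl dotNl. Qed.

Lemma dot0l n (c : 'rV[R]_n) : dot 0 c = 0.
Proof. by rewrite /dot mul0mx mxE. Qed.

Lemma dotMr k n (a : 'rV[R]_k) (b : 'rV[R]_n) (M : 'M[R]_(n, k)) :
  dot a (b *m M) = dot (a *m M^T) b.
Proof. by rewrite /dot trmx_mul mulmxA. Qed.

Lemma dot_delta n (a : 'rV[R]_n) i : dot a (delta_mx 0 i) = a 0 i.
Proof.
rewrite dotE (bigD1 i) //= big1 ?addr0 ?mxE ?eqxx ?mulr1 // => j ji.
by rewrite mxE (negbTE ji) andbF mulr0.
Qed.

Lemma dot_inj n (a b : 'rV[R]_n) : (forall c, dot a c = dot b c) -> a = b.
Proof. by move=> ab; apply/rowP => i; rewrite -!dot_delta. Qed.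

Lemma dot_quad_inj n (M N : 'M[R]_n) : M^T = M -> N^T = N ->
  (forall a, dot (a *m M) a = dot (a *m N) a) -> M = N.
Proof.
move=> Ms Ns MN; apply/row_matrixP => i; rewrite !rowE; apply: dot_inj => b.
set a := delta_mx _ _.
have dM (P : 'M[R]_n) : P^T = P -> dot (b *m P) a = dot (a *m P) b.
  by move=> Ps; rewrite dotC dotMr Ps.
have := MN (a + b); rewrite !mulmxDl !dotDl !dotDr !MN dM // (dM N) //; lra.
Qed.

End Dot.

(** * Linear coordinates of curves, Darboux frames and velocities *)

Section Curves.
Variables (R : realType) (V : vectType R).

(** [vderiv] is defined through the coordinates in one basis; this makes it available through any
    linear functional, in particular through Darboux coordinates. *)
Lemma smooth_curve_lin (u : 'Hom(V, R^o)) (l : R -> V) t :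
  smooth_curve_near l t ->
  smooth_near (fun s => u (l s) : R^o) t /\
  is_derive (t : R) (1 : R) (fun s => u (l s)) (u (vderiv l t)).
Proof.
move=> /choice[A AP].
pose B : set R^o := (\bigcap_(i in [set: 'I_(\dim (@fullv R V))]) A i)^°.
have Bo : open B by exact: open_interior.
have Bt : B t.
  have : \forall s \near t, forall i, A i s.
    by apply: (@filter_forall _ _ A (nbhs (t : R^o))) => i; have [? ? _] := AP i; exact: open_nbhs_nbhs.
  by apply: filterS => s As i _.
have lB i : smooth_on B (fun s => coord (vbasis fullv) i (l s) : R^o).
  by have [_ _] := AP i; apply: smooth_onS => s /interior_subset; apply.
pose c s : 'rV[R]_(\dim (@fullv R V)) := \row_i coord (vbasis fullv) i (l s).
pose U : 'cV[R]_(\dim (@fullv R V)) := \col_i u (vbasis (@fullv R V))`_i.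
have cB : msmooth B c by move=> i j; under eq_fun do rewrite mxE; exact: lB.
have UB : msmooth B (fun=> U) by exact: msmooth_cst.
have ucE : (fun s => u (l s)) = fun s => (c s *m U) 0 0.
  apply/funext => s; rewrite {1}(coord_vbasis (memvf (l s))) linear_sum mxE.
  by apply: eq_bigr => i _; rewrite linearZ /= !mxE.
split; first by exists B; split => //; rewrite ucE; exact: msmoothM.
rewrite ucE; have := msmooth_is_derive Bt 0 0 (msmoothM Bo cB UB).
rewrite (mderiveM Bt) // mderive_cst mulmx0 addr0.
set x := (_ *m U) 0 0; suff -> : u (vderiv l t) = x by [].
rewrite /x /vderiv linear_sum mxE; apply: eq_bigr => i _.
rewrite linearZ !mxE; congr (_ * _); congr (derive1 _ t).
by apply/funext => s; rewrite mxE.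
Qed.

End Curves.

(** The images of [e] and [f] are complementary Lagrangian subspaces of [S], put in duality by [sg].
    The sign is chosen so that the velocity of the graph of G is G' and not its opposite. The
    subspace [S] is kept general because the same notion serves for the reduced symplectic space. *)
Definition darboux (R : realType) (V : vectType R) (S : {vspace V})
    (sg : V -> V -> R) n (e f : 'Hom('rV[R]_n, V)) : Prop :=
  (forall v, v \in S <-> exists p a, v = e p + f a) /\
  (forall p a q b, sg (e p + f a) (e q + f b) = dot a q - dot p b).

Lemma near_open (R : realType) (A : set R^o) (t : R) :
  open A -> A t -> \forall s \near t, A s.
Proof. by move=> oA At; exact: (open_nbhs_nbhs (conj oA At)). Qed.

Section Darboux.
Variables (R : realType) (V : vectType R) (S : {vspace V}) (sg : V -> V -> R).
Variables (n : nat) (e f : 'Hom('rV[R]_n, V)).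
Hypothesis dbx : darboux S sg e f.

Lemma darboux_form p a q b : sg (e p + f a) (e q + f b) = dot a q - dot p b.
Proof. exact: dbx.2. Qed.

Lemma darboux_mem p a : e p + f a \in S.
Proof. by apply/dbx.1; exists p, a. Qed.

Lemma darboux_inj p a q b : e p + f a = e q + f b -> p = q /\ a = b.
Proof.
move=> pq; split; apply: dot_inj => c.
  have := darboux_form p a 0 c; rewrite pq darboux_form !(dotC _ 0) !dot0l; lra.
by have := darboux_form p a c 0; rewrite pq darboux_form !(dotC _ 0) !dot0l; lra.
Qed.

(** [S] may be a proper subspace of [V], so the coordinates come from a left inverse of the
    injective map [e + f]; outside [S] their values are arbitrary. *)
Lemma darboux_coord : exists xi eta : 'Hom(V, 'rV[R]_n),
  forall p a, xi (e p + f a) = p /\ eta (e p + f a) = a.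
Proof.
pose lsub : 'Hom('rV[R]_(n + n), 'rV[R]_n) := linfun (lsubmx : 'M[R]_(1, n + n) -> _).
pose rsub : 'Hom('rV[R]_(n + n), 'rV[R]_n) := linfun (rsubmx : 'M[R]_(1, n + n) -> _).
pose F := ((e \o lsub) + (f \o rsub))%VF.
have FE u : F u = e (lsubmx u) + f (rsubmx u).
  by rewrite add_lfunE !comp_lfunE !lfunE.
have Finj : lker F == 0%VS.
  apply/lker0P => u v; rewrite !FE => /darboux_inj[l r].
  by rewrite -[u]hsubmxK -[v]hsubmxK l r.
exists (lsub \o F^-1)%VF, (rsub \o F^-1)%VF => p a.
have -> : e p + f a = F (row_mx p a) by rewrite FE row_mxKl row_mxKr.
by rewrite !comp_lfunE lker0_lfunK // !lfunE /= row_mxKl row_mxKr.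
Qed.

(** The rows only have to generate [L]: the natural frame of a reduced curve has more rows than its
    dimension. *)
Definition framed k (X Y : 'M[R]_(k, n)) (L : {vspace V}) : Prop :=
  forall v, v \in L <-> exists p, v = e (p *m X) + f (p *m Y).

Lemma smooth_frame (A : set R^o) (Xp Yp : R^o -> 'rV[R]_n) t : open A -> A t ->
  msmooth A Xp -> msmooth A Yp ->
  smooth_curve_near (fun s => e (Xp s) + f (Yp s)) t.
Proof.
move=> oA At sX sY i; exists A; split => //.
have lin (h : 'Hom('rV[R]_n, V)) (Z : R^o -> 'rV[R]_n) : msmooth A Z ->
    smooth_on A (fun s => coord (vbasis fullv) i (h (Z s)) : R^o).
  move=> sZ.
  under eq_fun => s do rewrite (row_sum_delta (Z s)) !linear_sum /=.
  apply: smooth_on_sum => // j.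
  under eq_fun => s do rewrite !linearZ /=.
  by apply: smooth_onM => //; exact: smooth_on_cst.
by under eq_fun do rewrite linearD /=; apply: smooth_onD => //; exact: lin.
Qed.

(** The section [l] picked by [velocity] need not have smooth coefficients in a redundant frame. It
    is compared with the section [l0] of constant coefficients [p]: both lie in the isotropic [C s],
    so [sg (l s) (l0 s)] is zero near [t], and since both take the value [v] at [t], differentiating
    shows that their derivatives pair equally with [v]. *)
Lemma velocity_frame k (A : set R^o) (X Y : R^o -> 'M[R]_(k, n)) C t p :
  open A -> A t -> msmooth A X -> msmooth A Y ->
  (forall s, A s -> X s *m (Y s)^T = Y s *m (X s)^T) ->
  (forall s, A s -> framed (X s) (Y s) (C s)) ->
  velocity sg C t (e (p *m X t) + f (p *m Y t)) =
  dot (p *m (mderive Y t *m (X t)^T - mderive X t *m (Y t)^T)) p.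
Proof.
move=> oA At sX sY XY CE; set v := e _ + f _.
have cA k1 k2 (M : 'M[R]_(k1, k2)) : msmooth A (fun=> M) by exact: msmooth_cst.
pose l0 s := e (p *m X s) + f (p *m Y s).
have l0P : section_at C t v l0.
  split => //; first exact: (smooth_frame oA At (msmoothM oA (cA _ _ p) sX) (msmoothM oA (cA _ _ p) sY)).
  near=> s; apply/CE; last by exists p.
  by near: s; exact: near_open.
rewrite /velocity; case: xgetP => [l _ [ls lC lt]|/(_ l0)/(_ l0P)//].
have [xi [eta xe]] := darboux_coord.
have lE : \forall s \near t, l s = e (xi (l s)) + f (eta (l s)) /\ dot (eta (l s)) (p *m X s) = dot (xi (l s)) (p *m Y s).
  near=> s.
  have As : A s by near: s; exact: near_open.
  have : l s \in C s by near: s.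
  move=> /(CE _ As)[q ->]; have [-> ->] := xe (q *m X s) (q *m Y s); split => //.
  by rewrite !dotMr -!mulmxA XY.
have d_lin (u : 'Hom(V, 'rV[R]_n)) i : smooth_near (fun s => u (l s) 0 i : R^o) t /\
    is_derive (t : R) (1 : R) (fun s => u (l s) 0 i) (u (vderiv l t) 0 i).
  pose g : 'rV[R]_n -> R^o := fun r => r 0 i.
  have gl : linear g by move=> a x y; rewrite /g !mxE.
  pose gL : {linear 'rV[R]_n -> R^o} := HB.pack g (GRing.isLinear.Build _ _ _ _ _ gl).
  have := smooth_curve_lin (linfun gL \o u)%VF ls.
  have -> : (fun s => (linfun gL \o u)%VF (l s)) = fun s => u (l s) 0 i.
    by apply/funext => s; rewrite comp_lfunE lfunE.
  by rewrite comp_lfunE lfunE.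
(* The derivative of [l] stays in [S], as the form is only controlled there: the linear map [h]
   vanishes on [S], hence along [l], hence on the derivative. *)
have vS : vderiv l t = e (xi (vderiv l t)) + f (eta (vderiv l t)).
  pose h := (\1 - ((e \o xi) + (f \o eta)))%VF.
  have hE v' : h v' = v' - (e (xi v') + f (eta v')).
    by rewrite add_lfunE opp_lfunE add_lfunE !comp_lfunE id_lfunE.
  suff : h (vderiv l t) = 0 by rewrite hE => /eqP; rewrite subr_eq0 => /eqP.
  rewrite (coord_vbasis (memvf (h _))) big1 // => i _.
  pose c : 'Hom(V, R^o) := linfun (coord (vbasis (@fullv R V)) i : V -> R^o).
  have [_ d1] := smooth_curve_lin (c \o h)%VF ls.
  have : is_derive (t : R) (1 : R) (fun s => (c \o h)%VF (l s)) (0 : R).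
    apply: (@near_eq_is_derive _ _ _ (fun=> 0)).
    apply: filterS lE => s [ls0 _].
    by rewrite comp_lfunE hE -ls0 subrr linear0.
  move=> [_ d2]; move: d1 => [_]; rewrite d2 comp_lfunE lfunE /= => <-.
  by rewrite scale0r.
pose x s := xi (l s); pose y s := eta (l s).
have [B [oB Bt [sx sy sXB sYB]]] : exists B : set R^o, [/\ open B, B t &
    [/\ msmooth B x, msmooth B y, msmooth B X & msmooth B Y]].
  have /choice[Bx BxP] : forall i, exists B : set R^o, [/\ open B, B t & smooth_on B (fun s => x s 0 i : R^o)].
    by move=> i; have [[B ?] _] := d_lin xi i; exists B.
  have /choice[By ByP] : forall i, exists B : set R^o, [/\ open B, B t & smooth_on B (fun s => y s 0 i : R^o)].
    by move=> i; have [[B ?] _] := d_lin eta i; exists B.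
  exists (A `&` ((\bigcap_(i in [set: 'I_n]) Bx i)^° `&` (\bigcap_(i in [set: 'I_n]) By i)^°)); split.
  - by apply: openI => //; apply: openI; exact: open_interior.
  - split => //; split.
      have : \forall s \near t, forall i, Bx i s.
        by apply: (@filter_forall _ _ Bx (nbhs (t : R^o))) => i; have [? ? _] := BxP i; exact: open_nbhs_nbhs.
      by apply: filterS => s As i _.
    have : \forall s \near t, forall i, By i s.
      by apply: (@filter_forall _ _ By (nbhs (t : R^o))) => i; have [? ? _] := ByP i; exact: open_nbhs_nbhs.
    by apply: filterS => s As i _.
  - split.
    + move=> i j; rewrite (ord1 i); have [_ _] := BxP j; apply: smooth_onS.
      by move=> s [_ [/interior_subset+ _]]; apply.
    + move=> i j; rewrite (ord1 i); have [_ _] := ByP j; apply: smooth_onS.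
      by move=> s [_ [_ /interior_subset]]; apply.
    + by move=> i j; apply: smooth_onS (sX i j) => s [].
    + by move=> i j; apply: smooth_onS (sY i j) => s [].
have cB k1 k2 (M : 'M[R]_(k1, k2)) : msmooth B (fun=> M) by exact: msmooth_cst.
have dx : mderive x t = xi (vderiv l t).
  apply/rowP => i; have [_ [_ <-]] := d_lin xi i.
  by rewrite mxE derive1E.
have dy : mderive y t = eta (vderiv l t).
  apply/rowP => i; have [_ [_ <-]] := d_lin eta i.
  by rewrite mxE derive1E.
have [xt yt] : x t = p *m X t /\ y t = p *m Y t.
  by rewrite /x /y lt /v; exact: xe.
(* The expression under the derivative is the pairing of [l s] with [l0 s] in Darboux
   coordinates. *)
have : mderive (fun s => y s *m (p *m X s)^T - x s *m (p *m Y s)^T) t = 0.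
  rewrite -(mderive_cst t (0 : 'M[R]_1)); apply: near_eq_mderive.
  apply: filterS lE => s [_ ds].
  apply/matrixP => i j; rewrite !ord1 mxE [in X in _ + X]mxE [RHS]mxE.
  by move: ds; rewrite /dot => ->; rewrite subrr.
have sM1 : msmooth B (fun s => (p *m X s)^T) by apply: msmooth_tr; exact: msmoothM.
have sM2 : msmooth B (fun s => (p *m Y s)^T) by apply: msmooth_tr; exact: msmoothM.
rewrite (mderiveB oB Bt); [|exact: msmoothM|exact: msmoothM].
rewrite !(mderiveM Bt) // !mderive_tr !(mderiveM Bt) // mderive_cst !mul0mx !add0r xt yt dx dy.
have mx4 (a b c d : 'M[R]_1) : (a + b - (c + d)) 0 0 = a 0 0 + b 0 0 - (c 0 0 + d 0 0).
  by rewrite !mxE.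
move=> /(congr1 (fun M : 'M[R]_(1, 1) => M 0 0)); rewrite /= mx4 [RHS]mxE.
rewrite -!/(dot _ _) => E.
rewrite vS /v darboux_form.
rewrite mulmxBr dotBl !mulmxA -!dotMr (dotC (p *m mderive Y t)) (dotC (p *m mderive X t)).
lra.
Unshelve. all: by end_near.
Qed.

Definition frame_velocity k (X Y : R^o -> 'M[R]_(k, n)) t : 'M[R]_k :=
  mderive Y t *m (X t)^T - mderive X t *m (Y t)^T.

Lemma frame_velocity_sym k (A : set R^o) (X Y : R^o -> 'M[R]_(k, n)) t :
  open A -> A t -> msmooth A X -> msmooth A Y ->
  (forall s, A s -> X s *m (Y s)^T = Y s *m (X s)^T) ->
  (frame_velocity X Y t)^T = frame_velocity X Y t.
Proof.
move=> oA At sX sY XY.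
have sXt := msmooth_tr sX; have sYt := msmooth_tr sY.
have : mderive (fun s => X s *m (Y s)^T) t = mderive (fun s => Y s *m (X s)^T) t.
  apply: near_eq_mderive; near=> s; apply: XY; near: s; exact: near_open.
rewrite !(mderiveM At) // !mderive_tr /frame_velocity linearB /= !trmx_mul !trmxK => E.
by apply/eqP; rewrite subr_eq addrAC -E addrAC subrr add0r.
Unshelve. all: by end_near.
Qed.

Lemma polar_velocity_frame k (A : set R^o) (X Y : R^o -> 'M[R]_(k, n)) C t p q :
  open A -> A t -> msmooth A X -> msmooth A Y ->
  (forall s, A s -> X s *m (Y s)^T = Y s *m (X s)^T) ->
  (forall s, A s -> framed (X s) (Y s) (C s)) ->
  polar (velocity sg C t) (e (p *m X t) + f (p *m Y t)) (e (q *m X t) + f (q *m Y t)) =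
  dot (p *m frame_velocity X Y t) q.
Proof.
move=> oA At sX sY XY CE.
have vE r := velocity_frame r oA At sX sY XY CE.
rewrite /polar addrACA -!linearD -!mulmxDl !vE -/(frame_velocity X Y t).
have Bs := frame_velocity_sym oA At sX sY XY.
rewrite !mulmxDl !dotDl !dotDr (dotC (q *m _) p) dotMr Bs.
by field.
Qed.

End Darboux.

Lemma linfun_eq (R : realType) (U V : vectType R) (g : U -> V) (h : 'Hom(U, V)) :
  g =1 h -> linfun g = h.
Proof. by move=> /funext ->; apply/lfunP => u; rewrite lfunE. Qed.

(** * The maps [Bmap] and [Imap], and Lagrangian subspaces given by frames *)

Section Frames.
Variables (R : realType) (V : vectType R) (S : {vspace V}) (sg : V -> V -> R).
Variables (n : nat) (e f : 'Hom('rV[R]_n, V)).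
Hypothesis dbx : darboux S sg e f.

(** [sg] is bilinear on [S] only, whereas [linfun] is meaningful only on linear maps. A linear
    extension of [sg x] is therefore needed before [Bmap] can be evaluated. *)
Lemma form_lin x : x \in S -> exists h : 'Hom(V, R^o), forall w, w \in S -> h w = sg x w.
Proof.
move=> /dbx.1[p [a ->]]; have [xi [eta xe]] := darboux_coord dbx.
pose g w : R^o := dot a (xi w) - dot p (eta w).
have gl : linear g.
  by move=> k u v; rewrite /g !linearP /= !dotDr !dotZr /GRing.scale /=; ring.
pose gL : {linear V -> R^o} := HB.pack g (GRing.isLinear.Build _ _ _ _ _ gl).
exists (linfun gL) => w /dbx.1[q [b ->]].
by rewrite lfunE /= /g (darboux_form dbx); have [-> ->] := xe q b.
Qed.

Lemma BmapE L x w : x \in S -> (L <= S)%VS -> Bmap sg L x w = sg x (vsval w).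
Proof.
move=> /form_lin[h hE] LS.
have E : (fun v : subvs_of L => sg x (vsval v) : R^o) =1 (h \o linfun vsval)%VF.
  by move=> v; rewrite comp_lfunE lfunE /= hE // (subvP LS) // subvsP.
by rewrite /Bmap (linfun_eq E) comp_lfunE lfunE /= hE // (subvP LS) // subvsP.
Qed.

Lemma ImapE L G (phi : dual L) y : (L <= S)%VS -> (G <= S)%VS -> y \in G ->
  (forall w : subvs_of L, phi w = sg y (vsval w)) ->
  (forall z, z \in G -> (forall w, w \in L -> sg z w = sg y w) -> z = y) ->
  Imap sg G phi = y.
Proof.
move=> LS GS yG phiE yU; rewrite /Imap; case: xgetP => [z _ [zG zB]|/(_ y)]; last first.
  by case; split => //; apply/lfunP => w; rewrite BmapE ?phiE // (subvP GS).
apply: yU => // w wL.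
by rewrite -(vsprojK wL) -BmapE ?(subvP GS) // zB phiE.
Qed.

Lemma framed_sub k (X Y : 'M[R]_(k, n)) L : framed e f X Y L -> (L <= S)%VS.
Proof.
by move=> LE; apply/subvP => v /LE[p ->]; exact: (darboux_mem dbx).
Qed.

Lemma framed_mem k (X Y : 'M[R]_(k, n)) L p : framed e f X Y L ->
  e (p *m X) + f (p *m Y) \in L.
Proof. by move=> LE; apply/LE; exists p. Qed.

Lemma framed_lagrangian k (X Y : 'M[R]_(k, n)) L : framed e f X Y L ->
  X *m Y^T = Y *m X^T ->
  (forall x y : 'rV[R]_n, y *m X^T = x *m Y^T ->
     exists p, x = p *m X /\ y = p *m Y) ->
  lagrangian S sg L.
Proof.
move=> LE XY Lmax; split; first exact: framed_sub LE.
move=> v /dbx.1[x [y ->]]; split.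
  move=> /LE[p ->] w /LE[q ->].
  by rewrite (darboux_form dbx) !dotMr -!mulmxA XY subrr.
move=> h; have [p [-> ->]] : exists p, x = p *m X /\ y = p *m Y; last exact: framed_mem.
apply: Lmax; apply: dot_inj => q.
have := h _ (framed_mem q LE); rewrite (darboux_form dbx) !dotMr => /eqP.
by rewrite subr_eq0 => /eqP.
Qed.

Lemma graph_lagrangian (M : 'M[R]_n) L : framed e f 1%:M M L -> M^T = M -> lagrangian S sg L.
Proof.
move=> LE Ms; apply: (framed_lagrangian LE); first by rewrite Ms mul1mx trmx1 mulmx1.
by move=> x y; rewrite trmx1 mulmx1 Ms => ->; exists x; rewrite mulmx1.
Qed.

(** The vector with parameter [b] is [f b] plus the point of the graph of [M] over [b *m T], and [b]
    is recovered from the coordinates as [y - x *m M]. The symmetric matrix [T] is thus an affine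
    coordinate on the Lagrangian complements of the graph. *)
Lemma transverse_lagrangian (M T : 'M[R]_n) L : framed e f T (1%:M + T *m M) L ->
  M^T = M -> T^T = T -> lagrangian S sg L.
Proof.
move=> LE Ms Ts; have E : (1%:M + T *m M)^T = 1%:M + M *m T.
  by rewrite linearD /= trmx1 trmx_mul Ms Ts.
apply: (framed_lagrangian LE).
  by rewrite E Ts mulmxDr mulmxDl mulmx1 mul1mx mulmxA.
move=> x y; rewrite E Ts mulmxDr mulmx1 mulmxA => h.
exists (y - x *m M); rewrite mulmxBl h addrK; split => //.
by rewrite mulmxDr mulmx1 mulmxA mulmxBl h addrK subrK.
Qed.

Lemma graph_dual (M : 'M[R]_n) L (phi : dual L) : framed e f 1%:M M L ->
  exists a, forall (w : subvs_of L) q, vsval w = e q + f (q *m M) -> phi w = dot a q.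
Proof.
move=> LE; exists (\row_i phi (vsproj L (e (delta_mx 0 i) + f (delta_mx 0 i *m M)))) => w q wE.
have mem r : e r + f (r *m M) \in L.
  by have := framed_mem r LE; rewrite mulmx1.
have -> : w = \sum_i q 0 i *: vsproj L (e (delta_mx 0 i) + f (delta_mx 0 i *m M)).
  apply: val_inj; rewrite /= wE linear_sum /= {1 2}(row_sum_delta q).
  rewrite mulmx_suml !linear_sum -big_split; apply: eq_bigr => i _ /=.
  by rewrite linearZ -scalemxAl !linearZ /= vsprojK // -scalerDr.
rewrite linear_sum dotE; apply: eq_bigr => i _.
by rewrite linearZ /= mxE mulrC.
Qed.

End Frames.

(** * The derivative curve of a graph *)

Section GraphCurve.
Variables (R : realType) (V : vectType R) (S : {vspace V}) (sg : V -> V -> R).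
Variables (n : nat) (e f : 'Hom('rV[R]_n, V)).
Hypothesis dbx : darboux S sg e f.
Variables (C : R -> {vspace V}) (A : set R^o) (G : R^o -> 'M[R]_n).
Hypotheses (oA : open A) (Gsm : msmooth A G).
Hypothesis Gs : forall s, A s -> (G s)^T = G s.
Hypothesis CE : forall s, A s -> framed e f 1%:M (G s) (C s).
Hypothesis G'u : forall s, A s -> mderive G s \in unitmx.

Local Notation G' := (mderive G).
Local Notation G'' := (mderive (mderive G)).

(* the free term at [s] of the Laurent expansion of
   [u |-> invmx (G u - G s)] *)
Definition derivative_param s : 'M[R]_n :=
  - (2^-1 *: (invmx (G' s) *m G'' s *m invmx (G' s))).
Local Notation T := derivative_param.

Lemma graph_derive_sym s : A s -> (G' s)^T = G' s.
Proof.
move=> As; rewrite -mderive_tr; apply: near_eq_mderive.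
near=> u; apply: Gs; near: u; exact: near_open.
Unshelve. all: by end_near.
Qed.

Lemma graph_derive2_sym s : A s -> (G'' s)^T = G'' s.
Proof.
move=> As; rewrite -mderive_tr; apply: near_eq_mderive.
near=> u; apply: graph_derive_sym; near: u; exact: near_open.
Unshelve. all: by end_near.
Qed.

Lemma derivative_param_smooth : msmooth A T.
Proof.
have sG' := msmooth_derive Gsm; have sV := msmooth_inv oA sG' G'u.
apply: msmoothN => //; apply: msmoothZ => //; apply: msmoothM => //.
apply: msmoothM => //; exact: msmooth_derive.
Qed.

Lemma derivative_param_sym s : A s -> (T s)^T = T s.
Proof.
move=> As; rewrite linearN /= linearZ /= !trmx_mul trmx_inv.
by rewrite graph_derive_sym // graph_derive2_sym // !mulmxA.
Qed.

(** The difference quotient of [G], smooth across [s = t]. Its value at [t] is the invertible G'(t),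
    so its inverse is smooth near [t] and shows that the inverse of [G s - G t] has a simple
    pole. *)
Definition graph_quotient t s : 'M[R]_n :=
  \matrix_(i, j) hadamard t 1 (fun s => G s i j - G t i j) s.

Lemma graph_quotient_ne t s : s != t ->
  G s - G t = (s - t) *: graph_quotient t s.
Proof.
move=> st; apply/matrixP => i j; rewrite !mxE /hadamard (negbTE st) expr1.
by rewrite mulrC divfK // subr_eq0.
Qed.

Let diff_smooth t i j : smooth_on A (fun s => G s i j - G t i j : R^o).
Proof. by apply: smooth_onB => //; exact: smooth_on_cst. Qed.

Let diff0 t i j k : (k < 1)%N -> derive1n k (fun s => G s i j - G t i j) t = 0 :> R.
Proof. by case: k => //= _; rewrite subrr. Qed.

Let diff1 t i j s : A s ->
  derive1 (fun s => G s i j - G t i j) s = G' s i j.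
Proof.
move=> As; have d := msmooth_is_derive As i j Gsm.
rewrite derive1E (@deriveB _ _ _ (fun s => G s i j) (cst (G t i j))) ?derive_val //.
by rewrite subr0.
Qed.

Lemma graph_quotient_smooth t : A t -> msmooth A (graph_quotient t).
Proof.
move=> At i j; under eq_fun do rewrite mxE.
by apply: (hadamard_smooth oA (diff_smooth t i j) At) => k; exact: diff0.
Qed.

Lemma graph_quotientE t : A t -> graph_quotient t t = G' t.
Proof.
by move=> At; apply/matrixP => i j; rewrite mxE /hadamard eqxx /= diff1 // divr1.
Qed.

Lemma graph_quotient_derive t : A t -> mderive (graph_quotient t) t = 2^-1 *: G'' t.
Proof.
move=> At; apply/matrixP => i j; rewrite mxE [RHS]mxE.
under eq_fun do rewrite mxE.
have h := hadamard_is_derive oA (diff_smooth t i j) At At (fun k => @diff0 t i j k).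
rewrite derive1E; have [_ ->] := h.
rewrite /hadamard eqxx.
rewrite (derive1n_hadamard_next oA t 1 2 (diff_smooth t i j) At).
rewrite subrr mul0r add0r (_ : 2%:R - 1%:R = 1); last by ring.
rewrite mul1r (_ : 2`! = 2)%N // mulrC; congr (_ * _).
rewrite derive1nS mxE [LHS]derive1E derive1E; apply: near_eq_derive.
near=> s; rewrite [LHS]diff1 //; near: s; exact: near_open.
Unshelve. all: by end_near.
Qed.

Lemma graph_quotient_unit t : A t -> \forall s \near t, graph_quotient t s \in unitmx.
Proof.
move=> At; have sd := smooth_on_det oA (graph_quotient_smooth At).
have : \det (graph_quotient t t) != 0.
  by rewrite graph_quotientE // -unitfE -unitmxE G'u.
have c := smooth_on_continuous sd At.
move=> d0.
have : \forall s \near t, \det (graph_quotient t s) != 0.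
  exact: (c [set y | y != 0] (open_nbhs_nbhs (conj (@open_neq R^o 0) d0))).
by apply: filterS => s; rewrite unitmxE unitfE.
Qed.

Lemma graph_mem t v : A t -> v \in C t <-> exists p, v = e p + f (p *m G t).
Proof.
move=> At; split=> [/(CE At)[p ->]|[p ->]]; first by exists p; rewrite mulmx1.
by apply/(CE At); exists p; rewrite mulmx1.
Qed.

Lemma graph_sub t : A t -> (C t <= S)%VS.
Proof. by move=> At; exact: (framed_sub dbx (CE At)). Qed.

Lemma near_graph_diff_unit t : A t -> \forall s \near t^', G s - G t \in unitmx.
Proof.
move=> At; near=> s.
have st : s != t by near: s; exact: nbhs_dnbhs_neq.
rewrite graph_quotient_ne // unitmxZ ?unitfE ?subr_eq0 //.
near: s; apply: nbhs_dnbhs; exact: graph_quotient_unit.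
Unshelve. all: by end_near.
Qed.

Lemma Imap_graph s t (phi : dual (C t)) a : A s -> A t -> G s - G t \in unitmx ->
  (forall (w : subvs_of (C t)) q, vsval w = e q + f (q *m G t) -> phi w = dot a q) ->
  let p := a *m invmx (G s - G t) in
  Imap sg (C s) phi = e p + f (p *m G s).
Proof.
move=> As At u phiE p.
have formE r q : sg (e r + f (r *m G s)) (e q + f (q *m G t)) = dot (r *m (G s - G t)) q.
  by rewrite (darboux_form dbx) dotMr Gs // -dotBl -mulmxBr.
apply: (ImapE dbx); [exact: graph_sub|exact: graph_sub|by apply/(graph_mem _ As); exists p| |].
  move=> w; have /(graph_mem _ At)[q wE] := subvsP w.
  by rewrite (phiE _ _ wE) wE formE mulmxKV.
move=> z /(graph_mem _ As)[r ->] h; suff -> : r = p by [].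
apply: (can_inj (mulmxK u)); apply: dot_inj => q; rewrite -!formE; apply: h.
by apply/(graph_mem _ At); exists q.
Qed.

Lemma Imap_transverse t (phi : dual (C t)) a M D : A t -> M^T = M ->
  framed e f M (1%:M + M *m G t) D ->
  (forall (w : subvs_of (C t)) q, vsval w = e q + f (q *m G t) -> phi w = dot a q) ->
  Imap sg D phi = e (a *m M) + f (a *m (1%:M + M *m G t)).
Proof.
move=> At Ms DE phiE.
have formE b q : sg (e (b *m M) + f (b *m (1%:M + M *m G t))) (e q + f (q *m G t)) = dot b q.
  rewrite (darboux_form dbx) dotMr Gs // -dotBl mulmxDr mulmx1 !mulmxA.
  by rewrite addrK.
apply: (ImapE dbx); [exact: graph_sub|exact: (framed_sub dbx DE)|exact: framed_mem| |].
  by move=> w; have /(graph_mem _ At)[q wE] := subvsP w; rewrite (phiE _ _ wE) wE formE.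
move=> z /DE[b ->] h; suff -> : b = a by [].
apply: dot_inj => q; rewrite -!formE; apply: h.
by apply/(graph_mem _ At); exists q.
Qed.

Lemma Imap_graph_of_transverse t M D (phi : dual D) c : A t -> M^T = M ->
  framed e f M (1%:M + M *m G t) D ->
  (forall (w : subvs_of D) b, vsval w = e (b *m M) + f (b *m (1%:M + M *m G t)) ->
    phi w = dot c b) ->
  Imap sg (C t) phi = e (- c) + f (- c *m G t).
Proof.
move=> At Ms DE phiE.
have formE q b : sg (e q + f (q *m G t)) (e (b *m M) + f (b *m (1%:M + M *m G t))) = - dot q b.
  rewrite (darboux_form dbx) mulmxDr mulmx1 dotDr mulmxA [dot q (_ *m G t)]dotMr Gs //.
  by ring.
apply: (ImapE dbx); [exact: (framed_sub dbx DE)|exact: graph_sub|by apply/(graph_mem _ At); exists (- c)| |].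
  by move=> w; have /DE[b wE] := subvsP w; rewrite (phiE _ _ wE) wE formE dotNl opprK.
move=> z /(graph_mem _ At)[r ->] h; suff -> : r = - c by [].
apply: dot_inj => b; apply: oppr_inj; rewrite -!formE; apply: h.
exact: framed_mem.
Qed.

(** With Q the difference quotient of [G], the function equals
    [((s - t) c - a Q(s)^-1 a^T) / (s - t)], where [c] is the value of [M] on [a]. The free term is
    the derivative of the numerator at [t]; since Q'(t) = G''(t)/2, differentiating the inverse of Q
    produces the matrix [T t]. *)
Lemma affine_diff_free_term t (phi : dual (C t)) a M D : A t -> M^T = M ->
  framed e f M (1%:M + M *m G t) D ->
  (forall (w : subvs_of (C t)) q, vsval w = e q + f (q *m G t) -> phi w = dot a q) ->
  laurent_free_term (fun s => affine_diff sg (C s) D phi) t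
    (dot (a *m M) a - dot (a *m T t) a).
Proof.
move=> At Ms DE phiE.
pose Q := graph_quotient t.
have sQ : msmooth A Q by exact: graph_quotient_smooth.
pose B : set R^o := A `&` [set s | Q s \in unitmx]^°.
have oB : open B by apply: openI => //; exact: open_interior.
have Bt : B t by split => //; exact: graph_quotient_unit.
have sQB : msmooth B Q by move=> i j; apply: smooth_onS (sQ i j) => s [].
have uB s : B s -> Q s \in unitmx by move=> [_ /interior_subset].
have sV := msmooth_inv oB sQB uB.
pose c := dot (a *m M) a.
pose h s : 'M[R]_1 := a *m invmx (Q s) *m a^T.
have sh : msmooth B h.
  by apply: msmoothM (msmooth_cst oB _) => //; apply: msmoothM (sV) => //; exact: msmooth_cst.
pose g s : R^o := (s - t) * c - h s 0 0.
have sg' : smooth_on B g.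
  apply: smooth_onB => //.
  apply: smooth_onM => //; last exact: smooth_on_cst.
  by apply: smooth_onB => //; [exact: smooth_on_id|exact: smooth_on_cst].
exists 1%N, g; split; first by exists B.
- near=> s.
  have st : s != t by near: s; exact: nbhs_dnbhs_neq.
  have As : A s by near: s; apply: nbhs_dnbhs; exact: near_open.
  have u : G s - G t \in unitmx by near: s; exact: near_graph_diff_unit.
  rewrite /affine_diff (Imap_graph As At u phiE) (Imap_transverse At Ms DE phiE).
  rewrite (darboux_form dbx) mulmxDr mulmx1 dotDr mulmxA [dot _ (_ *m G t)]dotMr Gs //.
  rewrite opprD addrCA -dotBl -mulmxBr mulmxKV // dotMr Ms addrC -/c.
  rewrite /g expr1 mulrBl mulrAC divff ?subr_eq0 // mul1r; congr (_ - _).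
  rewrite /h -/(dot _ _) graph_quotient_ne // invmxZ ?unitfE ?subr_eq0 //.
    by rewrite -scalemxAr dotZl mulrC.
  by move: u; rewrite graph_quotient_ne // unitmxZ ?unitfE ?subr_eq0.
- rewrite (_ : 1`! = 1)%N // divr1 /=.
  have dh := msmooth_is_derive Bt 0 0 sh.
  have dg : is_derive (t : R) (1 : R) g (c - mderive h t 0 0).
    have d1 : is_derive (t : R) (1 : R) (fun s : R => (s - t) * c) c.
      rewrite (_ : (fun s : R => _) = (id - cst t) * cst c); last by apply/funext.
      by apply: is_derive_eq; rewrite /GRing.scale /= mulr0 add0r subr0 mulr1.
    exact: is_deriveB.
  rewrite derive1E; have [_ ->] := dg; congr (_ - _).
  rewrite /h (mderiveM Bt); [|by apply: msmoothM sV => //; exact: msmooth_cst|exact: msmooth_cst].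
  rewrite (mderiveM Bt); [|exact: msmooth_cst|exact: sV].
  rewrite !mderive_cst mulmx0 addr0 mul0mx add0r (mderive_inv oB Bt sQB uB).
  by rewrite graph_quotient_derive // /Q graph_quotientE // -scalemxAr -scalemxAl.
Unshelve. all: by end_near.
Qed.

(** The vertical coordinate relative to the graph, [al], represents the pairing with [C t].
    Transversality and maximal isotropy make it a bijection from [D] to rows; reading the horizontal
    coordinate as a function of it gives [M]. *)
Lemma transverse_framed t D : A t -> Defs.transversal S sg (C t) D ->
  exists2 M, M^T = M & framed e f M (1%:M + M *m G t) D.
Proof.
move=> At [[DS Dlag] D0].
have [xi [eta xe]] := darboux_coord dbx.
pose al : 'Hom(V, 'rV[R]_n) := (eta - (linfun (mulmxr (G t)) \o xi))%VF.
have alV v : al v = eta v - xi v *m G t.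
  by rewrite add_lfunE opp_lfunE comp_lfunE lfunE.
have decomp v : v \in S -> v = e (xi v) + f (xi v *m G t) + f (al v).
  move=> /dbx.1[p [a ->]]; rewrite alV; have [-> ->] := xe p a.
  by rewrite -addrA -linearD /= addrCA subrr addr0.
have alE v q : v \in S -> sg v (e q + f (q *m G t)) = dot (al v) q.
  move=> /dbx.1[p [a ->]]; rewrite (darboux_form dbx) dotMr Gs // -dotBl alV.
  by have [-> ->] := xe p a.
pose b := vbasis D.
have bD i : b`_i \in D.
  have [ib|ib] := ltnP i (\dim D); last by rewrite nth_default ?size_tuple // mem0v.
  by apply: vbasis_mem; rewrite mem_nth // size_tuple.
pose X : 'M[R]_(\dim D, n) := \matrix_i xi b`_i.
pose N : 'M[R]_(\dim D, n) := \matrix_i al b`_i.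
pose be (r : 'rV[R]_(\dim D)) := \sum_i r 0 i *: b`_i.
have beD r : be r \in D by apply: memv_suml => i _; apply: memvZ.
have xibe r : xi (be r) = r *m X.
  rewrite /be linear_sum mulmx_sum_row; apply: eq_bigr => i _.
  by rewrite linearZ /= rowK.
have albe r : al (be r) = r *m N.
  rewrite /be linear_sum mulmx_sum_row; apply: eq_bigr => i _.
  by rewrite linearZ /= rowK.
have bev v : v \in D -> exists r, v = be r.
  move=> vD; exists (\row_i coord b i v); rewrite {1}(coord_vbasis vD).
  by apply: eq_bigr => i _; rewrite mxE.
have C0 v : v \in D -> v \in C t -> v = 0.
  by move=> vD vC; apply/eqP; rewrite -memv0 -D0 memv_cap vD.
(* Surjectivity of [al] on [D]: a row [q] orthogonal to its image gives a vector of the graph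
   skew-orthogonal to [D], which lies in [D] by maximality and so vanishes by transversality. *)
have [P PN] : exists P, P *m N = 1%:M.
  apply/row_fullP; rewrite /row_full -mxrank_tr; apply/eqP.
  suff : row_free N^T by rewrite /row_free => /eqP.
  apply: inj_row_free => q q0.
  have gD : e q + f (q *m G t) \in D.
    apply/Dlag; first exact: (darboux_mem dbx).
    move=> w wD; have wS : w \in S by apply: (subvP DS).
    have /dbx.1[p [a wE]] := wS.
    have : sg w (e q + f (q *m G t)) = 0.
      have [r wr] := bev _ wD.
      by rewrite alE // wr albe dotC dotMr q0 dot0l.
    rewrite wE !(darboux_form dbx) (dotC q) (dotC p) => E.
    by apply/eqP; rewrite -oppr_eq0 opprB E.
  have := C0 _ gD; rewrite (graph_mem _ At) => /(_ (ex_intro _ q erefl)).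
  move=> E; have := @darboux_inj _ _ _ _ _ _ _ dbx q (q *m G t) 0 0.
  by rewrite E !linear0 addr0 => /(_ erefl)[].
pose M := P *m X.
have xM a : xi (be (a *m P)) = a *m M by rewrite xibe mulmxA.
have aM a : al (be (a *m P)) = a by rewrite albe -mulmxA PN mulmx1.
have eM a : be (a *m P) = e (a *m M) + f (a *m (1%:M + M *m G t)).
  rewrite [LHS]decomp ?(subvP DS) // xM aM -addrA -linearD /= mulmxDr mulmx1 mulmxA.
  by rewrite [a + _]addrC.
have DE : framed e f M (1%:M + M *m G t) D.
  move=> v; split=> [vD|[a ->]]; last by rewrite -eM.
  have [r vr] := bev _ vD; exists (r *m N); rewrite -eM; apply/eqP; rewrite -subr_eq0; apply/eqP.
  have wD : v - be (r *m N *m P) \in D by apply: memvB.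
  apply: C0 => //; apply/(graph_mem _ At); exists (xi (v - be (r *m N *m P))).
  rewrite [LHS]decomp ?(subvP DS) // (_ : al _ = 0) ?linear0 ?addr0 //.
  by rewrite linearB /= aM vr albe subrr.
exists M => //.
(* The symmetry of [M] is the isotropy of [D]: the terms with [G t] cancel because [G t] is
   symmetric. *)
apply/row_matrixP => i; rewrite !rowE; apply: dot_inj => q; set a := delta_mx _ _.
have : sg (be (a *m P)) (be (q *m P)) = 0.
  by apply: (Dlag _ _).1 => //; rewrite (subvP DS).
rewrite !eM (darboux_form dbx) !mulmxDr !mulmx1 dotDl dotDr !mulmxA.
rewrite [dot _ (_ *m G t)]dotMr Gs // => E; rewrite -(dotMr a) /M !mulmxA; lra.
Qed.

Lemma graph_transversal t : A t -> \forall s \near t^', Defs.transversal S sg (C t) (C s).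
Proof.
move=> At; near=> s.
have As : A s by near: s; apply: nbhs_dnbhs; exact: near_open.
have u : G s - G t \in unitmx by near: s; exact: near_graph_diff_unit.
split; first exact: (graph_lagrangian dbx (CE As) (Gs As)).
apply/eqP; rewrite -subv0; apply/subvP => v; rewrite memv_cap => /andP[].
move=> /(graph_mem _ As)[p ->] /(graph_mem _ At)[q /(darboux_inj dbx)[<- E]].
suff -> : p = 0 by rewrite mul0mx !linear0 addr0 mem0v.
by apply: (can_inj (mulmxK u)); rewrite mul0mx mulmxBr E subrr.
Unshelve. all: by end_near.
Qed.

Lemma transverse_transversal t M D : A t -> M^T = M ->
  framed e f M (1%:M + M *m G t) D -> Defs.transversal S sg (C t) D.
Proof.
move=> At Ms DE; split; first exact: (transverse_lagrangian dbx DE (Gs At) Ms).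
apply/eqP; rewrite -subv0; apply/subvP => v; rewrite memv_cap => /andP[].
move=> /DE[a ->] /(graph_mem _ At)[q /(darboux_inj dbx)[<-]].
rewrite mulmxDr mulmx1 mulmxA -[RHS]add0r => /addIr ->.
by rewrite !mul0mx addr0 !linear0 addr0 mem0v.
Qed.

Lemma graph_dual_form t a : A t ->
  forall (w : subvs_of (C t)) q, vsval w = e q + f (q *m G t) -> Bmap sg (C t) (f a) w = dot a q.
Proof.
move=> At w q wE; have fE : f a = e 0 + f a by rewrite linear0 add0r.
rewrite (BmapE dbx) ?graph_sub // fE; last exact: (darboux_mem dbx).
by rewrite wE (darboux_form dbx) dot0l subr0.
Qed.

(** A complement with parameter [M] has free term given by [M - T t], and a symmetric matrix is
    determined by its quadratic form, so the free term vanishes identically only for [M = T t]. *)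
Lemma is_derivative_subspaceP t D : A t ->
  is_derivative_subspace S sg C t D <-> framed e f (T t) (1%:M + T t *m G t) D.
Proof.
move=> At; split.
  move=> [_ /(transverse_framed At)[M Ms DE] free].
  suff <- : M = T t by [].
  apply: dot_quad_inj => //; first exact: derivative_param_sym.
  move=> a; apply/eqP; rewrite -subr_eq0; apply/eqP.
  apply: laurent_free_term_unique (free (Bmap sg (C t) (f a))).
  exact: (affine_diff_free_term At Ms DE (graph_dual_form a At)).
move=> DE; have Ts := derivative_param_sym At; split.
- exact: graph_transversal.
- exact: (transverse_transversal At Ts DE).
- move=> phi; have [a phiE] := graph_dual phi (CE At).
  by have := affine_diff_free_term At Ts DE phiE; rewrite subrr.
Qed.

Lemma derivative_curve_framed t : A t ->
  framed e f (T t) (1%:M + T t *m G t) (derivative_curve S sg C t).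
Proof.
move=> At; rewrite /derivative_curve.
case: xgetP => [D _ /(is_derivative_subspaceP _ At)//|].
(* The default value of [xget] is excluded by exhibiting the subspace with the required frame. *)
pose h : 'Hom('rV[R]_n, V) := ((e \o linfun (mulmxr (T t))) + (f \o linfun (mulmxr (1%:M + T t *m G t))))%VF.
move=> /(_ (limg h)); case; apply/(is_derivative_subspaceP _ At) => v; split.
  move=> /memv_imgP[a _ ->]; exists a.
  by rewrite add_lfunE !comp_lfunE !lfunE.
move=> [a ->]; apply/memv_imgP; exists a; first exact: memvf.
by rewrite add_lfunE !comp_lfunE !lfunE.
Qed.

End GraphCurve.

Lemma velocity_map_framed (R : realType) (V : vectType R) (S : {vspace V}) (sg : V -> V -> R)
    n (e f : 'Hom('rV[R]_n, V)) k (A : set R^o) (X Y : R^o -> 'M[R]_(k, n)) C t p r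
    (w : subvs_of (C t)) :
  darboux S sg e f -> open A -> A t -> msmooth A X -> msmooth A Y ->
  (forall s, A s -> X s *m (Y s)^T = Y s *m (X s)^T) ->
  (forall s, A s -> framed e f (X s) (Y s) (C s)) ->
  vsval w = e (r *m X t) + f (r *m Y t) ->
  velocity_map sg C t (e (p *m X t) + f (p *m Y t)) w = dot (p *m frame_velocity X Y t) r.
Proof.
move=> dbx oA At sX sY XY CE wE; set v := e (p *m _) + _.
have pE q := polar_velocity_frame dbx p q oA At sX sY XY CE.
pose g (w : subvs_of (C t)) : R^o := polar (velocity sg C t) v (vsval w).
have gl : linear g.
  move=> c w1 w2; have /(CE _ At)[q1 E1] := subvsP w1; have /(CE _ At)[q2 E2] := subvsP w2.
  have E : vsval (c *: w1 + w2) = e ((c *: q1 + q2) *m X t) + f ((c *: q1 + q2) *m Y t).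
    by rewrite /= E1 E2 !mulmxDl -!scalemxAl !linearP /= scalerDr addrACA.
  by rewrite /g E E1 E2 !pE dotDr dotZr.
pose gL : {linear subvs_of (C t) -> R^o} := HB.pack g (GRing.isLinear.Build _ _ _ _ _ gl).
by rewrite /velocity_map -/g (_ : g = gL) // lfunE /= /g wE pE.
Qed.

(** Here [a], [b], [c] stand for the first three derivatives of [G], [w] for the inverse of [a], and
    [t'] for the derivative of the parameter [t]. The constant 3/4 is 1 - 1/4: conjugating [- t'] by
    [a] contributes the coefficient -1 of [b *m w *m b], and the product of the two halves in [t]
    contributes 1/4. *)
Lemma curvature_algebra (R : realType) n (a w b c : 'M[R]_n) :
  w *m a = 1%:M -> a *m w = 1%:M ->
  let t := - (2^-1 *: (w *m b *m w)) in
  let t' := - (2^-1 *: (w *m c *m w - 2 *: (w *m b *m w *m b *m w))) in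
  a *m (t *m a *m t - t') *m a = 2^-1 *: c - (3 / 4) *: (b *m w *m b).
Proof.
move=> wa aw t t'.
have at_ : a *m t = - (2^-1 *: (b *m w)).
  by rewrite /t mulmxN -scalemxAr !mulmxA aw mul1mx.
have ta : t *m a = - (2^-1 *: (w *m b)).
  by rewrite /t mulNmx -scalemxAl -!mulmxA wa mulmx1.
rewrite mulmxBr mulmxBl.
have -> : a *m (t *m a *m t) *m a = (2^-1 * 2^-1) *: (b *m w *m b).
  rewrite !mulmxA at_ -[_ *m t *m _]mulmxA ta mulmxN !mulNmx opprK -scalemxAr -!scalemxAl scalerA.
  by rewrite !mulmxA -(mulmxA b w a) wa mulmx1.
have -> : a *m t' *m a = - (2^-1 *: (c - 2 *: (b *m w *m b))).
  rewrite /t' mulmxN mulNmx -scalemxAr -scalemxAl; congr (- (_ *: _)).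
  rewrite mulmxBr mulmxBl -scalemxAr -scalemxAl !mulmxA aw !mul1mx.
  by rewrite -(mulmxA c w a) wa mulmx1 -(mulmxA (b *m w *m b) w a) wa mulmx1.
rewrite opprK scalerBr scalerA addrCA; congr (_ + _).
by rewrite -scaleNr -scalerDl -[RHS]scaleNr; congr (_ *: _); rewrite ?/GRing.scale /=; field.
Qed.

(** * The curvature of a graph *)

Section GraphCurvature.
Variables (R : realType) (V : vectType R) (S : {vspace V}) (sg : V -> V -> R).
Variables (n : nat) (e f : 'Hom('rV[R]_n, V)).
Hypothesis dbx : darboux S sg e f.
Variables (C : R -> {vspace V}) (A : set R^o) (G : R^o -> 'M[R]_n).
Hypotheses (oA : open A) (Gsm : msmooth A G).
Hypothesis Gs : forall s, A s -> (G s)^T = G s.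
Hypothesis CE : forall s, A s -> framed e f 1%:M (G s) (C s).
Hypothesis G'u : forall s, A s -> mderive G s \in unitmx.

Local Notation G' := (mderive G).
Local Notation G'' := (mderive (mderive G)).
Local Notation G''' := (mderive (mderive (mderive G))).
Local Notation T := (derivative_param G).

(* For [n = 1] this is [G' / 2] times the Schwarzian derivative of [G]. *)
Definition curvature_mx t : 'M[R]_n :=
  2^-1 *: G''' t - (3 / 4) *: (G'' t *m invmx (G' t) *m G'' t).

Let graph_sym s : A s -> 1%:M *m (G s)^T = G s *m 1%:M^T.
Proof. by move=> As; rewrite trmx1 mulmx1 mul1mx Gs. Qed.

Lemma graph_frame_velocity t : A t -> frame_velocity (fun=> 1%:M) G t = G' t.
Proof. by move=> At; rewrite /frame_velocity mderive_cst mul0mx subr0 trmx1 mulmx1. Qed.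

Lemma polar_velocity_graph t p q : A t ->
  polar (velocity sg C t) (e p + f (p *m G t)) (e q + f (q *m G t)) = dot (p *m G' t) q.
Proof.
move=> At; have := polar_velocity_frame dbx p q oA At (msmooth_cst oA 1%:M) Gsm graph_sym CE.
by rewrite !mulmx1 graph_frame_velocity.
Qed.

Let sT : msmooth A T. Proof. exact: derivative_param_smooth. Qed.
Let sY : msmooth A (fun s => 1%:M + T s *m G s).
Proof. by apply: msmoothD => //; [exact: msmooth_cst|exact: msmoothM]. Qed.
Let Tsym t : A t -> (T t)^T = T t. Proof. exact: derivative_param_sym. Qed.

Let Ytr t : A t -> (1%:M + T t *m G t)^T = 1%:M + G t *m T t.
Proof. by move=> At; rewrite linearD /= trmx1 trmx_mul Gs // Tsym. Qed.

(** In the velocity [(T' G + T G') T - T' (1 + G T)] of the derivative curve the terms containing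
    [G] cancel, leaving [T G' T - T']. Only derivatives of [G] survive, as they must: adding a
    constant symmetric matrix to [G] is a symplectic shear. *)
Lemma derivative_frame_velocity t : A t ->
  G' t *m frame_velocity T (fun s => 1%:M + T s *m G s) t *m G' t = curvature_mx t.
Proof.
move=> At; have sG' := msmooth_derive Gsm; have sG'' := msmooth_derive sG'.
have sV := msmooth_inv oA sG' G'u.
have VK : invmx (G' t) *m G' t = 1%:M by rewrite mulVmx // G'u.
have KV : G' t *m invmx (G' t) = 1%:M by rewrite mulmxV // G'u.
have -> : frame_velocity T (fun s => 1%:M + T s *m G s) t = T t *m G' t *m T t - mderive T t.
  rewrite /frame_velocity (mderiveD At); [|exact: msmooth_cst|exact: msmoothM].
  rewrite mderive_cst add0r (mderiveM At) // Ytr // Tsym // mulmxDr mulmx1 mulmxDl mulmxA.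
  set a := _ *m T t; set b := _ *m T t; set c := mderive _ _.
  by rewrite [c + a]addrC opprD addrA [a + b]addrC addrK.
have s1 : msmooth A (fun s => invmx (G' s) *m G'' s) by exact: msmoothM.
have s2 : msmooth A (fun s => invmx (G' s) *m G'' s *m invmx (G' s)) by exact: msmoothM.
have -> : mderive T t = - (2^-1 *: (invmx (G' t) *m G''' t *m invmx (G' t)
    - 2 *: (invmx (G' t) *m G'' t *m invmx (G' t) *m G'' t *m invmx (G' t)))).
  rewrite /derivative_param (mderiveN At); last exact: msmoothZ.
  rewrite (mderiveZ At) // (mderiveM At) // (mderiveM At) // (mderive_inv oA At sG' G'u).
  move: (invmx (G' t)) (G'' t) (G''' t) => w g2 g3.
  have -> : (- (w *m g2 *m w) *m g2 + w *m g3) *m w + w *m g2 *m - (w *m g2 *m w)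
    = w *m g3 *m w - 2 *: (w *m g2 *m w *m g2 *m w).
    rewrite mulmxDl !mulNmx mulmxN !mulmxA scaler_nat mulr2n opprD addrA.
    by rewrite [X in X + _]addrC.
  by [].
exact: curvature_algebra.
Qed.

Lemma graph_curvature_operator t p : A t ->
  curvature_operator S sg C t (e p + f (p *m G t)) =
  let q := p *m G' t *m frame_velocity T (fun s => 1%:M + T s *m G s) t in
  e q + f (q *m G t).
Proof.
move=> At; set B := frame_velocity _ _ _.
have DE s : A s -> framed e f (T s) (1%:M + T s *m G s) (derivative_curve S sg C s).
  by move=> As; exact: (derivative_curve_framed dbx oA Gsm Gs CE G'u).
pose a := p *m G' t.
rewrite /curvature_operator.
have phi1E (w : subvs_of (C t)) q : vsval w = e q + f (q *m G t) ->
    velocity_map sg C t (e p + f (p *m G t)) w = dot a q.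
  move=> wE; have := @velocity_map_framed _ _ _ _ _ _ _ _ _ _ _ _ t p q w dbx oA At (msmooth_cst oA 1%:M) Gsm graph_sym CE.
  by rewrite !mulmx1 graph_frame_velocity //; apply.
rewrite (Imap_transverse dbx Gs CE At (Tsym At) (DE t At) phi1E).
have XY s : A s -> T s *m (1%:M + T s *m G s)^T = (1%:M + T s *m G s) *m (T s)^T.
  by move=> As; rewrite Ytr // Tsym // mulmxDr mulmxDl mulmx1 mul1mx mulmxA.
have phi2E (w : subvs_of (derivative_curve S sg C t)) b :
    vsval w = e (b *m T t) + f (b *m (1%:M + T t *m G t)) ->
    velocity_map sg (derivative_curve S sg C) t (e (a *m T t) + f (a *m (1%:M + T t *m G t))) w = dot (a *m B) b.
  by move=> wE; exact: (velocity_map_framed a dbx oA At sT sY XY DE wE).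
(* Pairing the graph with its complement, in this order, gives a minus sign, which cancels the one
   in the definition of the curvature operator. *)
rewrite (Imap_graph_of_transverse dbx Gs CE At (Tsym At) (DE t At) phi2E) /=.
by rewrite !mulNmx !linearN /= -opprD opprK.
Qed.

Lemma graph_curvature_form t p : A t ->
  curvature_form S sg C t (e p + f (p *m G t)) = dot (p *m curvature_mx t) p.
Proof.
move=> At; rewrite /curvature_form graph_curvature_operator // polar_velocity_graph //.
by rewrite -derivative_frame_velocity // !mulmxA.
Qed.

End GraphCurvature.

(** * Reduction *)

Lemma comp_linfunE (R : realType) (U1 U2 U3 U4 : vectType R) (P : 'Hom(U3, U4))
    (g : 'Hom(U2, U3)) (h : {linear U1 -> U2}) u :
  (P \o (g \o linfun h))%VF u = P (g (h u)).
Proof. by rewrite !comp_lfunE lfunE. Qed.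

Section Reduction.
Variables (R : realType) (V : vectType R) (sg : V -> V -> R).
Variables (n k : nat) (e f : 'Hom('rV[R]_n, V)) (l : seq V) (io : 'M[R]_(k, n)).
Hypothesis dbx : darboux fullv sg e f.
Hypothesis io_free : row_free io.
Hypothesis lE : forall v, v \in span l <-> exists2 b, b *m io^T = 0 & v = f b.

(** [span l] is vertical, so only the horizontal component of [v] pairs with it; it must be
    orthogonal to the kernel of [b |-> b *m io^T], which puts it in the row space of [io]. *)
Lemma sorthP v : v \in sorth sg l <-> exists q a, v = e (q *m io) + f a.
Proof.
have lin u : exists h : 'Hom(V, R^o), forall w, h w = sg w u.
  have [h hE] := form_lin dbx (memvf u); exists (- h)%VF => w.
  rewrite opp_lfunE hE ?memvf //.
  have [p [a ->]] := (dbx.1 u).1 (memvf _); have [q [b ->]] := (dbx.1 w).1 (memvf _).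
  rewrite !(darboux_form dbx) (dotC a) (dotC p); ring.
have sE : v \in sorth sg l <-> forall u, u \in span l -> sg v u = 0.
  have lfE u : linfun (fun w => sg w u : R^o) v = sg v u.
    by have [h hE] := lin u; rewrite (linfun_eq (h := h)) // => w; rewrite hE.
  split.
    move=> vs; have vl u : u \in l -> sg v u = 0.
      move: vs; rewrite /sorth; elim: l => //= u0 l' IH; rewrite big_cons in_cons memv_cap memv_ker.
      by rewrite lfE => /andP[/eqP v0 vl'] /orP[/eqP-> //|]; exact: IH.
    move=> u ul; rewrite (@coord_span _ _ _ (in_tuple l) u ul).
    have [h hE] := form_lin dbx (memvf v); rewrite -hE ?memvf // linear_sum big1 // => i _.
    by rewrite linearZ /= hE ?memvf // vl ?scaler0 // mem_nth.
  move=> h; rewrite /sorth; have : forall u, u \in l -> sg v u = 0.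
    by move=> u ul; apply: h; exact: memv_span.
  elim: l => [|u0 l' IH] h'; first by rewrite big_nil memvf.
  rewrite big_cons memv_cap memv_ker lfE h' ?mem_head // eqxx /= IH // => u ul.
  by apply: h'; rewrite in_cons ul orbT.
rewrite sE; split.
  have [p [a ->]] := (dbx.1 v).1 (memvf _) => h.
  have : (p <= io)%MS.
    rewrite submxE; apply/eqP/rowP => j; rewrite [RHS]mxE.
    (* The image under [f] of each such row lies in [span l]; orthogonality of [p] to all these rows
       is the cokernel test for membership in the row space of [io]. *)
    have b0 : row j (cokermx io)^T *m io^T = 0.
      by rewrite -row_mul -trmx_mul mulmx_coker trmx0 row0.
    have := h (f (row j (cokermx io)^T)) => /(_ _)/=.
    have -> : f (row j (cokermx io)^T) = e 0 + f (row j (cokermx io)^T) by rewrite linear0 add0r.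
    rewrite (darboux_form dbx) (dotC a) dot0l sub0r => /(_ _)/eqP; rewrite oppr_eq0 => E.
    rewrite -(eqP (E _)); last by rewrite linear0 add0r; apply/lE; exists (row j (cokermx io)^T).
    by rewrite mxE dotE; apply: eq_bigr => i _; rewrite !mxE.
  by move=> /submxP[q ->]; exists q, a.
move=> [q [a ->]] u /lE[b b0 ->].
have -> : f b = e 0 + f b by rewrite linear0 add0r.
by rewrite (darboux_form dbx) (dotC a) dot0l sub0r dotC dotMr b0 dot0l oppr0.
Qed.

Lemma red_proj_eq u v : red_proj l u = red_proj l v <-> u - v \in span l.
Proof.
have -> : (u - v \in span l) = (u - v \in lker (red_proj l)) by rewrite lker_quot_proj.
rewrite memv_ker linearB /= subr_eq0.
by split=> [->|/eqP].
Qed.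

(** The form is independent of the lifts picked by [red_lift]: two lifts differ by some [f c] with
    [c *m io^T = 0], and such a vector pairs to zero with the skew-orthogonal complement of [l]. *)
Lemma red_form_proj q a q' a' :
  red_form sg (red_proj l (e (q *m io) + f a)) (red_proj l (e (q' *m io) + f a')) =
  dot a (q' *m io) - dot (q *m io) a'.
Proof.
have liftE r b : exists2 c, c *m io^T = 0 &
    red_lift sg (red_proj l (e (r *m io) + f b)) = e (r *m io) + f (b + c).
  rewrite /red_lift; case: xgetP => [z _ [zS /red_proj_eq/lE[c c0 zE]]|/(_ (e (r *m io) + f b))]; last first.
    by case; split => //; apply/sorthP; exists r, b.
  by exists c => //; rewrite (linearD f) /= addrA -zE addrC subrK.
rewrite /red_form; have [c c0 ->] := liftE q a; have [c' c0' ->] := liftE q' a'.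
rewrite (darboux_form dbx).
have -> : dot (a + c) (q' *m io) = dot a (q' *m io).
  by rewrite dotDl (dotMr c) c0 dot0l addr0.
have -> : dot (q *m io) (a' + c') = dot (q *m io) a'.
  by rewrite dotDr [dot _ c']dotC (dotMr c') c0' dot0l addr0.
by [].
Qed.

(** A section of the restriction [a |-> a *m io^T] of covectors to the row space of [io]. Any other
    section differs by vertical vectors in [span l], which the projection kills. *)
Definition io_dual : 'M[R]_(k, n) := (pinvmx io)^T.

Lemma io_dualK : io_dual *m io^T = 1%:M.
Proof. by rewrite /io_dual -trmx_mul mulmxVp // trmx1. Qed.

Definition red_e : 'Hom('rV[R]_k, quotv (span l)) := (red_proj l \o (e \o linfun (mulmxr io)))%VF.
Definition red_f : 'Hom('rV[R]_k, quotv (span l)) := (red_proj l \o (f \o linfun (mulmxr io_dual)))%VF.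

Lemma red_eE q : red_e q = red_proj l (e (q *m io)).
Proof. exact: comp_linfunE. Qed.

Lemma red_fE a : red_f (a *m io^T) = red_proj l (f a).
Proof.
rewrite [LHS]comp_linfunE /=; apply/red_proj_eq; apply/lE.
exists (a *m io^T *m io_dual - a); last by rewrite linearB.
by rewrite mulmxBl -(mulmxA _ io_dual) io_dualK mulmx1 subrr.
Qed.

Lemma red_frameE q a : red_proj l (e (q *m io) + f a) = red_e q + red_f (a *m io^T).
Proof. by rewrite red_eE red_fE linearD. Qed.

Lemma red_darboux : darboux (red_space sg l) (@red_form R V sg l) red_e red_f.
Proof.
have fE a : red_f a = red_f (a *m io_dual *m io^T) by rewrite -mulmxA io_dualK mulmx1.
split=> [v|p a q b].
  split=> [/memv_imgP[u /sorthP[q [a ->]] ->]|[q [a ->]]].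
    by exists q, (a *m io^T); rewrite red_frameE.
  rewrite fE -red_frameE; apply: memv_img; apply/sorthP.
  by exists q, (a *m io_dual).
rewrite (fE a) (fE b) -!red_frameE red_form_proj dotMr -mulmxA io_dualK mulmx1.
by rewrite (dotC (p *m io)) dotMr -mulmxA io_dualK mulmx1 (dotC b).
Qed.

Variables (C : R -> {vspace V}) (A : set R^o) (G : R^o -> 'M[R]_n).
Hypotheses (oA : open A) (Gsm : msmooth A G).
Hypothesis Gs : forall s, A s -> (G s)^T = G s.
Hypothesis CE : forall s, A s -> framed e f 1%:M (G s) (C s).
Definition red_graph s := io *m G s *m io^T.
Hypothesis rG'u : forall s, A s -> mderive red_graph s \in unitmx.

Lemma red_graph_smooth : msmooth A red_graph.
Proof.
by apply: msmoothM => //; [apply: msmoothM => //; exact: msmooth_cst|exact: msmooth_cst].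
Qed.

Lemma mderive_conj (F : R^o -> 'M[R]_n) t : A t -> msmooth A F ->
  mderive (fun s => io *m F s *m io^T) t = io *m mderive F t *m io^T.
Proof.
move=> At sF; have sc m1 m2 (M : 'M[R]_(m1, m2)) : msmooth A (fun=> M) by exact: msmooth_cst.
rewrite (mderiveM At) //; last exact: msmoothM.
by rewrite (mderiveM At) // !mderive_cst mul0mx add0r mulmx0 addr0.
Qed.

Lemma graph_sorth s v : A s ->
  v \in (C s :&: sorth sg l)%VS <-> exists q, v = e (q *m io) + f (q *m io *m G s).
Proof.
move=> As; rewrite memv_cap; split.
  move=> /andP[/(CE As)[p ->] /sorthP[q [a /(darboux_inj dbx)[]]]].
  by rewrite mulmx1 => -> _; exists q; rewrite -mulmxA.
move=> [q ->]; apply/andP; split; last by apply/sorthP; exists q, (q *m io *m G s).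
by apply/(CE As); exists (q *m io); rewrite mulmx1.
Qed.

(** The upper blocks of [red_X] and [red_Y] frame the intersection with the skew-orthogonal
    complement, the lower blocks generate the constant subspace [span l]. Taking all rows of a
    kernel matrix is harmless, since frames may be redundant. *)
Definition red_X : 'M[R]_(k + n, n) := col_mx io 0.
Definition red_Y s : 'M[R]_(k + n, n) := col_mx (io *m G s) (kermx io^T).

Lemma reduced_framed s : A s -> framed e f red_X (red_Y s) (reduced_curve sg l C s).
Proof.
move=> As v; split.
  move=> /memv_addP[u /(graph_sorth _ As)[q ->] [w /lE[b b0 ->] ->]].
  have /submxP[c bc] : (b <= kermx io^T)%MS by apply/sub_kermxP.
  exists (row_mx q c); rewrite !mul_row_col mulmx0 addr0 -bc mulmxA.
  by rewrite linearD addrA.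
move=> [p ->]; rewrite -[p]hsubmxK !mul_row_col mulmx0 addr0 linearD addrA mulmxA.
apply: memv_add; first by apply/(graph_sorth _ As); exists (lsubmx p).
by apply/lE; exists (rsubmx p *m kermx io^T); rewrite // -mulmxA mulmx_ker mulmx0.
Qed.

Lemma red_Y_smooth : msmooth A red_Y.
Proof.
move=> i j; under eq_fun do rewrite mxE; case: (fintype.split i) => i'.
  by apply: msmoothM => //; exact: msmooth_cst.
exact: smooth_on_cst.
Qed.

Lemma mderive_red_Y t : A t -> mderive red_Y t = col_mx (io *m mderive G t) 0.
Proof.
move=> At; apply/matrixP => i j; rewrite !mxE; under eq_fun do rewrite mxE.
case: (fintype.split i) => i'; last by rewrite derive1_cst mxE.
have := mderiveM At (msmooth_cst oA io) Gsm; rewrite mderive_cst mul0mx add0r => <-.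
by rewrite mxE.
Qed.

(** The reduced curvature operator is computed in the quotient, but the form is evaluated with the
    velocity of the unprojected curve. This supplies that velocity, which has the same matrix as the
    velocity of the projected graph. *)
Lemma polar_velocity_reduced t q q' : A t ->
  polar (velocity sg (reduced_curve sg l C) t)
    (e (q *m io) + f (q *m io *m G t)) (e (q' *m io) + f (q' *m io *m G t)) =
  dot (q *m mderive red_graph t) q'.
Proof.
move=> At; have z0 : (0 : 'M[R]_n)^T = 0 by apply/matrixP => i j; rewrite !mxE.
have z1 : (0 : 'M[R]_(n, k))^T = 0 by apply/matrixP => i j; rewrite !mxE.
have XY s : A s -> red_X *m (red_Y s)^T = red_Y s *m red_X^T.
  move=> As; rewrite /red_X /red_Y !tr_col_mx !mul_col_row !mul0mx z0 !mulmx0 trmx_mul Gs // mulmxA.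
  by rewrite -[X in X *m (kermx _)^T](trmxK io) -trmx_mul mulmx_ker z1.
have := polar_velocity_frame dbx (row_mx q 0) (row_mx q' 0) oA At (msmooth_cst oA red_X) red_Y_smooth XY reduced_framed.
rewrite !mul_row_col !mul0mx !addr0 !mulmxA => ->.
rewrite /frame_velocity mderive_cst mul0mx subr0 mderive_red_Y // tr_col_mx trmx0.
rewrite mulmxA mul_row_col mul0mx addr0 mul_mx_row mulmx0.
rewrite /dot tr_row_mx trmx0 mul_row_col mulmx0 addr0 mderive_conj // !mulmxA.
by [].
Qed.

Lemma quotient_framed s : A s ->
  framed red_e red_f 1%:M (red_graph s) (quotient_curve sg l C s).
Proof.
move=> As v; split.
  move=> /memv_imgP[u /memv_addP[u1 /(graph_sorth _ As)[q ->] [w wl ->]] ->].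
  exists q; rewrite mulmx1 !mulmxA -red_frameE; apply/red_proj_eq.
  by rewrite addrC addKr.
move=> [q ->]; rewrite mulmx1 !mulmxA -red_frameE; apply: memv_img.
rewrite -[e _ + _]addr0; apply: memv_add; last exact: mem0v.
by apply/(graph_sorth _ As); exists q.
Qed.

Lemma red_graph_sym s : A s -> (red_graph s)^T = red_graph s.
Proof. by move=> As; rewrite !trmx_mul trmxK Gs // mulmxA. Qed.

Lemma reduced_curvature_formE t q : A t ->
  reduced_curvature_form sg l C t (e (q *m io) + f (q *m io *m G t)) =
  dot (q *m curvature_mx red_graph t) q.
Proof.
move=> At; have sr := red_graph_smooth.
pose B := frame_velocity (derivative_param red_graph)
   (fun s => 1%:M + derivative_param red_graph s *m red_graph s) t.
pose q1 := q *m mderive red_graph t *m B.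
have E : curvature_operator (red_space sg l) (@red_form R V sg l) (quotient_curve sg l C) t
    (red_proj l (e (q *m io) + f (q *m io *m G t))) = red_e q1 + red_f (q1 *m red_graph t).
  rewrite red_frameE (_ : q *m io *m G t *m io^T = q *m red_graph t); last by rewrite !mulmxA.
  exact: (graph_curvature_operator red_darboux oA sr red_graph_sym quotient_framed rG'u q At).
(* The projection is injective on the intersection of [C t] with the skew-orthogonal complement, as
   the horizontal coordinate downstairs determines the vector; hence the lift is forced. *)
have Eop : reduced_curvature_operator sg l C t (e (q *m io) + f (q *m io *m G t)) =
    e (q1 *m io) + f (q1 *m io *m G t).
  rewrite /reduced_curvature_operator E; case: xgetP => [u _ [/(graph_sorth _ At)[r ->]]|].
    by rewrite red_frameE => /(darboux_inj red_darboux)[-> _].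
  move=> /(_ (e (q1 *m io) + f (q1 *m io *m G t))); case; split.
    by apply/(graph_sorth _ At); exists q1.
  by rewrite red_frameE !mulmxA.
rewrite /reduced_curvature_form Eop.
rewrite polar_velocity_reduced // /q1 /B.
by rewrite -(derivative_frame_velocity oA sr red_graph_sym rG'u At) !mulmxA.
Qed.

End Reduction.

(** * Matrix algebra of the comparison, ranks of quadratic forms *)

Section ReductionAlgebra.
Variables (R : realType) (n k : nat) (P M : 'M[R]_n) (io : 'M[R]_(k, n)).
Hypotheses (Ps : P^T = P) (Ms : M^T = M) (io_free : row_free io).
Hypothesis P_gt0 : forall p : 'rV[R]_n, p != 0 -> 0 < dot (p *m P) p.

Lemma posdef_conj_unit m (N : 'M[R]_(m, n)) : row_free N -> N *m P *m N^T \in unitmx.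
Proof.
move=> Nf; rewrite -row_free_unit; apply: inj_row_free => q q0.
apply/eqP; apply: contraT => qn0.
have qN0 : q *m N != 0.
  by apply: contra qn0 => /eqP E; apply/eqP/(row_free_inj Nf); rewrite E mul0mx.
have := P_gt0 qN0; rewrite dotMr -(mulmxA q) -(mulmxA q) q0 dot0l.
by rewrite ltxx.
Qed.

Lemma posdef_unit : P \in unitmx.
Proof.
have := posdef_conj_unit (N := 1%:M); rewrite mul1mx trmx1 mulmx1; apply.
by rewrite row_free_unit unitmx1.
Qed.

(** [P *m K] acts on row vectors as the [P]-orthogonal projection that kills the row space of
    [io]. *)
Definition reduction_kernel : 'M[R]_n :=
  invmx P - io^T *m invmx (io *m P *m io^T) *m io.
Local Notation K := reduction_kernel.

Lemma reduction_kernel_mul : io *m P *m K = 0.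
Proof.
rewrite mulmxBr !mulmxA mulmxV ?posdef_conj_unit // mul1mx.
by rewrite -(mulmxA io) mulmxV ?posdef_unit // mulmx1 subrr.
Qed.

Lemma reduction_kernel_sym : K^T = K.
Proof.
rewrite linearB /= trmx_inv Ps !trmx_mul trmx_inv !trmx_mul !trmxK Ps.
by rewrite !mulmxA.
Qed.

Lemma reduction_kernelK : K *m P *m K = K.
Proof.
have {1}-> : K = invmx P - io^T *m invmx (io *m P *m io^T) *m io by [].
rewrite !mulmxBl mulVmx ?posdef_unit // mul1mx -!mulmxA (mulmxA io P K) reduction_kernel_mul.
by rewrite !mulmx0 subr0.
Qed.

Lemma reduction_kernel_ge0 y : 0 <= dot (y *m K) y.
Proof.
have -> : dot (y *m K) y = dot (y *m K *m P) (y *m K).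
  by rewrite dotMr reduction_kernel_sym -!mulmxA (mulmxA K) reduction_kernelK.
have [->|y0] := eqVneq (y *m K) 0; first by rewrite mul0mx dot0l.
exact/ltW/P_gt0.
Qed.

Lemma reduction_kernel_rank : (\rank K <= n - k)%N.
Proof.
have := mulmx0_rank_max reduction_kernel_mul.
rewrite mxrankMfree ?row_free_unit ?posdef_unit // (eqP io_free) => rk.
by rewrite leq_subRL // (leq_trans _ rk) // leq_addr.
Qed.

End ReductionAlgebra.

Lemma reduction_difference (R : realType) n k (io : 'M[R]_(k, n)) (w m c : 'M[R]_n) (w' : 'M[R]_k) :
  2^-1 *: (io *m c *m io^T) - (3 / 4) *: ((io *m m *m io^T) *m w' *m (io *m m *m io^T))
    - io *m (2^-1 *: c - (3 / 4) *: (m *m w *m m)) *m io^T =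
  (3 / 4) *: (io *m m *m (w - io^T *m w' *m io) *m m *m io^T).
Proof.
rewrite (mulmxBr io) mulmxBl -!scalemxAr -!scalemxAl opprB addrC addrA subrK -scalerBr.
by congr (_ *: _); rewrite mulmxBr !mulmxBl !mulmxA.
Qed.

Section QuadraticForm.
Variables (R : realType) (V : vectType R) (E : {vspace V}) (k : nat).
Variables (th : 'Hom('rV[R]_k, V)) (Q : 'M[R]_k) (q : V -> R).
Hypotheses (Qs : Q^T = Q) (EE : forall v, v \in E <-> exists p, v = th p).
Hypothesis qE : forall p, q (th p) = dot (p *m Q) p.

Let polarE p p' : polar q (th p) (th p') = dot (p *m Q) p'.
Proof.
rewrite /polar -linearD !qE mulmxDl !dotDl !dotDr (dotC (p' *m Q) p) dotMr Qs.
by field.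
Qed.

Lemma quadratic_on_param : quadratic_on E q.
Proof.
split=> [a _ /EE[p ->]|a _ _ _ /EE[p1 ->] /EE[p2 ->] /EE[p3 ->]].
  by rewrite -linearZ !qE -scalemxAl dotZl dotZr expr2 mulrA.
by rewrite -linearP !polarE mulmxDl -scalemxAl dotDl dotZl.
Qed.

(** The Gram matrix in the fixed basis of [E] is a congruence transform of [Q] by a possibly
    rectangular matrix, which cannot raise the rank. *)
Lemma quad_rank_param : (quad_rank E q <= \rank Q)%N.
Proof.
have /choice[p pE] : forall i : 'I_(\dim E), exists p, (vbasis E)`_i = th p.
  by move=> i; apply/EE/vbasis_mem; rewrite mem_nth // size_tuple.
pose N : 'M[R]_(\dim E, k) := \matrix_i p i.
rewrite /quad_rank; set M := (X in \rank X); have -> : M = N *m Q *m N^T.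
  apply/matrixP => i j; rewrite mxE !pE polarE /dot.
  rewrite mxE [RHS]mxE; apply: eq_bigr => m _; rewrite !mxE; congr (_ * _).
  by apply: eq_bigr => m' _; rewrite mxE.
by rewrite (leq_trans (mxrankM_maxl _ _)) // mxrankM_maxr.
Qed.

End QuadraticForm.

Lemma near_unitmx (R : realType) (A : set R^o) n (F : R^o -> 'M[R]_n) (t : R) :
  open A -> A t -> msmooth A F -> F t \in unitmx -> \forall s \near t, F s \in unitmx.
Proof.
move=> oA At sF; rewrite unitmxE unitfE => d0.
have c := smooth_on_continuous (smooth_on_det oA sF) At.
have : \forall s \near t, \det (F s) != 0.
  exact: (c [set y | y != 0] (open_nbhs_nbhs (conj (@open_neq R^o 0) d0))).
by apply: filterS => s; rewrite unitmxE unitfE.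
Qed.

(** * The comparison for graphs *)

Section Comparison.
Variables (R : realType) (V : vectType R) (sg : V -> V -> R).
Variables (n k : nat) (e f : 'Hom('rV[R]_n, V)) (l : seq V) (io : 'M[R]_(k, n)).
Hypothesis dbx : darboux fullv sg e f.
Hypothesis io_free : row_free io.
Hypothesis lE : forall v, v \in span l <-> exists2 b, b *m io^T = 0 & v = f b.
Variables (C : R -> {vspace V}) (A : set R^o) (G : R^o -> 'M[R]_n) (t : R).
Hypotheses (oA : open A) (At : A t) (Gsm : msmooth A G).
Hypothesis Gs : forall s, A s -> (G s)^T = G s.
Hypothesis CE : forall s, A s -> framed e f 1%:M (G s) (C s).
Hypothesis G'_gt0 : forall p : 'rV[R]_n, p != 0 -> 0 < dot (p *m mderive G t) p.

Lemma graph_reduction_comparison :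
  let E := (C t :&: sorth sg l)%VS in
  let diff v := reduced_curvature_form sg l C t v - curvature_form fullv sg C t v in
  [/\ quadratic_on E diff, forall v, v \in E -> 0 <= diff v
    & (quad_rank E diff <= n - k)%N].
Proof.
have G's := graph_derive_sym oA Gs At.
have G''s := graph_derive2_sym oA Gs At.
have sG' := msmooth_derive Gsm.
have srG : msmooth A (red_graph io G).
  exact: red_graph_smooth oA Gsm.
have rd1 s : A s -> mderive (red_graph io G) s = io *m mderive G s *m io^T.
  by move=> As; rewrite (mderive_conj _ oA).
have rd2 s : A s -> mderive (mderive (red_graph io G)) s = io *m mderive (mderive G) s *m io^T.
  move=> As; rewrite -(mderive_conj _ oA) //; apply: near_eq_mderive.
  by near=> u; apply: rd1; near: u; exact: near_open.
have rd3 s : A s -> mderive (mderive (mderive (red_graph io G))) s = io *m mderive (mderive (mderive G)) s *m io^T.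
  move=> As; rewrite -(mderive_conj _ oA) //; last exact: msmooth_derive.
  apply: near_eq_mderive.
  by near=> u; apply: rd2; near: u; exact: near_open.
(* The derivative curve must itself be differentiated, so both velocities have to be invertible at
   neighbouring times too; positivity at [t] alone gives this by continuity of determinants. *)
pose B : set R^o := A `&` ([set s | mderive G s \in unitmx]^° `&` [set s | mderive (red_graph io G) s \in unitmx]^°).
have oB : open B by apply: openI => //; apply: openI; exact: open_interior.
have Bt : B t.
  split => //; split.
    apply: (near_unitmx oA At sG'); exact: posdef_unit.
  apply: (near_unitmx oA At (msmooth_derive srG)); rewrite rd1 //; exact: posdef_conj_unit.
have BA s : B s -> A s by case.
have sGB : msmooth B G by move=> i j; apply: smooth_onS (Gsm i j).
have G'u s : B s -> mderive G s \in unitmx by move=> [_ [/interior_subset]].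
have rG'u s : B s -> mderive (red_graph io G) s \in unitmx by move=> [_ [_ /interior_subset]].
have GsB s (Bs : B s) := Gs (BA s Bs).
have CEB s (Bs : B s) := CE (BA s Bs).
move=> E diff.
pose P := mderive G t; pose M := mderive (mderive G) t.
pose K := reduction_kernel P io.
pose Q := (3 / 4) *: (io *m M *m K *m M *m io^T).
pose th : 'Hom('rV[R]_k, V) := ((e \o linfun (mulmxr io)) + (f \o linfun (mulmxr (io *m G t))))%VF.
have thE q : th q = e (q *m io) + f (q *m io *m G t).
  by rewrite add_lfunE !comp_lfunE !lfunE /= mulmxA.
have EE v : v \in E <-> exists q, v = th q.
  rewrite (graph_sorth dbx lE CE); last by [].
  by split=> -[q ->]; exists q; rewrite thE.
have Qs : Q^T = Q.
  by rewrite linearZ /= !trmx_mul trmxK G''s reduction_kernel_sym // !mulmxA.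
have dE q : diff (th q) = dot (q *m Q) q.
  rewrite /diff thE (reduced_curvature_formE dbx io_free lE oB sGB GsB CEB rG'u q Bt).
  rewrite (graph_curvature_form dbx oB sGB GsB CEB G'u (q *m io) Bt).
  rewrite dotMr -dotBl -(mulmxA q io) -(mulmxA q (io *m _)) -mulmxBr; congr (dot (_ *m _) _).
  rewrite /curvature_mx rd2 // rd3 // rd1 // -/P -/M /Q /K /reduction_kernel.
  exact: reduction_difference.
split.
- exact: (quadratic_on_param Qs EE dE).
- move=> v /EE[q ->]; rewrite dE /Q -scalemxAr dotZl mulr_ge0 ?divr_ge0 //.
  have := reduction_kernel_ge0 G's io_free G'_gt0 (q *m io *m M).
  by rewrite dotMr G''s -/M dotMr !mulmxA.
- apply: leq_trans (quad_rank_param Qs EE dE) _.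
  apply: leq_trans (reduction_kernel_rank io_free G'_gt0).
  rewrite /Q; apply: leq_trans (mxrank_scale _ _) _.
  apply: leq_trans (mxrankM_maxl _ _) _; apply: leq_trans (mxrankM_maxl _ _) _.
  exact: mxrankM_maxr.
Unshelve. all: by end_near.
Qed.

End Comparison.

(** * Adapted Darboux frames *)

Lemma submx_kerP (F : fieldType) a b c (A : 'M[F]_(a, b)) (X : 'M[F]_(a, c)) :
  (forall u : 'rV[F]_a, u *m A = 0 -> u *m X = 0) -> exists T, X = A *m T.
Proof.
move=> h; have : (X^T <= A^T)%MS.
  rewrite submxE; apply/eqP/trmx_inj/row_matrixP => i.
  rewrite trmx_mul trmxK row_mul h -?row_mul ?trmx0 ?row0 //.
  by rewrite -{2}[A]trmxK -trmx_mul mulmx_coker trmx0 row0.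
by move=> /submxP[T XT]; exists T^T; rewrite -[X]trmxK XT trmx_mul trmxK.
Qed.

Section DarbouxExists.
Variables (R : realType) (m n : nat) (Om : 'M[R]_m) (E : 'M[R]_(n, m)).
Variables (L : {vspace 'rV[R]_m}) (l : seq 'rV[R]_m).
Hypotheses (Oskew : Om^T = - Om) (Ounit : Om \in unitmx) (Efree : row_free E).
Hypothesis LE : forall v, v \in L <-> exists p, v = p *m E.
Hypothesis Llag : lagrangian fullv (mxform Om) L.
Hypothesis liso : forall u v, u \in l -> v \in l -> mxform Om u v = 0.
Hypothesis Ll0 : (L :&: span l)%VS = 0%VS.

Let bil_eq0 a b (X : 'M[R]_(a, m)) (Y : 'M[R]_(b, m)) :
  (forall i j, mxform Om (row i X) (row j Y) = 0) -> X *m Om *m Y^T = 0.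
Proof.
move=> h; apply/matrixP => i j; rewrite [RHS]mxE -(h i j) /mxform.
by rewrite -row_mul mxE [RHS]mxE; apply: eq_bigr => k _; rewrite [in RHS]mxE [Y^T _ _]mxE [(row j Y)^T _ _]mxE [row j Y _ _]mxE.
Qed.

Let Eiso : E *m Om *m E^T = 0.
Proof.
apply: bil_eq0 => i j.
have rL r : row r E \in L by apply/LE; exists (delta_mx 0 r); rewrite -rowE.
exact: ((Llag.2 _ (memvf _)).1 (rL i)).
Qed.

Let Emax (v : 'rV[R]_m) : v *m Om *m E^T = 0 -> exists x, v = x *m E.
Proof.
move=> h; apply/LE; apply: (Llag.2 _ (memvf v)).2 => w /LE[p ->].
by rewrite /mxform trmx_mul mulmxA h mul0mx mxE.
Qed.

Let trans_form a b (X : 'M[R]_(a, m)) (Y : 'M[R]_(b, m)) :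
  X *m Om *m Y^T = - (Y *m Om *m X^T)^T.
Proof. by rewrite !trmx_mul trmxK Oskew mulNmx mulmxN opprK mulmxA. Qed.

(** Any Lagrangian complement [F1] dual to [E] can be changed to [F1 + T *m E] with [T] symmetric.
    Writing the vectors of [l] as [X *m E + A *m F1], the new complement contains them once
    [A *m T = X]: [X] factors through [A] because [L] meets [span l] trivially, and a symmetric
    solution exists because [l] is isotropic. *)
Lemma darboux_exists : exists (F : 'M[R]_(n, m)) (k : nat) (io : 'M[R]_(k, n)),
  [/\ darboux fullv (mxform Om) (linfun (mulmxr E)) (linfun (mulmxr F)),
      row_free io,
      forall v, v \in span l <-> exists2 b, b *m io^T = 0 & v = linfun (mulmxr F) b
    & (n - k <= size l)%N].
Proof.
have [F0 F0E] : exists F0 : 'M[R]_(n, m), F0 *m (Om *m E^T) = 1%:M.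
  apply/row_fullP; rewrite /row_full -mxrank_tr trmx_mul trmxK mxrankMfree.
    exact: Efree.
  by rewrite row_free_unit unitmx_tr.
pose Z := F0 *m Om *m F0^T.
have Zs : Z^T = - Z by rewrite {2}/Z trans_form opprK.
(* [F0] is dual to [E] but has the skew Gram matrix [Z]. The correction by half of [Z] enters
   through both arguments of the form and removes [Z] exactly. *)
pose F1 := F0 + 2^-1 *: (Z *m E).
have F1E : F1 *m Om *m E^T = 1%:M.
  have ZE0 : Z *m E *m Om *m E^T = 0.
    by rewrite -(mulmxA Z E) -(mulmxA Z) Eiso mulmx0.
  by rewrite /F1 (mulmxDl F0) (mulmxDl (F0 *m Om)) -mulmxA F0E -!scalemxAl ZE0 scaler0 addr0.
have EF0 : E *m Om *m F0^T = - 1%:M by rewrite trans_form -(mulmxA F0) F0E trmx1.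
have F1F1 : F1 *m Om *m F1^T = 0.
  have F1F0 : F1 *m Om *m F0^T = Z - 2^-1 *: Z.
    rewrite /F1 (mulmxDl F0) (mulmxDl (F0 *m Om)) -!scalemxAl -/Z.
    by rewrite -(mulmxA Z E) -(mulmxA Z) EF0 mulmxN mulmx1 scalerN.
  have -> : F1^T = F0^T + 2^-1 *: (E^T *m Z^T).
    by rewrite /F1 linearD linearZ /= trmx_mul.
  rewrite mulmxDr -scalemxAr mulmxA F1E mul1mx Zs F1F0.
  rewrite scalerN -addrA -opprD -scalerDl (_ : 2^-1 + 2^-1 = 1 :> R) ?scale1r ?subrr //.
  by field.
pose s := size l.
pose Lm : 'M[R]_(s, m) := \matrix_i l`_i.
have spanE v : v \in span l <-> exists c, v = c *m Lm.
  split=> [vl|[c ->]].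
    exists (\row_i coord (in_tuple l) i v).
    rewrite {1}(@coord_span _ _ _ (in_tuple l) v vl) mulmx_sum_row.
    by apply: eq_bigr => i _; rewrite mxE rowK.
  rewrite mulmx_sum_row; apply: memv_suml => i _; apply: memvZ.
  by rewrite rowK; apply: memv_span; rewrite mem_nth.
pose A := Lm *m Om *m E^T.
have [X LmE] : exists X, Lm - A *m F1 = X *m E.
  have /choice[x xE] : forall i, exists x, row i (Lm - A *m F1) = x *m E.
    move=> i; apply: Emax; rewrite -!row_mul !mulmxBl -!(mulmxA A) F1E mulmx1.
    by rewrite subrr row0.
  exists (\matrix_i x i); apply/row_matrixP => i.
  by rewrite xE row_mul rowK.
have {}LmE : Lm = X *m E + A *m F1 by rewrite -LmE subrK.
(* This is the isotropy of [l], written in the frame [E], [F1]. *)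
have XAs : A *m X^T = X *m A^T.
  have : Lm *m Om *m Lm^T = 0.
    by apply: bil_eq0 => i j; rewrite !rowK; apply: liso; rewrite mem_nth.
  have EF1 : E *m Om *m F1^T = - 1%:M by rewrite trans_form F1E trmx1.
  have LmF1 : Lm *m Om *m F1^T = - X.
    rewrite {1}LmE (mulmxDl (X *m E)) (mulmxDl (X *m E *m Om)).
    rewrite -(mulmxA X E) -(mulmxA X) EF1 mulmxN mulmx1.
    by rewrite -(mulmxA A F1) -(mulmxA A) F1F1 mulmx0 addr0.
  have -> : Lm^T = E^T *m X^T + F1^T *m A^T by rewrite {1}LmE linearD /= !trmx_mul.
  rewrite mulmxDr !mulmxA -/A LmF1 mulNmx.
  by move=> /eqP; rewrite subr_eq0 => /eqP.
clearbody A Lm F1.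
(* A combination of [l] without component along [F1] lies in both [L] and [span l], hence is
   zero. *)
have AX0 (u : 'rV[R]_s) : u *m A = 0 -> u *m X = 0.
  move=> uA; apply: (row_free_inj Efree); rewrite mul0mx.
  suff : u *m X *m E \in (L :&: span l)%VS by rewrite Ll0 memv0 => /eqP.
  rewrite memv_cap; apply/andP; split; first by apply/LE; exists (u *m X).
  by apply/spanE; exists u; rewrite LmE mulmxDr !mulmxA uA mul0mx addr0.
have [T0 XT0] : exists T0 : 'M[R]_n, X = A *m T0 := submx_kerP AX0.
pose B : 'M[R]_(n, s) := pinvmx A.
have ABA : A *m B *m A = A by exact: mulmxKpV (submx_refl A).
clearbody B.
have AT0s : A *m T0^T *m A^T = A *m T0 *m A^T.
  by rewrite -XT0 -XAs XT0 trmx_mul mulmxA.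
have tm a b c (M : 'M[R]_(a, b)) (N : 'M[R]_(b, c)) : (M *m N)^T = N^T *m M^T.
  exact: trmx_mul.
(* A symmetric solution of [A *m T = X] built from an arbitrary solution [T0] and a generalized
   inverse [B] of [A]. After multiplication by [A] the last two terms cancel, because
   [A *m T0 *m A^T] is symmetric by [XAs]. *)
pose T : 'M[R]_n := B *m A *m T0 + (B *m A *m T0)^T - B *m (A *m T0 *m A^T) *m B^T.
have Ts : T^T = T.
  rewrite /T linearB linearD /= trmxK [X in X - _]addrC; congr (_ - _).
  have Ns : (A *m T0 *m A^T)^T = A *m T0 *m A^T.
    by rewrite !trmx_mul trmxK mulmxA AT0s.
  by rewrite trmx_mul (trmx_mul B) trmxK Ns mulmxA.
have AT : A *m T = X.
  rewrite /T mulmxBr mulmxDr !mulmxA ABA -XT0 !tm !mulmxA AT0s -XT0.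
  by rewrite addrK.
pose F := F1 + T *m E.
have FE : F *m Om *m E^T = 1%:M.
  rewrite /F (mulmxDl F1) (mulmxDl (F1 *m Om)) F1E.
  by rewrite -(mulmxA T E) -(mulmxA T) Eiso mulmx0 addr0.
have EF : E *m Om *m F^T = - 1%:M by rewrite trans_form FE trmx1.
have FF : F *m Om *m F^T = 0.
  have FF1 : F *m Om *m F1^T = - T.
    rewrite /F (mulmxDl F1) (mulmxDl (F1 *m Om)) F1F1 add0r.
    by rewrite -(mulmxA T E) -(mulmxA T) trans_form F1E trmx1 mulmxN mulmx1.
  have -> : F^T = F1^T + E^T *m T by rewrite /F linearD /= trmx_mul Ts.
  by rewrite mulmxDr mulmxA FE mul1mx FF1 addNr.
have LmF : Lm = A *m F by rewrite /F mulmxDr mulmxA AT LmE addrC.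
(* Its rows form a basis of the annihilator of the row space of [A], so [b *m io^T = 0]
   characterizes that row space, and [n - k] is the rank of [A], at most the number of vectors in
   [l]. *)
pose io := row_base (kermx A^T).
have ioA : io *m A^T = 0.
  by apply/sub_kermxP; rewrite eq_row_base.
have Aio : A *m io^T = 0.
  by apply: trmx_inj; rewrite tm trmxK ioA; apply/matrixP => i j; rewrite !mxE.
exists F, (\rank (kermx A^T)), io; split.
- split=> [v|p a q b].
    split=> [_|_]; last exact: memvf.
    have [x xE] : exists x, v - v *m Om *m E^T *m F = x *m E.
      by apply: Emax; rewrite !mulmxBl -!(mulmxA (v *m Om *m E^T)) FE mulmx1 subrr.
    by exists x, (v *m Om *m E^T); rewrite !lfunE /= -xE subrK.
  have u1 : (p *m E + a *m F) *m Om *m E^T = a.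
    rewrite (mulmxDl (p *m E)) (mulmxDl (p *m E *m Om)).
    by rewrite -(mulmxA p E) -(mulmxA p) Eiso mulmx0 add0r -(mulmxA a F) -(mulmxA a) FE mulmx1.
  have u2 : (p *m E + a *m F) *m Om *m F^T = - p.
    rewrite (mulmxDl (p *m E)) (mulmxDl (p *m E *m Om)).
    by rewrite -(mulmxA p E) -(mulmxA p) EF -(mulmxA a F) -(mulmxA a) FF mulmx0 addr0 mulmxN mulmx1.
  rewrite !lfunE /= /mxform.
  have -> : (q *m E + b *m F)^T = E^T *m q^T + F^T *m b^T by rewrite linearD /= !tm.
  by rewrite mulmxDr (mulmxA _ E^T) u1 (mulmxA _ F^T) u2 mulNmx mxE [in X in _ + X]mxE.
- exact: row_base_free.
- move=> v; rewrite spanE; split=> [[c ->]|[b b0 ->]].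
    exists (c *m A); first by rewrite -mulmxA Aio mulmx0.
    by rewrite lfunE /= LmF mulmxA.
  have : (b <= A)%MS.
    have : ((cokermx A)^T <= io)%MS.
      rewrite eq_row_base; apply/sub_kermxP.
      by rewrite -trmx_mul mulmx_coker trmx0.
    move=> /submxP[Y YE]; rewrite submxE.
    by rewrite -[cokermx A]trmxK YE trmx_mul mulmxA b0 mul0mx.
  by move=> /submxP[c ->]; exists c; rewrite lfunE /= LmF mulmxA.
- rewrite mxrank_ker mxrank_tr subKn ?rank_leq_col //.
  exact: rank_leq_row.
Qed.

End DarbouxExists.

(** * Calculus in charts *)

Lemma is_derive_comp_curve (R : realType) (U V : normedModType R) (h : U -> V)
    (ga : R -> U) (t : R) (ga' : U) :
  is_derive t (1 : R) ga ga' -> differentiable h (ga t) ->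
  is_derive t (1 : R) (fun s => h (ga s)) ('D_ga' h (ga t)).
Proof.
move=> [dg <-] dh; have dg' : differentiable ga t by exact/derivable1_diffP.
have dc : differentiable (h \o ga) t by exact: differentiable_comp.
apply: DeriveDef; first exact: diff_derivable.
by rewrite deriveE // diff_comp //= -deriveE // -deriveE.
Qed.

Lemma derive_comp (R : realType) (U V W : normedModType R) (g : U -> V) (f : V -> W) x v :
  differentiable g x -> differentiable f (g x) ->
  'D_v (f \o g) x = 'D_('D_v g x) f (g x).
Proof.
move=> dg df; have dc := differentiable_comp dg df.
by rewrite (deriveE v dc) (diff_comp dg df) /= (deriveE v dg) (deriveE _ df).
Qed.

Lemma is_derive_line (R : realType) (U : normedModType R) (u b : U) (t : R) :
  is_derive t (1 : R) (fun s => s *: u + b) u.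
Proof.
have d1 : is_derive t (1 : R) ( *:%R ^~ u) u.
  have d := is_diff_scalel t u; apply: DeriveDef; first exact: diff_derivable.
  by rewrite deriveE // diff_val scale1r.
rewrite -[u in is_derive _ _ _ u]addr0; apply: is_deriveD.
Qed.

(** * Symmetry of second derivatives *)

Section Schwarz.
Variables (R : realType) (U : normedModType R) (A : set U) (f : U -> R^o) (x : U).
Hypotheses (oA : open A) (Ax : A x) (fA : smooth_on A f).

(** The mean value theorem along [u], applied to the increment of [f] along [h *: v], reduces the
    second difference to an increment of ['D_u f], which its first-order expansion at [x]
    controls. *)
Lemma second_difference u v eps : 0 < eps -> \forall h \near (0 : R)^'+,
  `|f (x + h *: u + h *: v) - f (x + h *: u) - f (x + h *: v) + f x
    - h ^+ 2 * 'D_v (fun y => 'D_u f y) x| <= eps * h ^+ 2.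
Proof.
move=> eps0.
(* The summand 1 keeps [c] positive when both directions vanish. The two points compared lie at
   distances from [x] that add up to at most [h * (2 * c)], which explains the tolerance
   [eps / (2 * c)] used in the expansion. *)
pose c := `|u| + `|v| + 1.
have c0 : 0 < c by rewrite ltr_wpDl // addr_ge0.
have du : differentiable (fun y => 'D_u f y) x.
  by apply: smooth_on_differentiable Ax; exact: smooth_on_derive.
pose L := 'd (fun y => 'D_u f y) x.
have : \forall w \near (0 : U), `|'D_u f (w + x) - 'D_u f x - L w| <= (eps / (2 * c)) * `|w|.
  have := diff_locally du => /eqaddoP/(_ (eps / (2 * c))).
  rewrite divr_gt0 ?mulr_gt0 // => /(_ isT); apply: filterS => w /=.
  by rewrite !fctE /= opprD addrA.
have : \forall w \near (0 : U), A (w + x).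
  have : \forall y \near x, A y by exact: open_nbhs_nbhs.
  by rewrite (near_shift 0) /= subr0.
move=> /nbhs_ballP[r1 /= r10 h1] /nbhs_ballP[r2 /= r20 h2].
pose r := Num.min r1 r2.
have r0 : 0 < r by rewrite lt_min r10.
have inA w : `|w| < r -> A (x + w).
  by rewrite lt_min => /andP[w1 _]; rewrite addrC; apply: h1; rewrite -ball_normE /= sub0r normrN.
have est w : `|w| < r -> `|'D_u f (x + w) - 'D_u f x - L w| <= (eps / (2 * c)) * `|w|.
  by rewrite lt_min => /andP[_ w2]; rewrite (addrC x); apply: h2; rewrite -ball_normE /= sub0r normrN.
near=> h.
have h0 : 0 < h by [].
have hr : h * c < r by rewrite -ltr_pdivlMr //; near: h; apply: nbhs_right_lt; rewrite divr_gt0.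
have small a : 0 <= a <= h -> `|a *: u + h *: v| < r /\ `|a *: u| < r /\ `|a *: u + h *: v| + `|a *: u| <= h * (2 * c).
  move=> /andP[a0 ah].
  have n1 : `|a *: u| <= h * `|u| by rewrite normrZ ger0_norm // ler_wpM2r.
  have n2 : `|a *: u + h *: v| <= h * `|u| + h * `|v|.
    by apply: le_trans (ler_normD _ _) _; rewrite lerD // normrZ gtr0_norm.
  have hv0 : 0 <= h * `|v| by rewrite mulr_ge0 // ltW.
  have hu0 : 0 <= h * `|u| by rewrite mulr_ge0 // ltW.
  have hcE : h * c = h * `|u| + h * `|v| + h by rewrite /c !mulrDr mulr1.
  split; first by apply: le_lt_trans n2 _; lra.
  split; first by apply: le_lt_trans n1 _; lra.
  by lra.
pose g a := f (x + (a *: u + h *: v)) - f (x + a *: u).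
pose g' a := 'D_u f (x + (a *: u + h *: v)) - 'D_u f (x + a *: u).
have line w (a : R) : A (x + (a *: u + w)) -> is_derive a (1 : R) (fun a => f (x + (a *: u + w)) : R) ('D_u f (x + (a *: u + w))).
  move=> Aw.
  have E b : x + (b *: u + w) = b *: u + (w + x) by rewrite addrC addrA.
  rewrite E (_ : (fun _ => _) = fun b => f (b *: u + (w + x))); last first.
    by apply/funext => b; rewrite E.
  apply: (is_derive_comp_curve (is_derive_line u (w + x) a)).
  by rewrite -E; exact: smooth_on_differentiable Aw.
have dg a : 0 <= a <= h -> is_derive a (1 : R) g (g' a).
  move=> /small[s1 [s2 _]]; apply: is_deriveB; first by apply: line; exact: inA.
  have := line 0 a; rewrite !addr0 => /(_ (inA _ s2)).
  by under eq_fun do rewrite addr0.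
have [th thI gE] : exists2 th, th \in `]0, h[ & g h - g 0 = g' th * (h - 0).
  apply: MVT => //.
    move=> a; rewrite in_itv /= => /andP[a0 ah]; apply: dg; lra.
  apply: derivable_within_continuous => a; rewrite in_itv /= => a0h.
  by have [] := dg _ a0h.
have th0h : 0 <= th <= h by move: thI; rewrite in_itv /= => /andP[? ?]; lra.
have -> : f (x + h *: u + h *: v) - f (x + h *: u) - f (x + h *: v) + f x = g' th * h.
  move: gE; rewrite subr0 /g => <-; rewrite scale0r add0r addr0 addrA; lra.
have [s1 [s2 s12]] := small _ th0h.
have E : g' th - h * 'D_v (fun y => 'D_u f y) x =
    ('D_u f (x + (th *: u + h *: v)) - 'D_u f x - L (th *: u + h *: v)) -
    ('D_u f (x + th *: u) - 'D_u f x - L (th *: u)).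
  rewrite (deriveE v du) -/L /g' linearD /= [L (h *: v)]linearZ /=.
  by rewrite /GRing.scale /=; ring.
have B : `|g' th - h * 'D_v (fun y => 'D_u f y) x| <= eps * h.
  rewrite E; apply: le_trans (ler_normB _ _) _.
  apply: le_trans (lerD (est _ s1) (est _ s2)) _.
  rewrite -mulrDr; apply: le_trans (ler_wpM2l _ s12) _.
    by rewrite divr_ge0 ?mulr_ge0 // ltW.
  by rewrite mulrCA mulrC divfK // ?mulf_neq0 // gt_eqF.
have -> : g' th * h - h ^+ 2 * 'D_v (fun y => 'D_u f y) x = (g' th - h * 'D_v (fun y => 'D_u f y) x) * h.
  by rewrite expr2; ring.
by rewrite normrM (gtr0_norm h0) expr2 mulrA ler_wpM2r // ltW.
Unshelve. all: by end_near.
Qed.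

End Schwarz.

Lemma dist_of_approx (R : realType) (s a b eps c : R) : 0 < c ->
  `|s - c * a| <= eps / 2 * c -> `|s - c * b| <= eps / 2 * c -> `|a - b| <= eps.
Proof.
move=> c0 h1 h2; rewrite -(ler_pM2l c0) -{1}(gtr0_norm c0) -normrM.
have -> : c * (a - b) = (s - c * b) - (s - c * a) by ring.
apply: le_trans (ler_normB _ _) _; apply: le_trans (lerD h2 h1) _.
by rewrite -mulrDl -splitr mulrC.
Qed.

(** The second difference is symmetric in [u] and [v], and divided by [h ^+ 2] it approximates both
    mixed derivatives. *)
Lemma derive_comm (R : realType) (U : normedModType R) (A : set U) (f : U -> R^o) x u v :
  open A -> A x -> smooth_on A f ->
  'D_v (fun y => 'D_u f y) x = 'D_u (fun y => 'D_v f y) x.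
Proof.
move=> oA Ax fA; apply/eqP; rewrite -subr_eq0 -normr_le0; apply/ler_addgt0Pl => eps eps0.
rewrite addr0; have e20 : 0 < eps / 2 by rewrite divr_gt0.
have [h [h0 h1 h2]] : exists h : R, [/\ 0 < h,
  `|f (x + h *: u + h *: v) - f (x + h *: u) - f (x + h *: v) + f x
    - h ^+ 2 * 'D_v (fun y => 'D_u f y) x| <= eps / 2 * h ^+ 2 &
  `|f (x + h *: v + h *: u) - f (x + h *: v) - f (x + h *: u) + f x
    - h ^+ 2 * 'D_u (fun y => 'D_v f y) x| <= eps / 2 * h ^+ 2].
  have H1 := second_difference oA Ax fA u v e20.
  have H2 := second_difference oA Ax fA v u e20.
  have H3 : \forall h \near (0 : R)^'+, 0 < h by exact: nbhs_right_gt.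
  have [h [h1 [h2 h3]]] := filter_ex (filterI H3 (filterI H1 H2)).
  exists h; split.
  - exact: h1.
  - exact: h2.
  - exact: h3.
have h20 : 0 < h ^+ 2 by rewrite exprn_gt0.
have E : f (x + h *: v + h *: u) - f (x + h *: v) - f (x + h *: u) + f x =
    f (x + h *: u + h *: v) - f (x + h *: u) - f (x + h *: v) + f x.
  by rewrite (addrAC x (h *: v)); congr (_ + _); rewrite [LHS]addrAC.
by rewrite E in h2; exact: (dist_of_approx h20 h1 h2).
Qed.

Section RowValued.
Variables (R : realType) (U : normedModType R) (m : nat).
Implicit Types f : U -> 'rV[R]_m.

Lemma derive_coord f x v j : differentiable f x ->
  'D_v (fun y => f y 0 j : R^o) x = ('D_v f x) 0 j.
Proof.
move=> df; have d : derivable f x v by exact: diff_derivable.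
by rewrite (derive_mx d) mxE.
Qed.

Lemma differentiable_rV_coord f x j : differentiable f x ->
  differentiable (fun y => f y 0 j : R^o) x.
Proof.
move=> df; apply: (@differentiable_comp _ _ _ _ f (fun M : 'rV[R]_m => M 0 j : R^o)) => //.
exact: differentiable_coord.
Qed.

Lemma differentiable_rV f x : (forall j, differentiable (fun y => f y 0 j : R^o) x) ->
  differentiable f x.
Proof.
move=> df; rewrite (_ : f = \sum_j (fun y => f y 0 j *: delta_mx 0 j)).
  by apply: differentiable_sum => j; exact: differentiableZl.
by apply/funext => y; rewrite fct_sumE -row_sum_delta.
Qed.

Lemma smooth_on_coord (A : set U) f j : open A -> smooth_on A f ->
  smooth_on A (fun y => f y 0 j : R^o).
Proof.
move=> oA fA.
have H := @smooth_on_coind R U R^o A (fun h => exists2 f : U -> 'rV[R]_m, smooth_on A f & h = fun y => f y 0 j).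
refine (H _ _ _ _ _) => //.
- move=> _ [g gA ->] x Ax; apply: differentiable_rV_coord.
  exact: smooth_on_differentiable Ax.
- move=> _ v [g gA ->]; exists (fun y => ('D_v g y) 0 j).
    by exists (fun y => 'D_v g y) => //; exact: smooth_on_derive.
  by move=> x Ax; apply: derive_coord; exact: smooth_on_differentiable Ax.
- by exists f.
Qed.

End RowValued.

(** * Coordinate changes of tangent vectors, differentials and tangent maps *)

Section ChartCalculus.
Variables (R : realType) (m : nat) (W : manifold R m).
Implicit Types (c d : chart R W m) (z : W).

Lemma cinv_mem c y : cimg c setT y -> cdom c (cinv c y) /\ cmap c (cinv c y) = y.
Proof. by move=> [z [cz _] <-]; rewrite cmapK. Qed.

Lemma cimgE c (U : set W) y : cimg c U y <-> cimg c setT y /\ U (cinv c y).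
Proof.
split=> [[z [cz Uz] <-]|[cy Uy]]; first by split; [exists z|rewrite cmapK].
by have [? E] := cinv_mem cy; exists (cinv c y).
Qed.

Lemma cimg_map c (U : set W) z : cdom c z -> U z -> cimg c U (cmap c z).
Proof. by exists z. Qed.

Lemma cimgT_open c : open (cimg c setT).
Proof. by have := @cimg_open _ _ _ c; rewrite /cimg setIT. Qed.

Lemma near_cinv c z (U : set W) : cdom c z -> open U -> U z ->
  \forall y \near cmap c z, cimg c U y.
Proof.
move=> cz oU Uz.
have n1 : \forall y \near cmap c z, cimg c setT y.
  by apply: open_nbhs_nbhs; split; [exact: cimgT_open|exact: cimg_map].
have n2 : \forall y \near cmap c z, U (cinv c y).
  have cc : nbhs (cinv c (cmap c z)) U by rewrite cmapK //; exact: open_nbhs_nbhs.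
  exact: (cinv_continuous cz cc).
by apply: filterS2 n1 n2 => y h1 h2; apply/cimgE.
Qed.

Lemma cimg_open_sub c (U : set W) : open U -> open (cimg c U).
Proof.
move=> oU; rewrite openE => _ [z [cz Uz] <-]; exact: near_cinv.
Qed.

(** A common form of [to_chart] and [from_chart], for which the chain rule becomes the cocycle
    identity. *)
Definition trans c d (y v : 'rV[R]_m) : 'rV[R]_m := 'D_v (cmap d \o cinv c) y.

Lemma trans_differentiable c d z : atlas c -> atlas d -> cdom c z -> cdom d z ->
  differentiable (cmap d \o cinv c) (cmap c z).
Proof.
move=> ac ad cz dz; apply: smooth_on_differentiable (atlas_smooth ac ad) _.
exact: cimg_map.
Qed.

Lemma near_change (V : Type) (f : W -> V) c d z : cdom c z -> cdom d z ->
  \forall y \near cmap d z, ((f \o cinv c) \o (cmap c \o cinv d)) y = (f \o cinv d) y.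
Proof.
move=> cz dz; apply: filterS (near_cinv dz (@cdom_open _ _ _ c) cz) => y /cimgE[_ cy].
by rewrite /= (cmapK cy).
Qed.

Lemma differentiable_change (V : normedModType R) (f : W -> V) c d z :
  atlas c -> atlas d -> cdom c z -> cdom d z ->
  differentiable (f \o cinv c) (cmap c z) -> differentiable (f \o cinv d) (cmap d z).
Proof.
move=> ac ad cz dz df; apply: near_eq_differentiable (near_change f cz dz) _.
apply: differentiable_comp; first exact: trans_differentiable.
by rewrite /= (cmapK dz).
Qed.

Lemma derive_change (V : normedModType R) (f : W -> V) c d z v :
  atlas c -> atlas d -> cdom c z -> cdom d z ->
  differentiable (f \o cinv c) (cmap c z) ->
  'D_v (f \o cinv d) (cmap d z) = 'D_(trans d c (cmap d z) v) (f \o cinv c) (cmap c z).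
Proof.
move=> ac ad cz dz df.
have dt := trans_differentiable ad ac dz cz.
have df' : differentiable (f \o cinv c) ((cmap c \o cinv d) (cmap d z)) by rewrite /= (cmapK dz).
rewrite -(near_eq_derive v (near_change f cz dz)) (derive_comp _ dt df').
by rewrite /= (cmapK dz).
Qed.

Lemma trans_id c z v : atlas c -> cdom c z -> trans c c (cmap c z) v = v.
Proof.
move=> ac cz; have nE : \forall y \near cmap c z, y = (cmap c \o cinv c) y.
  apply: filterS (near_cinv cz openT I) => y /cinv_mem[_ E].
  by rewrite /= E.
by rewrite /trans -(near_eq_derive v nE) derive_id.
Qed.

Lemma trans_comp b c d z v : atlas b -> atlas c -> atlas d ->
  cdom b z -> cdom c z -> cdom d z ->
  trans c d (cmap c z) (trans b c (cmap b z) v) = trans b d (cmap b z) v.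
Proof.
move=> ab ac ad bz cz dz; rewrite /trans -(@derive_change _ (cmap d) c b z v) //.
exact: trans_differentiable.
Qed.

Lemma to_chartE c z v : atlas c -> cdom c z ->
  to_chart c z v = trans (chart_at z) c (cmap (chart_at z) z) v.
Proof.
move=> ac cz.
have df := trans_differentiable (chart_at_atlas z) ac (chart_at_dom z) cz.
by rewrite /trans (deriveE v df).
Qed.

Lemma from_chartE c z v : atlas c -> cdom c z ->
  from_chart c (cmap c z) v = trans c (chart_at z) (cmap c z) v.
Proof.
move=> ac cz.
have df := trans_differentiable ac (chart_at_atlas z) cz (chart_at_dom z).
rewrite /from_chart (cmapK cz).
by rewrite /trans (deriveE v df).
Qed.

Lemma to_chartK c z v : atlas c -> cdom c z ->
  from_chart c (cmap c z) (to_chart c z v) = v.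
Proof.
move=> ac cz; have az := chart_at_atlas z; have dz := chart_at_dom z.
by rewrite from_chartE // to_chartE // trans_comp // trans_id.
Qed.

Lemma from_chartK c z v : atlas c -> cdom c z ->
  to_chart c z (from_chart c (cmap c z) v) = v.
Proof.
move=> ac cz; have az := chart_at_atlas z; have dz := chart_at_dom z.
by rewrite from_chartE // to_chartE // trans_comp // trans_id.
Qed.

Lemma dfun_chart (f : W -> R) c z v : atlas c -> cdom c z ->
  differentiable (f \o cinv c : 'rV[R]_m -> R^o) (cmap c z) ->
  dfun f z v = 'D_(to_chart c z v) (f \o cinv c : 'rV[R]_m -> R^o) (cmap c z).
Proof.
move=> ac cz df; have az := chart_at_atlas z; have dz := chart_at_dom z.
have df' : differentiable (f \o cinv (chart_at z) : 'rV[R]_m -> R^o) (coord_at z).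
  exact: (@differentiable_change R^o f c).
have -> : dfun f z v = 'D_v (f \o cinv (chart_at z) : 'rV[R]_m -> R^o) (coord_at z).
  by rewrite (deriveE v df').
rewrite to_chartE //; exact: (@derive_change R^o f c).
Qed.

Lemma tmap_chart (F : W -> W) c z v : atlas c -> cdom c z ->
  differentiable ((cmap (chart_at (F z)) \o F) \o cinv c) (cmap c z) ->
  tmap F z v = 'D_(to_chart c z v) ((cmap (chart_at (F z)) \o F) \o cinv c) (cmap c z).
Proof.
move=> ac cz df; have az := chart_at_atlas z; have dz := chart_at_dom z.
have df' : differentiable ((cmap (chart_at (F z)) \o F) \o cinv (chart_at z)) (coord_at z).
  exact: (@differentiable_change _ (cmap (chart_at (F z)) \o F) c).
have -> : tmap F z v = 'D_v ((cmap (chart_at (F z)) \o F) \o cinv (chart_at z)) (coord_at z).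
  by rewrite (deriveE v df').
rewrite to_chartE //; exact: (@derive_change _ (cmap (chart_at (F z)) \o F) c).
Qed.

Lemma to_chart_self (x : W) v : to_chart (chart_at x) x v = v.
Proof. by rewrite to_chartE ?trans_id //; by [exact: chart_at_atlas|exact: chart_at_dom]. Qed.

End ChartCalculus.

Section SmoothCompositions.
Variables (R : realType) (U : normedModType R) (m : nat) (A : set U).
Hypothesis oA : open A.

Lemma smooth_on_comp_rV (B : set 'rV[R]_m) (h : 'rV[R]_m -> R^o) (r : U -> 'rV[R]_m) :
  smooth_on B h -> (forall u, A u -> B (r u)) -> msmooth A r ->
  smooth_on A (fun u => h (r u) : R^o).
Proof.
move=> hB rB sr.
have E : (fun u => h (r u)) = fun u => h (\sum_j r u 0 j *: delta_mx 0 j).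
  by apply/funext => u; rewrite -row_sum_delta.
rewrite E; apply: (smooth_on_comp oA hB) => [u Au|j]; last exact: sr.
by rewrite -row_sum_delta; exact: rB.
Qed.

Lemma smooth_on_comp_pair (B : set (R^o * 'rV[R]_m)) (h : R^o * 'rV[R]_m -> R^o)
    (a : U -> R^o) (r : U -> 'rV[R]_m) :
  smooth_on B h -> (forall u, A u -> B (a u, r u)) -> smooth_on A a -> msmooth A r ->
  smooth_on A (fun u => h (a u, r u) : R^o).
Proof.
move=> hB rB sa sr.
(* The pair is written as a combination of fixed vectors, index 0 being the time direction, to match
   the form required by [smooth_on_comp]. *)
pose b (i : 'I_m.+1) : R^o * 'rV[R]_m := if unlift ord0 i is Some j then (0, delta_mx 0 j) else (1, 0).
pose g (i : 'I_m.+1) u : R^o := if unlift ord0 i is Some j then r u 0 j else a u.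
have E u : (a u, r u) = \sum_i g i u *: b i.
  rewrite big_ord_recl /g /b unlift_none.
  under eq_bigr do rewrite liftK.
  have -> : \sum_i r u 0 i *: ((0, delta_mx 0 i) : R^o * 'rV[R]_m) = (0, r u).
    have sp (F : 'I_m -> R^o) (H : 'I_m -> 'rV[R]_m) :
        \sum_i ((F i, H i) : R^o * 'rV[R]_m) = (\sum_i F i, \sum_i H i).
      by elim/big_rec3 : _ => // i y1 y2 y3 _ ->.
    rewrite {2}[r u]row_sum_delta.
    transitivity (\sum_i ((0, r u 0 i *: delta_mx 0 i) : R^o * 'rV[R]_m)).
      by apply: eq_bigr => i _; congr pair; rewrite scaler0.
    by rewrite sp big1.
  by congr pair; rewrite /= ?scaler0 ?add0r // addr0 [RHS]mulr1.
under eq_fun do rewrite E; apply: (smooth_on_comp oA hB) => [u Au|i].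
  by rewrite -E; exact: rB.
by rewrite /g; case: (unlift ord0 i) => [j|]; [exact: sr|exact: sa].
Qed.

Lemma msmooth_coord (r : U -> 'rV[R]_m) : smooth_on A r -> msmooth A r.
Proof. by move=> sr i j; rewrite (ord1 i); exact: smooth_on_coord. Qed.

Lemma msmooth_differentiable (r : U -> 'rV[R]_m) x : msmooth A r -> A x -> differentiable r x.
Proof.
by move=> sr Ax; apply: differentiable_rV => j; exact: smooth_on_differentiable (sr 0 j) Ax.
Qed.

End SmoothCompositions.

Lemma smooth_on_rV_coord (R : realType) m (A : set 'rV[R]_m) j : open A ->
  smooth_on A (fun y : 'rV[R]_m => y 0 j : R^o).
Proof.
move=> oA; apply: smooth_on_coord => //.
have H := (@smooth_on_coind R _ _ A (fun h : 'rV[R]_m -> 'rV[R]_m => h = id \/ exists c, h = fun=> c)).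
apply: H => //; last by left.
- by move=> _ [->|[c ->]] y _; [exact: ex_diff|exact: differentiable_cst].
- move=> _ v [->|[c ->]].
    by exists (fun=> v); [right; exists v|move=> y _; exact: derive_id].
  by exists (fun=> 0); [right; exists 0|move=> y _; exact: derive_cst].
Qed.

(** * Flows *)

Section LocalFlow.
Variables (R : realType) (m : nat) (W : manifold R m).
Variables (X : W -> 'rV[R]_m) (Om : set (R^o * W)) (Phi : R -> W -> W).
Hypothesis flow : is_flow X Om Phi.
Variable c : chart R W m.
Hypothesis ac : atlas c.

Definition local_flow (p : R^o * 'rV[R]_m) : 'rV[R]_m := cmap c (Phi p.1 (cinv c p.2)).
Definition local_dom : set (R^o * 'rV[R]_m) :=
  [set p | [/\ cimg c setT p.2, Om (p.1, cinv c p.2) & cdom c (Phi p.1 (cinv c p.2))]].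
Definition local_field (y : 'rV[R]_m) : 'rV[R]_m := to_chart c (cinv c y) (X (cinv c y)).
Local Notation phi := local_flow.
Local Notation N := local_dom.
Local Notation xi := local_field.

Lemma local_dom_open : open N.
Proof.
rewrite openE => p [p1 p2 p3].
have [dp _] := cinv_mem p1.
have k1 : q.1 @[q --> p] --> p.1.
  by case: p {p1 p2 p3 dp} => t y; exact: (@cvg_fst _ _ (nbhs t) (nbhs y)).
have k2 : q.2 @[q --> p] --> p.2.
  by case: p {p1 p2 p3 dp k1} => t y; exact: (@cvg_snd _ _ (nbhs t) (nbhs y)).
have k (B : set (R^o * W)) : nbhs ((p.1, cinv c p.2) : R^o * W) B -> \forall q \near p, B (q.1, cinv c q.2).
  have cc := cinv_continuous dp; have [_ E] := cinv_mem p1; rewrite E in cc.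
  move=> [[B1 B2] [/= b1 b2] sB].
  have m1 : \forall q \near p, B1 q.1 by exact: (k1 _ b1).
  have m2 : \forall q \near p, B2 (cinv c q.2) by exact: (k2 _ (cc _ b2)).
  by apply: filterS2 m1 m2 => q q1 q2; apply: sB.
have n1 : \forall q \near p, cimg c setT q.2.
  have n : nbhs p.2 (cimg c setT) by apply: open_nbhs_nbhs; split => //; exact: cimgT_open.
  exact: (k2 _ n).
have n2 : \forall q \near p, Om (q.1, cinv c q.2).
  have n : nbhs ((p.1, cinv c p.2) : R^o * W) Om by apply: open_nbhs_nbhs; split => //; exact: flow_open flow.
  exact: (k _ n).
have n3 : \forall q \near p, cdom c (Phi q.1 (cinv c q.2)).
  have := flow_continuous flow p2 => fc.
  have n : nbhs (Phi p.1 (cinv c p.2)) (cdom c) by apply: open_nbhs_nbhs; split => //; exact: cdom_open.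
  exact: (k _ (fc _ n)).
by apply: filterS3 n1 n2 n3.
Qed.

Lemma local_flow_smooth : smooth_on N phi.
Proof. exact: (flow_smooth flow ac ac). Qed.

Lemma local_dom0 y : cimg c setT y -> N (0, y).
Proof.
by move=> cy; split=> //=; [exact: flow_dom0 flow _|rewrite (flow0 flow); have [] := cinv_mem cy].
Qed.

Lemma local_flow0 y : cimg c setT y -> phi (0, y) = y.
Proof. by move=> cy; rewrite /phi /= (flow0 flow); have [] := cinv_mem cy. Qed.

Lemma local_flow_img p : N p -> cimg c setT (phi p).
Proof. by move=> [_ _ h]; exact: cimg_map. Qed.

Lemma cinv_local_flow p : N p -> cinv c (phi p) = Phi p.1 (cinv c p.2).
Proof. by move=> [_ _ h]; rewrite /phi cmapK. Qed.

(** The flow equation is given in the preferred chart at the endpoint, which varies with [t]; the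
    chain rule transfers it to the fixed chart [c]. *)
Lemma local_flow_ode t y : N (t, y) ->
  is_derive (t : R) (1 : R) (fun s : R => phi (s, y)) (xi (phi (t, y))).
Proof.
move=> Nty; have [_ /= Omt dt] := Nty; set z := cinv c y in Omt dt *.
have fd := flow_derive flow Omt.
have aw := chart_at_atlas (Phi t z); have dw := chart_at_dom (Phi t z).
have dtr := trans_differentiable aw ac dw dt.
have near_dom : \forall s \near (t : R), cdom (chart_at (Phi t z)) (Phi s z).
  have n : nbhs (Phi t z) (cdom (chart_at (Phi t z))).
    by apply: open_nbhs_nbhs; split => //; exact: cdom_open.
  have [[B1 B2] [/= b1 b2] sB] := flow_continuous flow Omt n.
  have m1 : \forall s \near (t : R), B1 s by exact: b1.
  apply: filterS m1 => s s1; apply: (sB (s, z)); split => //=; exact: nbhs_singleton b2.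
have E : xi (phi (t, y)) = 'D_(X (Phi t z)) (cmap c \o cinv (chart_at (Phi t z))) (cmap (chart_at (Phi t z)) (Phi t z)).
  by rewrite /xi (cinv_local_flow Nty) to_chartE.
rewrite E; apply: (near_eq_is_derive _ (is_derive_comp_curve fd dtr)).
by apply: filterS near_dom => s ds; rewrite /phi /= (cmapK ds).
Qed.

Lemma local_flow_dt t y : N (t, y) -> 'D_((1, 0) : R^o * 'rV[R]_m) phi (t, y) = xi (phi (t, y)).
Proof.
move=> Nty; have [_ <-] := local_flow_ode Nty.
have dphi : differentiable phi ((t, y) : R^o * 'rV[R]_m).
  by apply: smooth_on_differentiable Nty; exact: local_flow_smooth.
have line (s : R) : s *: ((1, 0) : R^o * 'rV[R]_m) + (0, y) = (s, y).
  by congr pair; rewrite /= ?scaler0 ?add0r // addr0 [LHS]mulr1.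
have := is_derive_line ((1, 0) : R^o * 'rV[R]_m) (0, y) t.
rewrite (_ : (fun s => _) = fun s : R => ((s, y) : R^o * 'rV[R]_m)); last first.
  by apply/funext => s; exact: line.
by move=> /is_derive_comp_curve/(_ dphi)[_ ->].
Qed.

(** The smoothness of the field is read off the flow: [xi] is the time derivative at time 0 of the
    jointly smooth local flow. *)
Lemma local_field_smooth : msmooth (cimg c setT) xi.
Proof.
have oc := @cimgT_open _ _ _ c.
move=> i j; rewrite (ord1 i).
have s1 : smooth_on N (fun p => phi p 0 j : R^o).
  by apply: smooth_on_coord; [exact: local_dom_open|exact: local_flow_smooth].
have s2 := smooth_on_derive ((1, 0) : R^o * 'rV[R]_m) s1.
have s3 : smooth_on (cimg c setT) (fun y : 'rV[R]_m => 'D_((1, 0) : R^o * 'rV[R]_m) (fun p => phi p 0 j : R^o) (0, y) : R^o).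
  apply: (smooth_on_comp_pair oc s2) => [y cy||k l]; first exact: local_dom0.
    exact: smooth_on_cst.
  rewrite (ord1 k); exact: smooth_on_rV_coord.
apply: (eq_smooth_on oc _ s3) => y cy.
rewrite derive_coord; last by apply: smooth_on_differentiable (local_dom0 cy); exact: local_flow_smooth.
by rewrite local_flow_dt ?local_flow0 //; exact: local_dom0.
Qed.

End LocalFlow.

Definition mdir (R : realType) (U : normedModType R) a b (v : U) (M : U -> 'M[R]_(a, b)) (x : U) : 'M[R]_(a, b) :=
  \matrix_(i, j) 'D_v (fun x => M x i j : R^o) x.

Lemma is_derive0_const (R : realType) (G : R -> R) (eps t : R) : `|t| < eps ->
  (forall s, `|s| < eps -> is_derive (s : R) (1 : R) G 0) -> G t = G 0.
Proof.
move=> te dG; have eps0 : 0 < eps by apply: le_lt_trans te.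
move: te; rewrite ltr_norml => /andP[te1 te2].
have dG' s : - eps < s < eps -> is_derive (s : R) (1 : R) G 0.
  by move=> se; apply: dG; rewrite ltr_norml.
have [t0|t0|->//] := ltgtP t 0.
- have [] := @MVT R G (fun=> 0) t 0 t0.
  + by move=> s; rewrite in_itv /= => /andP[a b]; apply: dG'; rewrite (lt_trans te1) //= (lt_trans b).
  + apply: derivable_within_continuous => s; rewrite in_itv /= => /andP[a b].
    by have [] // := dG' s; rewrite (lt_le_trans te1) //= (le_lt_trans b).
  + by move=> s _; rewrite mul0r => /eqP; rewrite subr_eq0 => /eqP ->.
- have [] := @MVT R G (fun=> 0) 0 t t0.
  + by move=> s; rewrite in_itv /= => /andP[a b]; apply: dG'; rewrite (lt_trans _ a) ?oppr_lt0 //= (lt_trans b).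
  + apply: derivable_within_continuous => s; rewrite in_itv /= => /andP[a b].
    by have [] // := dG' s; rewrite (lt_le_trans _ a) ?oppr_lt0 //= (le_lt_trans b).
  + by move=> s _; rewrite mul0r => /eqP; rewrite subr_eq0 => /eqP ->.
Qed.

Section DirectionalMatrix.
Variables (R : realType) (U : normedModType R) (A : set U) (x v : U).
Hypotheses (oA : open A) (Ax : A x).

Lemma mdir_cst a b (M : 'M[R]_(a, b)) : mdir v (fun=> M) x = 0.
Proof. by apply/matrixP => i j; rewrite !mxE derive_cst. Qed.

Lemma mdir_tr a b (M : U -> 'M[R]_(a, b)) : mdir v (fun x => (M x)^T) x = (mdir v M x)^T.
Proof. by apply/matrixP => i j; rewrite !mxE; under eq_fun do rewrite mxE. Qed.

Lemma near_eq_mdir a b (M N : U -> 'M[R]_(a, b)) :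
  (\forall y \near x, M y = N y) -> mdir v M x = mdir v N x.
Proof.
move=> MN; apply/matrixP => i j; rewrite !mxE; apply: near_eq_derive.
by apply: filterS MN => u ->.
Qed.

Lemma mdirM a b c (M : U -> 'M[R]_(a, b)) (N : U -> 'M[R]_(b, c)) :
  msmooth A M -> msmooth A N ->
  mdir v (fun y => M y *m N y) x = mdir v M x *m N x + M x *m mdir v N x.
Proof.
move=> sM sN; apply/matrixP => i j; rewrite mxE [RHS]mxE !mxE.
under eq_fun do rewrite mxE.
have -> : (fun y => \sum_k M y i k * N y k j : R^o) = \sum_k ((fun y => M y i k) * (fun y => N y k j) : U -> R).
  by apply/funext => u; rewrite fct_sumE.
have dM k : derivable (fun y => M y i k : R) x v.
  by apply: diff_derivable; exact: smooth_on_differentiable (sM i k) Ax.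
have dN k : derivable (fun y => N y k j : R) x v.
  by apply: diff_derivable; exact: smooth_on_differentiable (sN k j) Ax.
rewrite derive_sum; last by move=> k; apply: derivableM; [exact: dM|exact: dN].
rewrite -big_split; apply: eq_bigr => k _ /=.
rewrite (deriveM (dM k) (dN k)) addrC !mxE; congr (_ + _).
by rewrite [LHS]mulrC.
Qed.

Lemma mdir_rV a (r : U -> 'rV[R]_a) : msmooth A r -> mdir v r x = 'D_v r x.
Proof.
move=> sr; have dr : differentiable r x by exact: msmooth_differentiable Ax.
by apply/rowP => j; rewrite mxE derive_coord.
Qed.

Lemma mdir_lin a b (M : U -> 'M[R]_(a, b)) : msmooth A M -> forall (k : R) u w,
  mdir (k *: u + w) M x = k *: mdir u M x + mdir w M x.
Proof.
move=> sM k u w; apply/matrixP => i j; rewrite !mxE.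
have d := smooth_on_differentiable (sM i j) Ax.
by rewrite (deriveE _ d) (deriveE u d) (deriveE w d) linearP.
Qed.

End DirectionalMatrix.

Lemma mdir_comp (R : realType) (U V : normedModType R) (B : set V) a b
    (M : V -> 'M[R]_(a, b)) (g : U -> V) (x v : U) :
  differentiable g x -> msmooth B M -> B (g x) ->
  mdir v (fun x => M (g x)) x = mdir ('D_v g x) M (g x).
Proof.
move=> dg sM Bx; apply/matrixP => i j; rewrite mxE [RHS]mxE.
exact: (derive_comp v dg (smooth_on_differentiable (sM i j) Bx)).
Qed.

Lemma mderive_comp_curve (R : realType) (U : normedModType R) (A : set U) a b
    (M : U -> 'M[R]_(a, b)) (ga : R -> U) (t : R) ga' :
  A (ga t) -> msmooth A M -> is_derive t (1 : R) ga ga' ->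
  mderive (fun s => M (ga s)) t = mdir ga' M (ga t).
Proof.
move=> At sM dg; apply/matrixP => i j; rewrite !mxE derive1E.
have d := smooth_on_differentiable (sM i j) At.
by have [_ ->] := is_derive_comp_curve dg d.
Qed.

(** * The linearized flow *)

Section FlowDerivative.
Variables (R : realType) (m : nat) (W : manifold R m).
Variables (X : W -> 'rV[R]_m) (Om : set (R^o * W)) (Phi : R -> W -> W).
Hypothesis flow : is_flow X Om Phi.
Variable c : chart R W m.
Hypothesis ac : atlas c.

Local Notation phi := (local_flow Phi c).
Local Notation N := (local_dom Om Phi c).
Local Notation xi := (local_field X c).
Let oN : open N. Proof. exact: local_dom_open flow _. Qed.
Let sphi : smooth_on N phi := local_flow_smooth flow ac.
Let oV : open (cimg c setT). Proof. exact: cimgT_open. Qed.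

Definition space_derive (p : R^o * 'rV[R]_m) (v : 'rV[R]_m) : 'rV[R]_m :=
  'D_((0, v) : R^o * 'rV[R]_m) phi p.
Local Notation dphi := space_derive.

Lemma space_derive_smooth v : msmooth N (dphi^~ v).
Proof. by apply: msmooth_coord => //; exact: smooth_on_derive. Qed.

Lemma space_derive_lin p : N p -> linear (dphi p).
Proof.
move=> Np k u w; have d := smooth_on_differentiable sphi Np.
rewrite /dphi (deriveE _ d) (deriveE ((0, u) : R^o * 'rV[R]_m) d) (deriveE ((0, w) : R^o * 'rV[R]_m) d) -linearP.
by congr ('d _ _ _); congr pair; rewrite /= scaler0 addr0.
Qed.

Lemma time_slice_derive (t : R) (y : 'rV[R]_m) :
  is_derive t (1 : R) (fun s : R => ((s, y) : R^o * 'rV[R]_m)) ((1, 0) : R^o * 'rV[R]_m).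
Proof.
have := is_derive_line ((1, 0) : R^o * 'rV[R]_m) (0, y) t.
rewrite (_ : (fun s => _) = fun s : R => ((s, y) : R^o * 'rV[R]_m)) //.
by apply/funext => s; congr pair; rewrite /= ?scaler0 ?add0r // addr0 [LHS]mulr1.
Qed.

(** The variational equation of the flow: exchange the time and space derivatives of each coordinate
    of the local flow, then differentiate the flow equation in space. *)
Lemma space_derive_dt t y v : N (t, y) ->
  mdir ((1, 0) : R^o * 'rV[R]_m) (dphi^~ v) (t, y) = 'D_(dphi (t, y) v) xi (phi (t, y)).
Proof.
move=> Nty; have sxi := local_field_smooth flow ac.
have cy : cimg c setT (phi (t, y)) by exact: local_flow_img Nty.
have dxi : differentiable xi (phi (t, y)) by exact: msmooth_differentiable cy.
have dph p : N p -> differentiable phi p by exact: smooth_on_differentiable.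
apply/rowP => j; rewrite mxE.
have s1 : smooth_on N (fun p => phi p 0 j : R^o) by exact: smooth_on_coord.
have E1 w : \forall p \near ((t, y) : R^o * 'rV[R]_m), ('D_w phi p) 0 j = 'D_w (fun p => phi p 0 j : R^o) p.
  have n : \forall p \near ((t, y) : R^o * 'rV[R]_m), N p by exact: open_nbhs_nbhs.
  by apply: filterS n => p Np; rewrite derive_coord //; exact: dph.
rewrite (near_eq_derive _ (E1 _)) (derive_comm _ _ oN Nty s1).
have E2 : \forall p \near ((t, y) : R^o * 'rV[R]_m), 'D_((1, 0) : R^o * 'rV[R]_m) (fun p => phi p 0 j : R^o) p = ((fun y => xi y 0 j : R^o) \o phi) p.
  have n : \forall p \near ((t, y) : R^o * 'rV[R]_m), N p by exact: open_nbhs_nbhs.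
  apply: filterS n => p Np; rewrite derive_coord; last exact: dph.
  by case: p Np => t' y' Np; rewrite (local_flow_dt flow ac Np).
rewrite (near_eq_derive _ E2) derive_comp; [|exact: dph|exact: differentiable_rV_coord].
by rewrite derive_coord.
Qed.

Lemma space_derive0 y v : cimg c setT y -> dphi (0, y) v = v.
Proof.
move=> cy; have N0 := local_dom0 flow cy.
have line (s : R) : s *: ((0, v) : R^o * 'rV[R]_m) + (0, y) = (0, s *: v + y).
  by congr pair; rewrite /= scaler0 addr0.
have d := smooth_on_differentiable sphi N0.
have d' : differentiable phi (0 *: ((0, v) : R^o * 'rV[R]_m) + (0, y)) by rewrite scale0r add0r.
have [_] := is_derive_comp_curve (is_derive_line ((0, v) : R^o * 'rV[R]_m) (0, y) 0) d'.
rewrite scale0r add0r /space_derive => <-.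
have [_ E] := is_derive_line v y 0; rewrite -[RHS]E; apply: near_eq_derive.
have cl : (s *: v + y) @[s --> (0 : R)] --> y.
  rewrite -[X in _ --> X]add0r -(scale0r v); apply: cvgD; last exact: cvg_cst.
  by apply: cvgZr_tmp; exact: cvg_id.
have n : nbhs y (cimg c setT) by exact: open_nbhs_nbhs.
have n' : \forall s \near (0 : R), cimg c setT (s *: v + y) by exact: (cl _ n).
apply: filterS n' => s cs; rewrite line; exact: (local_flow0 flow cs).
Qed.

End FlowDerivative.

(** * Invariance of the symplectic form under a Hamiltonian flow *)

Section HamiltonianFlow.
Variables (R : realType) (m : nat) (W : symplectic_manifold R m).
Variables (H : W -> R) (Om : set (R^o * W)) (Phi : R -> W -> W).
Hypothesis H_smooth : smooth_fun setT H.
Hypothesis flow : is_flow (ham H) Om Phi.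
Variable c : chart R W m.
Hypothesis ac : atlas c.

Local Notation phi := (local_flow Phi c).
Local Notation N := (local_dom Om Phi c).
Local Notation xi := (local_field (ham H) c).
Local Notation dphi := (space_derive Phi c).
Let oN : open N. Proof. exact: local_dom_open flow _. Qed.
Let oV : open (cimg c setT). Proof. exact: cimgT_open. Qed.

Definition local_form (y : 'rV[R]_m) : 'M[R]_m :=
  \matrix_(i, j) form_in_chart (@omega R m W) c (delta_mx 0 i) (delta_mx 0 j) y.
Local Notation Omc := local_form.

Lemma local_formE y u v : form_in_chart (@omega R m W) c u v y = mxform (Omc y) u v.
Proof.
pose P := lin1_mx ('d (cmap (chart_at (cinv c y)) \o cinv c) y).
have fE u' v' : form_in_chart (@omega R m W) c u' v' y = mxform (P *m omega (cinv c y) *m P^T) u' v'.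
  by rewrite /form_in_chart /mxform !mulmxA mul_rV_lin1 -(mulmxA _ P^T) -trmx_mul mul_rV_lin1.
rewrite fE; congr (mxform _ _ _); apply/matrixP => i j.
by rewrite [RHS]mxE fE -[RHS]/(dot _ _) dot_delta -rowE [RHS]mxE.
Qed.

Lemma local_form_smooth : msmooth (cimg c setT) Omc.
Proof. by move=> i j; under eq_fun do rewrite mxE; exact: omega_smooth. Qed.

Lemma derive_local_form y u v w : cimg c setT y ->
  'D_u (form_in_chart (@omega R m W) c v w) y = mxform (mdir u Omc y) v w.
Proof.
move=> cy.
have cst_s a b (M : 'M[R]_(a, b)) : msmooth (cimg c setT) (fun _ : 'rV[R]_m => M) by exact: msmooth_cst.
have sO := local_form_smooth.
have -> : form_in_chart (@omega R m W) c v w = fun y => (v *m Omc y *m w^T) 0 0.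
  by apply/funext => z; rewrite local_formE.
transitivity (mdir u (fun y => v *m Omc y *m w^T) y 0 0); first by rewrite mxE.
rewrite (mdirM u cy) //; last exact: msmoothM.
by rewrite (mdirM u cy) // !mdir_cst mul0mx add0r mulmx0 addr0.
Qed.

Lemma local_form_closed y u v w : cimg c setT y ->
  mxform (mdir u Omc y) v w + mxform (mdir v Omc y) w u + mxform (mdir w Omc y) u v = 0.
Proof.
move=> cy; have := @omega_closed _ _ W c ac u v w y cy.
by rewrite (derive_local_form u v w cy) (derive_local_form v w u cy) (derive_local_form w u v cy).
Qed.

Lemma mxform_skew (A : 'M[R]_m) u v : A^T = - A -> mxform A u v = - mxform A v u.
Proof.
move=> As; rewrite /mxform -[LHS]/((u *m A *m v^T) 0 0) -[in LHS](trmxK (u *m A *m v^T)) mxE.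
by rewrite trmx_mul trmxK trmx_mul As mulNmx mulmxN mulmxA mxE.
Qed.

Lemma local_form_skew y : (Omc y)^T = - Omc y.
Proof.
apply/matrixP => i j; rewrite !mxE /form_in_chart mxform_skew //; exact: omega_skew.
Qed.

Lemma mdir_local_form_skew y u : cimg c setT y -> (mdir u Omc y)^T = - mdir u Omc y.
Proof.
move=> cy; rewrite -mdir_tr; apply/matrixP => i j; rewrite mxE [RHS]mxE [X in - X]mxE.
under eq_fun do rewrite local_form_skew mxE.
have d : derivable (fun y => Omc y i j : R^o) y u.
  by apply: diff_derivable; exact: smooth_on_differentiable (local_form_smooth i j) cy.
exact: (deriveN d).
Qed.

(** Inverting the Gram matrix [omega z] yields a solution of the defining equation, so [ham] does
    not fall back on its default. *)
Lemma hamP z v : dfun H z v = sform z v (ham H z).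
Proof.
rewrite /ham; case: xgetP => [w _ //|].
pose g : 'cV[R]_m := \col_i dfun H z (delta_mx 0 i).
move=> /(_ ((invmx (omega z) *m g)^T)); case=> u.
rewrite /sform /mxform trmxK -mulmxA (mulmxA (omega z)) mulmxV ?omega_nondegenerate // mul1mx.
rewrite {1}(row_sum_delta u) /dfun linear_sum mxE; apply: eq_bigr => i _.
by rewrite linearZ /= !mxE.
Qed.

Let h := (H \o cinv c : 'rV[R]_m -> R^o).

Lemma local_ham_smooth : smooth_on (cimg c setT) h.
Proof. exact: H_smooth. Qed.

Lemma local_hamE y v : cimg c setT y -> 'D_v h y = mxform (Omc y) v (xi y).
Proof.
move=> cy; have [cz E] := cinv_mem cy; set z := cinv c y in cz E *.
have dh : differentiable h (cmap c z).
  by rewrite E; exact: smooth_on_differentiable local_ham_smooth cy.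
have := dfun_chart (from_chart c y v) ac cz dh.
rewrite -{2}E from_chartK // E hamP => <-.
rewrite -local_formE /form_in_chart -/z /xi -/z /sform; congr (mxform _ _ _).
by rewrite -{1}E to_chartK.
Qed.

(* [L_X omega = 0] for the Hamiltonian field [X], on constant coordinate fields:
   it combines closedness with the symmetry of second derivatives of [H]. *)
Lemma lie_derive_form y a b : cimg c setT y ->
  mxform (mdir (xi y) Omc y) a b + mxform (Omc y) ('D_a xi y) b + mxform (Omc y) a ('D_b xi y) = 0.
Proof.
have arith (t1 t2 t3 t4 t5 t6 t7 : R) : t1 + t2 = t3 + t4 -> t3 + t5 + t6 = 0 ->
  t1 = - t5 -> t4 = - t7 -> t6 + t7 + t2 = 0 by move=> *; lra.
move=> cy; have sxi := local_field_smooth flow ac; have sO := local_form_smooth.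
have second u v : 'D_u (fun y => 'D_v h y) y = mxform (mdir u Omc y) v (xi y) + mxform (Omc y) v ('D_u xi y).
  have cst_s k l (M : 'M[R]_(k, l)) : msmooth (cimg c setT) (fun _ : 'rV[R]_m => M) by exact: msmooth_cst.
  transitivity (mdir u (fun y => v *m Omc y *m (xi y)^T) y 0 0).
    rewrite mxE; apply: near_eq_derive.
    have n : nbhs y (cimg c setT) by exact: open_nbhs_nbhs.
    by apply: filterS n => y' cy'; rewrite local_hamE.
  rewrite (mdirM u cy); [|exact: msmoothM|exact: msmooth_tr].
  by rewrite (mdirM u cy) // mdir_cst mul0mx add0r mdir_tr (mdir_rV u cy) // mxE.
have E := derive_comm a b oV cy local_ham_smooth.
rewrite !second in E.
have cl := local_form_closed a b (xi y) cy.
have sk1 := mxform_skew a (xi y) (mdir_local_form_skew b cy).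
have sk2 := mxform_skew b ('D_a xi y) (local_form_skew y).
exact: (arith _ _ _ _ _ _ _ E cl sk1 sk2).
Qed.

Lemma near_local_dom (y0 : 'rV[R]_m) : cimg c setT y0 -> exists2 eps : R, 0 < eps &
  forall t y, `|t| < eps -> ball y0 eps y -> N (t, y).
Proof.
move=> cy; have : nbhs ((0, y0) : R^o * 'rV[R]_m) N.
  by apply: open_nbhs_nbhs; split => //; exact: (local_dom0 flow cy).
move=> /nbhs_ballP[eps /= e0 sub]; exists eps => // t y te ye.
by apply: sub; split => //=; rewrite /ball /= sub0r normrN.
Qed.

(** By the variational equation, the time derivative of the pulled-back form is the Lie derivative
    of the form evaluated on the transported vectors, hence zero. Constancy uses the mean value
    theorem, so the orbit has to stay in the chart during a whole interval of times. *)
Lemma flow_symplectic (eps t : R) y u v : `|t| < eps -> (forall s, `|s| < eps -> N (s, y)) ->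
  mxform (Omc (phi (t, y))) (dphi (t, y) u) (dphi (t, y) v) = mxform (Omc y) u v.
Proof.
move=> te Ny; have eps0 : 0 < eps by apply: le_lt_trans te.
pose F (p : R^o * 'rV[R]_m) : 'M[R]_1 := dphi p u *m Omc (phi p) *m (dphi p v)^T.
have sO := local_form_smooth; have sxi := local_field_smooth flow ac.
have s1 := space_derive_smooth flow ac.
have sph : msmooth N phi := msmooth_coord oN (local_flow_smooth flow ac).
have sOp : msmooth N (fun p => Omc (phi p)).
  move=> i j; apply: (smooth_on_comp_rV oN (sO i j)) => // p Np; exact: (local_flow_img Np).
have s2 : msmooth N (fun p => dphi p u *m Omc (phi p)) by exact: msmoothM.
have s3 : msmooth N (fun p => (dphi p v)^T) by exact: msmooth_tr.
have sF : msmooth N F by exact: msmoothM.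
have dF s : `|s| < eps -> mdir ((1, 0) : R^o * 'rV[R]_m) F (s, y) = 0.
  move=> se; have Ns := Ny s se; have cs := local_flow_img Ns.
  have dph := smooth_on_differentiable (local_flow_smooth flow ac) Ns.
  have e3 := etrans (mdir_comp ((1, 0) : R^o * 'rV[R]_m) dph sO cs)
    (congr1 (fun w => mdir w Omc (phi (s, y))) (local_flow_dt flow ac Ns)).
  have comb a' M' b' : mdir ((1, 0) : R^o * 'rV[R]_m) (dphi^~ u) (s, y) = a' ->
      mdir ((1, 0) : R^o * 'rV[R]_m) (fun p => Omc (phi p)) (s, y) = M' ->
      mdir ((1, 0) : R^o * 'rV[R]_m) (dphi^~ v) (s, y) = b' ->
      mdir ((1, 0) : R^o * 'rV[R]_m) F (s, y) =
      (a' *m Omc (phi (s, y)) + dphi (s, y) u *m M') *m (dphi (s, y) v)^T +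
      dphi (s, y) u *m Omc (phi (s, y)) *m b'^T.
    move=> E1 E2 E3.
    have D1 := mdirM ((1, 0) : R^o * 'rV[R]_m) Ns s2 s3.
    have D2 := mdirM ((1, 0) : R^o * 'rV[R]_m) Ns (s1 u) sOp.
    apply: (etrans D1); apply: (congr2 +%R).
      apply: (congr1 (mulmx^~ _)); apply: (etrans D2).
      by apply: (congr2 +%R); [exact: (congr1 (mulmx^~ _) E1)|exact: (congr1 (mulmx _) E2)].
    apply: (congr1 (mulmx _)); apply: etrans (mdir_tr _ _ _) _.
    exact: (congr1 trmx E3).
  apply: etrans (comb _ _ _ (space_derive_dt flow ac u Ns) e3 (space_derive_dt flow ac v Ns)) _.
  have := lie_derive_form (dphi (s, y) u) (dphi (s, y) v) cs.
  move: (dphi (s, y) u) (dphi (s, y) v) (mdir _ Omc _) (Omc _) => a b M O.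
  move: ('D_a _ _) ('D_b _ _) => a' b' E.
  apply/matrixP => i j; rewrite !ord1 mulmxDl [RHS]mxE -[RHS]E /mxform.
  by rewrite mxE [X in X + _]mxE [X in X + _ = _]addrC.
have dFs s : `|s| < eps -> is_derive (s : R) (1 : R) (fun s : R => F (s, y) 0 0) 0.
  move=> se; have Ns := Ny s se.
  have d := smooth_on_differentiable (sF 0 0) Ns.
  have := is_derive_comp_curve (time_slice_derive s y) d.
  have := congr1 (fun M : 'M[R]_1 => M 0 0) (dF s se); rewrite /= mxE [RHS]mxE => -> //.
have E0 : F (0, y) 0 0 = mxform (Omc y) u v.
  have cy : cimg c setT y by have [] : N (0, y) by apply: Ny; rewrite normr0.
  by rewrite /F (local_flow0 flow cy) !(space_derive0 flow ac _ cy).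
apply: etrans _ E0; change (F (t, y) 0 0 = F (0, y) 0 0).
have const (G : R -> R) : (forall s, `|s| < eps -> is_derive (s : R) (1 : R) G 0) -> G t = G 0.
  exact: is_derive0_const.
exact: (const (fun s => F (s, y) 0 0) dFs).
Qed.

End HamiltonianFlow.

(** * Lie brackets *)

Section LieBracket.
Variables (R : realType) (m : nat) (W : manifold R m) (X Y : W -> 'rV[R]_m) (x : W).

Local Notation c := (chart_at x).
Local Notation y0 := (coord_at x).
Local Notation xi := (local_field X c).
Local Notation eta := (local_field Y c).

Lemma local_field_base (Z : W -> 'rV[R]_m) : local_field Z c y0 = Z x.
Proof. by rewrite /local_field /coord_at (cmapK (chart_at_dom x)) to_chart_self. Qed.

Variable B : set 'rV[R]_m.
Hypotheses (oB : open B) (By0 : B y0).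
Hypotheses (sxi : msmooth B xi) (seta : msmooth B eta).

Definition grad (f : 'rV[R]_m -> R^o) (y : 'rV[R]_m) : 'cV[R]_m :=
  \col_k 'D_(delta_mx 0 k) f y.

Lemma derive_grad (f : 'rV[R]_m -> R^o) y v : differentiable f y ->
  'D_v f y = (v *m grad f y) 0 0.
Proof.
move=> df; rewrite (deriveE v df) {1}(row_sum_delta v) linear_sum mxE.
by apply: eq_bigr => i _; rewrite linearZ /= -(deriveE _ df) mxE.
Qed.

(** Product rule for [Z f] written as field times gradient. The last term is the Hessian of [f] on
    the two vectors; its symmetry makes it cancel in the bracket. *)
Lemma app_field_chart (Z Z' : W -> 'rV[R]_m) (U : set W) (f : W -> R) :
  msmooth B (local_field Z c) -> open U -> U x -> smooth_fun U f ->
  let ft := (f \o cinv c : 'rV[R]_m -> R^o) in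
  app_field Z' (app_field Z f) x =
  ('D_(Z' x) (local_field Z c) y0 *m grad ft y0) 0 0 + 'D_(Z' x) (fun y => 'D_(Z x) ft y : R^o) y0.
Proof.
move=> sZ oU Ux sf ft.
have cx := chart_at_dom x; have acx := chart_at_atlas x.
have oC : open (cimg c U) by exact: cimg_open_sub.
have Cy0 : cimg c U y0 by exact: cimg_map.
have sft : smooth_on (cimg c U) ft by exact: sf.
pose B' := B `&` cimg c U.
have oB' : open B' by exact: openI.
have By0' : B' y0 by split.
have sgr : msmooth B' (grad ft).
  move=> i j; under eq_fun do rewrite mxE; apply: smooth_onS (smooth_on_derive _ sft).
  by move=> y [].
have sZ' : msmooth B' (local_field Z c) by move=> i j; apply: smooth_onS (sZ i j) => y [].
pose g y : 'M[R]_1 := local_field Z c y *m grad ft y.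
have sg : msmooth B' g by exact: msmoothM.
have dg : differentiable (fun y => g y 0 0 : R^o) y0 by exact: smooth_on_differentiable (sg 0 0) By0'.
have gE : \forall y \near y0, g y 0 0 = (app_field Z f \o cinv c) y.
  have n : nbhs y0 B' by exact: open_nbhs_nbhs.
  apply: filterS n => y [yB yC].
  have [cy Uy] := (cimgE _ _ _).1 yC; have [dy Ey] := cinv_mem cy.
  have dft : differentiable ft (cmap c (cinv c y)) by rewrite Ey; exact: smooth_on_differentiable sft yC.
  rewrite /= /app_field (dfun_chart _ acx dy dft) derive_grad // -/ft.
  by rewrite /g /local_field Ey.
have dA : differentiable (app_field Z f \o cinv c : 'rV[R]_m -> R^o) y0.
  exact: near_eq_differentiable gE dg.
rewrite {1}/app_field (dfun_chart _ acx cx dA) to_chart_self.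
have e1 := near_eq_derive (Z' x) gE; rewrite /coord_at in e1; apply: etrans (esym e1) _.
have e2 := mdirM (Z' x) By0' sZ' sgr.
have e3 := congr1 (fun M : 'M[R]_1 => M 0 0) e2; rewrite /= mxE in e3.
apply: (etrans e3); rewrite mxE (mdir_rV _ By0' sZ') local_field_base; congr (_ + _).
have n : \forall y \near y0, 'D_(Z x) ft y = (Z x *m grad ft y) 0 0.
  have n : nbhs y0 (cimg c U) by exact: open_nbhs_nbhs.
  apply: filterS n => y yC; apply: derive_grad; exact: smooth_on_differentiable sft yC.
apply: esym; apply: (etrans (near_eq_derive (Z' x) n)).
have cst_s : msmooth B' (fun _ : 'rV[R]_m => Z x) by exact: msmooth_cst.
have e4 := congr1 (fun M : 'M[R]_1 => M 0 0) (mdirM (Z' x) By0' cst_s sgr).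
by rewrite /= mxE in e4; apply: (etrans e4); rewrite mdir_cst mul0mx add0r.
Qed.

Lemma lie_bracket_chart :
  lie_bracket X Y x = 'D_(X x) eta y0 - 'D_(Y x) xi y0.
Proof.
have cx := chart_at_dom x; have acx := chart_at_atlas x.
rewrite /lie_bracket; set z := _ - _; set P := [set _ | _].
have Pz : P z.
  move=> U f oU Ux sf.
  rewrite (app_field_chart X seta oU Ux sf) (app_field_chart Y sxi oU Ux sf).
  have sft : smooth_on (cimg c U) (f \o cinv c : 'rV[R]_m -> R^o) by exact: sf.
  have Cy0 : cimg c U y0 by exact: cimg_map.
  have oC : open (cimg c U) by exact: cimg_open_sub.
  have df := smooth_on_differentiable sft Cy0.
  rewrite (dfun_chart z acx cx df) to_chart_self derive_grad //.
  rewrite (derive_comm (Y x) (X x) oC Cy0 sft) /z mulmxBl.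
  have mxB (M1 M2 : 'M[R]_1) (a : R) : (M1 - M2) 0 0 = M1 0 0 + a - (M2 0 0 + a).
    by rewrite !mxE; ring.
  exact: mxB.
case: xgetP => [z' _ Pz'|/(_ z)//].
apply/rowP => j.
(* Any admissible choice of the bracket agrees with [z] once both are tested on the chart
   coordinates. These are smooth on the chart domain only, which the quantification over open [U]
   allows. *)
pose f w := cmap c w 0 j.
have sf : smooth_fun (cdom c) f.
  move=> d ad; apply: smooth_on_coord; first exact/cimg_open_sub/cdom_open.
  exact: (atlas_smooth ad acx).
have oc : open (cdom c) by exact: cdom_open.
have dfE w : dfun f x w = w 0 j.
  have s1 : smooth_on (cimg c (cdom c)) (f \o cinv c : 'rV[R]_m -> R^o) by exact: sf.
  have d1 := smooth_on_differentiable s1 (cimg_map cx cx).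
  rewrite (dfun_chart w acx cx d1) to_chart_self.
  have n : \forall y \near (cmap c x : 'rV[R]_m), ((y : 'rV[R]_m) 0 j : R^o) = (f \o cinv c) y.
    by apply: filterS (near_cinv cx openT I) => y /cinv_mem[_ E]; rewrite /= /f E.
  apply: (etrans (esym (near_eq_derive w n))).
  have di : differentiable (fun y : 'rV[R]_m => y) (cmap c x) by exact: ex_diff.
  by apply: (etrans (derive_coord w j di)); rewrite derive_id.
rewrite -(dfE z') -(dfE z); apply: (etrans (Pz' _ _ oc cx sf)).
exact: (esym (Pz _ _ oc cx sf)).
Qed.

End LieBracket.

(** * Jacobi curves *)

Section MovingFrame.
Variables (R : realType) (m n : nat) (Om : 'M[R]_m) (A : set R^o).
Variables (Lam : R^o -> 'M[R]_(n, m)) (C : R -> {vspace 'rV[R]_m}) (l : seq 'rV[R]_m).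
Hypotheses (Oskew : Om^T = - Om) (Ounit : Om \in unitmx).
Hypotheses (oA : open A) (A0 : A 0) (sLam : msmooth A Lam) (Lam_free : row_free (Lam 0)).
Hypothesis CE : forall s, A s -> forall v, v \in C s <-> exists p, v = p *m Lam s.
Hypothesis Lam_iso : forall s, A s -> Lam s *m Om *m (Lam s)^T = 0.
Hypothesis Lam_gt0 : forall p : 'rV[R]_n, p != 0 ->
  0 < mxform Om (p *m mderive Lam 0) (p *m Lam 0).
Hypothesis C0_lag : lagrangian fullv (mxform Om) (C 0).
Hypothesis liso : forall u v, u \in l -> v \in l -> mxform Om u v = 0.
Hypothesis Cl0 : (C 0 :&: span l)%VS = 0%VS.

(** Expanding the frame as [Lam s = e P(s) + f Q(s)] with P(0) = 1 and Q(0) = 0 presents the curve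
    as the graph of [G = P^-1 Q] near 0, which brings the comparison for graphs into play. *)
Lemma moving_frame_comparison :
  let E := (C 0 :&: sorth (mxform Om) l)%VS in
  let diff v := reduced_curvature_form (mxform Om) l C 0 v
                - curvature_form fullv (mxform Om) C 0 v in
  [/\ quadratic_on E diff, forall v, v \in E -> 0 <= diff v
    & (quad_rank E diff <= size l)%N].
Proof.
have [F [k [io [dbx io_free lE rk]]]] :=
  darboux_exists Oskew Ounit Lam_free (CE A0) C0_lag liso Cl0.
set e := linfun (mulmxr (Lam 0)) in dbx; set f := linfun (mulmxr F) in dbx lE.
have eE p : e p = p *m Lam 0 by rewrite lfunE.
have fE p : f p = p *m F by rewrite lfunE.
have eqP0 : e 0 = 0 by rewrite linear0.
have fq0 : f 0 = 0 by rewrite linear0.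
have vQ v : exists p a, [/\ v = e p + f a, v *m Om *m (Lam 0)^T = a & v *m Om *m F^T = - p].
  have [p [a vE]] := (dbx.1 v).1 (memvf _); exists p, a; split => //.
    apply: dot_inj => q; rewrite -[LHS]dotMr.
    have := dbx.2 p a q 0; rewrite fq0 addr0 -vE eE /mxform.
    by rewrite [dot p _]dotC dot0l subr0 => <-.
  apply: dot_inj => q; rewrite -[LHS]dotMr.
  have := dbx.2 p a 0 q; rewrite eqP0 add0r -vE fE /mxform.
  by rewrite [dot a _]dotC dot0l sub0r -dotNl => <-.
(* Each Darboux component is obtained by pairing with the opposite half of the frame; the minus sign
   is that of the Darboux form. *)
pose P s := - (Lam s *m Om *m F^T); pose Q s := Lam s *m Om *m (Lam 0)^T.
have LamE s q : q *m Lam s = e (q *m P s) + f (q *m Q s).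
  have [p [a [vE aE pE]]] := vQ (q *m Lam s).
  by rewrite {1}vE mulmxN !mulmxA aE pE opprK.
have cA a b (M : 'M[R]_(a, b)) : msmooth A (fun=> M) by exact: msmooth_cst.
have sP : msmooth A P by apply: msmoothN => //; apply: msmoothM => //; exact: msmoothM.
have sQ : msmooth A Q by apply: msmoothM => //; exact: msmoothM.
have Q0 : Q 0 = 0 by exact: Lam_iso.
have P0 : P 0 = 1%:M.
  apply: (row_free_inj Lam_free); apply/row_matrixP => i.
  have := LamE 0 (delta_mx 0 i); rewrite Q0 mulmx0 fq0 addr0 eE -mulmxA -!rowE => <-.
  by rewrite mul1mx.
have uP0 : P 0 \in unitmx by rewrite P0 unitmx1.
pose B : set R^o := A `&` [set s | P s \in unitmx]^°.
have oB : open B by apply: openI => //; exact: open_interior.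
have B0 : B 0 by split => //; exact: (near_unitmx oA A0 sP uP0).
have BA s : B s -> A s by case.
have PB s : B s -> P s \in unitmx by move=> [_ /interior_subset].
have sPB : msmooth B P by move=> i j; apply: smooth_onS (sP i j).
have sQB : msmooth B Q by move=> i j; apply: smooth_onS (sQ i j).
pose G s := invmx (P s) *m Q s.
have sVB : msmooth B (fun s => invmx (P s)) by exact: msmooth_inv.
have sG : msmooth B G by exact: msmoothM.
have QPs s : A s -> Q s *m (P s)^T = P s *m (Q s)^T.
  move=> As; apply/row_matrixP => i; apply: dot_inj => q.
  have E0 : mxform Om (delta_mx 0 i *m Lam s) (q *m Lam s) = 0.
    rewrite /mxform trmx_mul !mulmxA -(mulmxA _ (Lam s) Om) -(mulmxA _ _ (Lam s)^T).
    by rewrite Lam_iso // mulmx0 mul0mx mxE.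
  have := dbx.2 (delta_mx 0 i *m P s) (delta_mx 0 i *m Q s) (q *m P s) (q *m Q s).
  rewrite -!LamE E0 => /esym/eqP; rewrite subr_eq0 => /eqP.
  by move: (P s) (Q s) => P1 Q1; rewrite !dotMr -!mulmxA -!rowE.
have Gs s : B s -> (G s)^T = G s.
  move=> Bs; have u := PB s Bs; have ut : (P s)^T \in unitmx by rewrite unitmx_tr.
  rewrite /G trmx_mul trmx_inv; apply: (can_inj (mulmxK ut)); rewrite mulmxKV //.
  by rewrite -mulmxA QPs ?mulmxA ?mulVmx ?mul1mx //; exact: BA.
have CG s : B s -> framed e f 1%:M (G s) (C s).
  move=> Bs v; split=> [/(CE (BA s Bs))[p ->]|[p ->]].
    exists (p *m P s); rewrite LamE mulmx1 /G.
    by move: (P s) (Q s) (PB s Bs) => P1 Q1 u1; rewrite mulmxA mulmxK.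
  apply/(CE (BA s Bs)); exists (p *m invmx (P s)).
  rewrite LamE mulmxKV ?PB // mulmx1 /G.
  by move: (P s) (Q s) => P1 Q1; rewrite mulmxA.
(* As Q vanishes at 0, the derivative of the inverse of P does not contribute. *)
have G'0 : mderive G 0 = mderive Lam 0 *m Om *m (Lam 0)^T.
  rewrite (mderiveM B0 sVB sQB) Q0 mulmx0 add0r P0 invmx1 mul1mx.
  rewrite (mderiveM A0 (msmoothM oA sLam (cA _ _ Om)) (cA _ _ _)) mderive_cst mulmx0 addr0.
  by rewrite (mderiveM A0 sLam (cA _ _ _)) mderive_cst mulmx0 addr0.
have G'_gt0 p : p != 0 -> 0 < dot (p *m mderive G 0) p.
  by move=> /Lam_gt0; rewrite G'0 /mxform /dot trmx_mul !mulmxA.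
have [h1 h2 h3] := graph_reduction_comparison dbx io_free lE oB B0 sG Gs CG G'_gt0.
by split => //; exact: leq_trans h3 rk.
Qed.

End MovingFrame.

Section TimeSlice.
Variables (R : realType) (m : nat).

Lemma slice_differentiable (t : R^o) (y : 'rV[R]_m) :
  differentiable (fun y : 'rV[R]_m => ((t, y) : R^o * 'rV[R]_m)) y.
Proof. by apply: differentiable_pair; [exact: differentiable_cst|exact: ex_diff]. Qed.

Lemma slice_derive (t : R^o) (y w : 'rV[R]_m) :
  'D_w (fun y : 'rV[R]_m => ((t, y) : R^o * 'rV[R]_m)) y = (0, w).
Proof.
have ds : differentiable (fun y : 'rV[R]_m => ((t, y) : R^o * 'rV[R]_m)) (0 *: w + y) by exact: slice_differentiable.
have [_] := is_derive_comp_curve (is_derive_line w y 0) ds.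
have -> : (fun s : R => ((t, s *: w + y) : R^o * 'rV[R]_m)) = fun s : R => s *: ((0, w) : R^o * 'rV[R]_m) + (t, y).
  by apply/funext => s; congr pair; rewrite /= scaler0 add0r.
have [_ ->] := is_derive_line ((0, w) : R^o * 'rV[R]_m) (t, y) 0.
by rewrite scale0r add0r.
Qed.

Lemma msmooth_smooth_on (U : normedModType R) (A : set U) (h : U -> 'rV[R]_m) :
  open A -> msmooth A h -> smooth_on A h.
Proof.
move=> oA; apply: (smooth_on_coind oA) => {h} [h sh x Ax|h v sh].
  exact: msmooth_differentiable sh Ax.
exists (fun x => 'D_v h x) => // i j.
rewrite (ord1 i); apply: (eq_smooth_on oA _ (smooth_on_derive v (sh 0 j))) => x Ax.
by rewrite derive_coord //; exact: msmooth_differentiable sh Ax.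
Qed.

End TimeSlice.

(** * Pulling fields back along an orbit *)

Section PulledBack.
Variables (R : realType) (m : nat) (W : manifold R m).
Variables (X : W -> 'rV[R]_m) (Om : set (R^o * W)) (Phi : R -> W -> W).
Hypothesis flow : is_flow X Om Phi.
Variable x : W.

Local Notation c := (chart_at x).
Local Notation y0 := (coord_at x).
Local Notation phi := (local_flow Phi c).
Local Notation N := (local_dom Om Phi c).
Local Notation xi := (local_field X c).
Local Notation dphi := (space_derive Phi c).
Local Notation ys := (fun s : R => phi (s, y0)).
Let ac : atlas c := chart_at_atlas x.
Let cx : cdom c x := chart_at_dom x.
Let oN : open N. Proof. exact: local_dom_open flow _. Qed.
Let sphi : smooth_on N phi := local_flow_smooth flow ac.
Let cy0 : cimg c setT y0. Proof. exact: cimg_map. Qed.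
Let cinv0 : cinv c y0 = x. Proof. exact: cmapK. Qed.

Lemma cinv_orbit s : N (s, y0) -> cinv c (phi (s, y0)) = Phi s x.
Proof. by move=> Ns; rewrite (cinv_local_flow Ns) /= cinv0. Qed.

Lemma flow_back s : N (s, y0) -> N (- s, phi (s, y0)) -> Phi (- s) (Phi s x) = x.
Proof.
move=> Ns [_ /= Om2 _]; rewrite (cinv_orbit Ns) in Om2.
case: Ns => [_ /= Om1 _]; rewrite cinv0 in Om1.
by rewrite (flowD flow Om1 Om2) subrr ?(flow0 flow) //; exact: flow_dom0 flow _.
Qed.

Lemma local_flow_back s : N (s, y0) -> N (- s, phi (s, y0)) -> phi (- s, phi (s, y0)) = y0.
Proof. by move=> N1 N2; rewrite {1}/local_flow /= (cinv_orbit N1) flow_back. Qed.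

(** The backward flow returns to [x], so the target chart in [tmap] is the chart at [x] for every
    [s]; only the source coordinates at [Phi s x] have to be changed. *)
Lemma tmap_flow_back s w : N (s, y0) -> N (- s, phi (s, y0)) ->
  tmap (Phi (- s)) (Phi s x) w = dphi (- s, phi (s, y0)) (to_chart c (Phi s x) w).
Proof.
move=> N1 N2; have [cz ez] := cinv_mem (local_flow_img N1).
rewrite (cinv_orbit N1) in cz ez.
have dph := smooth_on_differentiable sphi N2.
have dsl := slice_differentiable (- s : R^o) (phi (s, y0)).
have E : (cmap (chart_at (Phi (- s) (Phi s x))) \o Phi (- s)) \o cinv c = phi \o (fun y : 'rV[R]_m => ((- s, y) : R^o * 'rV[R]_m)).
  by rewrite flow_back.
have dc : differentiable (phi \o (fun y : 'rV[R]_m => ((- s, y) : R^o * 'rV[R]_m))) (phi (s, y0)).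
  exact: differentiable_comp.
have H := @tmap_chart _ _ _ (Phi (- s)) c (Phi s x) w ac cz; rewrite E ez in H.
apply: (etrans (H dc)); apply: (etrans (derive_comp _ dsl dph)).
by rewrite slice_derive.
Qed.

Lemma orbit_smooth (A : set R^o) : open A -> (forall s, A s -> N (s, y0)) ->
  msmooth A (fun s : R^o => phi (s, y0)).
Proof.
move=> oA AN i j; rewrite (ord1 i).
have s1 : smooth_on N (fun p => phi p 0 j : R^o) by exact: smooth_on_coord.
apply: (smooth_on_comp_pair oA s1 AN); first exact: smooth_on_id.
by move=> k l; exact: smooth_on_cst.
Qed.

Definition pullback_mx (s : R^o) : 'M[R]_m := \matrix_k dphi (- s, phi (s, y0)) (delta_mx 0 k).

Lemma mul_pullback_mx s (v : 'rV[R]_m) : N (- s, phi (s, y0)) ->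
  v *m pullback_mx s = dphi (- s, phi (s, y0)) v.
Proof.
move=> Np; have dl := space_derive_lin flow ac Np.
pose dL : {linear 'rV[R]_m -> 'rV[R]_m} := HB.pack (dphi (- s, phi (s, y0))) (GRing.isLinear.Build _ _ _ _ _ dl).
rewrite {2}(row_sum_delta v) -[dphi _]/(dL : _ -> _) linear_sum mulmx_sum_row.
by apply: eq_bigr => k _; rewrite linearZ rowK.
Qed.

Lemma pullback_mx_smooth (A : set R^o) : open A -> (forall s, A s -> N (s, y0)) ->
  (forall s, A s -> N (- s, phi (s, y0))) -> msmooth A pullback_mx.
Proof.
move=> oA AN AN' k j; under eq_fun do rewrite mxE.
apply: (smooth_on_comp_pair oA (space_derive_smooth flow ac (delta_mx 0 k) 0 j) AN').
  by apply: smooth_onN => //; exact: smooth_on_id.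
exact: orbit_smooth.
Qed.

Lemma pullback_mx0 : pullback_mx 0 = 1%:M.
Proof.
apply/row_matrixP => k; rewrite rowK row1 oppr0 (local_flow0 flow cy0).
exact: (space_derive0 flow ac _ cy0).
Qed.

Lemma orbit_derive0 : is_derive (0 : R) (1 : R) ys (X x).
Proof.
have := local_flow_ode flow ac (local_dom0 flow cy0).
by rewrite (local_flow0 flow cy0) local_field_base.
Qed.

Lemma reversed_orbit_derive0 :
  is_derive (0 : R) (1 : R) (fun s : R => ((- s, phi (s, y0)) : R^o * 'rV[R]_m)) ((-1, X x) : R^o * 'rV[R]_m).
Proof.
have d1 := is_derive_comp_curve orbit_derive0 (slice_differentiable (0 : R^o) (phi (0, y0))).
rewrite slice_derive in d1.
have d2 := is_derive_line ((-1, 0) : R^o * 'rV[R]_m) 0 0.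
have -> : (fun s : R => ((- s, phi (s, y0)) : R^o * 'rV[R]_m)) =
    (fun s : R => s *: ((-1, 0) : R^o * 'rV[R]_m) + 0) + (fun s : R => ((0, phi (s, y0)) : R^o * 'rV[R]_m)).
  by apply/funext => s; congr pair; rewrite /= ?scaler0 ?addr0 ?add0r // [RHS]mulrN1.
have -> : ((-1, X x) : R^o * 'rV[R]_m) = (-1, 0) + (0, X x).
  by congr pair; rewrite /= ?add0r ?addr0.
exact: is_deriveD d2 d1.
Qed.

(** Both arguments of the linearized flow move with [s]. The reversed time gives minus the
    variational equation; the motion of the base point gives nothing, since the linearized flow at
    time 0 is the identity at every point of the chart. *)
Lemma pullback_mx_derive0 v (A : set R^o) : open A -> A 0 -> (forall s, A s -> N (s, y0)) ->
  (forall s, A s -> N (- s, phi (s, y0))) ->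
  v *m mderive pullback_mx 0 = - 'D_v xi y0.
Proof.
move=> oA A0 AN AN'; have sxi := local_field_smooth flow ac.
have N0 : N (0, y0) := local_dom0 flow cy0.
have cst_s a b (M : 'M[R]_(a, b)) : msmooth A (fun=> M) by exact: msmooth_cst.
have := mderiveM A0 (cst_s _ _ v) (pullback_mx_smooth oA AN AN').
rewrite mderive_cst mul0mx add0r => <-.
have E1 : \forall s \near (0 : R^o), v *m pullback_mx s = dphi (- s, phi (s, y0)) v.
  by apply: filterS (near_open oA A0) => s /AN'; exact: mul_pullback_mx.
rewrite (near_eq_mderive E1).
have N0' : N (- 0, phi (0, y0)) by rewrite oppr0 (local_flow0 flow cy0).
have sd := space_derive_smooth flow ac v.
have D1 := mderive_comp_curve N0' sd reversed_orbit_derive0.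
apply: (etrans D1); rewrite oppr0 (local_flow0 flow cy0).
have -> : ((-1, X x) : R^o * 'rV[R]_m) = -1 *: ((1, 0) : R^o * 'rV[R]_m) + (0, X x).
  apply: (congr2 pair); first exact: (esym (etrans (addr0 (-1 * 1 : R)) (mulr1 _))).
  have E0 : (-1 : R) *: (0 : 'rV[R]_m) + X x = X x by rewrite scaler0 add0r.
  exact: (esym E0).
have L := mdir_lin N0 sd (-1) ((1, 0) : R^o * 'rV[R]_m) ((0, X x) : R^o * 'rV[R]_m).
apply: (etrans L).
have D2 : mdir ((0, X x) : R^o * 'rV[R]_m) (dphi^~ v) (0, y0) = 0.
  have dsl := slice_differentiable (0 : R^o) y0.
  have D2 := mdir_comp (X x) dsl sd N0; rewrite slice_derive in D2.
  apply: (etrans (esym D2)); apply: etrans (mdir_cst y0 (X x) v); apply: near_eq_mdir.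
  apply: filterS (near_cinv cx openT I) => y cy; exact: (space_derive0 flow ac v cy).
have D3 := space_derive_dt flow ac v N0.
rewrite (space_derive0 flow ac v cy0) (local_flow0 flow cy0) in D3.
have D4 := congr2 +%R (congr1 ( *:%R (-1)) D3) D2.
by apply: (etrans D4); rewrite scaleN1r addr0.
Qed.

Lemma pulled_field_derive0 (eta : 'rV[R]_m -> 'rV[R]_m) (B : set 'rV[R]_m) (A : set R^o) :
  open A -> A 0 -> (forall s, A s -> N (s, y0)) -> (forall s, A s -> N (- s, phi (s, y0))) ->
  (forall s, A s -> B (phi (s, y0))) -> msmooth B eta ->
  mderive (fun s : R^o => eta (phi (s, y0)) *m pullback_mx s) 0 = 'D_(X x) eta y0 - 'D_(eta y0) xi y0.
Proof.
move=> oA A0 AN AN' AB sB.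
have sE : msmooth A (fun s : R^o => eta (phi (s, y0))).
  by move=> i j; apply: (smooth_on_comp_rV oA (sB i j) AB); exact: orbit_smooth.
have B0 := AB 0 A0.
rewrite (mderiveM A0 sE (pullback_mx_smooth oA AN AN')) pullback_mx0 mulmx1.
rewrite (mderive_comp_curve B0 sB orbit_derive0) (pullback_mx_derive0 _ oA A0 AN AN').
by move: B0; rewrite (local_flow0 flow cy0) => B0; rewrite (mdir_rV _ B0 sB).
Qed.

End PulledBack.

Section LocalSections.
Variables (R : realType) (m : nat) (W : manifold R m).

Lemma smooth_field_comb (U : set W) k (Y : 'I_k -> W -> 'rV[R]_m) (p : 'rV[R]_k) : open U ->
  (forall i, smooth_field U (Y i)) -> smooth_field U (fun y => \sum_i p 0 i *: Y i y).
Proof.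
move=> oU sY d ad; have oC : open (cimg d U) by exact: cimg_open_sub.
apply: (msmooth_smooth_on oC) => i j; rewrite (ord1 i).
apply: (@eq_smooth_on _ _ _ _ (fun y => \sum_i p 0 i * to_chart d (cinv d y) (Y i (cinv d y)) 0 j : R^o) _ oC).
  move=> y yC; rewrite /to_chart linear_sum summxE; apply: eq_bigr => l _.
  by rewrite linearZ [RHS]mxE.
apply: smooth_on_sum => // l; apply: smooth_onM => //; first exact: smooth_on_cst.
by apply: smooth_on_coord => //; exact: sY.
Qed.

Lemma smooth_field_local (U : set W) Y c : open U -> atlas c -> smooth_field U Y ->
  msmooth (cimg c U) (local_field Y c).
Proof. by move=> oU ac sY; apply: msmooth_coord; [exact: cimg_open_sub|exact: sY]. Qed.

End LocalSections.

(** * The Jacobi curve as a moving frame *)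

Section JacobiCurve.
Variables (R : realType) (m : nat) (W : symplectic_manifold R m).
Variables (H : W -> R) (D : W -> {vspace 'rV[R]_m}).
Variables (Om : set (R^o * W)) (Phi : R -> W -> W).
Hypothesis H_smooth : smooth_fun setT H.
Hypothesis D_lag : lagrangian_distribution D.
Hypothesis flow : is_flow (ham H) Om Phi.
Variable x : W.

Local Notation c := (chart_at x).
Local Notation y0 := (coord_at x).
Local Notation phi := (local_flow Phi c).
Local Notation N := (local_dom Om Phi c).
Local Notation Psi := (pullback_mx Phi x).
Let ac : atlas c := chart_at_atlas x.
Let cx : cdom c x := chart_at_dom x.
Let oN : open N. Proof. exact: local_dom_open flow _. Qed.
Let cy0 : cimg c setT y0. Proof. exact: cimg_map. Qed.
Let cinv0 : cinv c y0 = x. Proof. exact: cmapK. Qed.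

(** Times for which the flow can be followed forth and back inside one chart while the orbit stays
    in [U]. The last clause provides the whole time interval around each orbit point on which
    [flow_symplectic] relies. *)
Definition orbit_window (U : set W) (A : set R^o) : Prop :=
  [/\ open A, A 0 & forall s, A s ->
    [/\ N (s, y0), N (- s, phi (s, y0)), U (Phi s x)
      & exists2 eps, `|- s| < eps & forall t, `|t| < eps -> N (t, phi (s, y0))]].

Lemma orbit_window_exists (U : set W) : open U -> U x -> exists A, orbit_window U A.
Proof.
move=> oU Ux; have [eps e0 NP] := near_local_dom flow cy0.
have n0 : \forall s \near (0 : R^o), `|s| < eps.
  by apply/nbhs_ballP; exists eps => //= s; rewrite /ball /= sub0r normrN.
have N0 : N (0, y0) := local_dom0 flow cy0.
have [dph _] := orbit_derive0 flow x.
have ct : {for (0 : R^o), continuous (fun s : R^o => phi (s, y0))}.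
  by apply: differentiable_continuous; apply/derivable1_diffP.
have p0 : phi (0, y0) = y0 by exact: (local_flow0 flow cy0).
have n1 : \forall s \near (0 : R^o), ball y0 eps (phi (s, y0)).
  by apply: ct; rewrite p0; exact: nbhsx_ballx.
have n2 : \forall s \near (0 : R^o), cimg c U (phi (s, y0)).
  by apply: ct; rewrite p0; exact: near_cinv.
exists [set s | [/\ `|s| < eps, ball y0 eps (phi (s, y0)) & cimg c U (phi (s, y0))]]^°; split.
- exact: open_interior.
- by apply: filterS3 n0 n1 n2 => s.
- move=> s /interior_subset[se ys /cimgE[_ Us]].
  have Ns : N (s, y0) by apply: NP => //; exact: ballxx.
  rewrite -(cinv_orbit Ns); split => //.
    by apply: NP => //; rewrite normrN.
  by exists eps; [rewrite normrN|move=> t te; exact: NP].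
Qed.

Lemma local_form_base : local_form c y0 = omega x.
Proof.
apply/matrixP => i j; rewrite mxE /form_in_chart cinv0.
have E u : from_chart c y0 u = u by rewrite -{1}(to_chart_self x u) /coord_at to_chartK.
by rewrite !E -[LHS]/(dot _ _) dot_delta -rowE mxE.
Qed.

Section Window.
Variables (U : set W) (A : set R^o).
Hypothesis AU : orbit_window U A.
Let oA : open A. Proof. by have [] := AU. Qed.
Let A0 : A 0. Proof. by have [] := AU. Qed.
Let AN s : A s -> N (s, y0). Proof. by move=> As; have [_ _ /(_ s As)[]] := AU. Qed.
Let AN' s : A s -> N (- s, phi (s, y0)). Proof. by move=> As; have [_ _ /(_ s As)[]] := AU. Qed.
Let AUx s : A s -> U (Phi s x). Proof. by move=> As; have [_ _ /(_ s As)[]] := AU. Qed.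
Let AC s : A s -> cimg c U (phi (s, y0)).
Proof.
move=> As; apply/cimgE; split; first exact: (local_flow_img (AN As)).
by rewrite (cinv_orbit (AN As)); exact: AUx.
Qed.

Definition pulled_field (Y : W -> 'rV[R]_m) (s : R^o) : 'rV[R]_m :=
  local_field Y c (phi (s, y0)) *m Psi s.

Lemma pulled_fieldE Y s : A s ->
  pulled_field Y s = tmap (Phi (- s)) (Phi s x) (Y (Phi s x)).
Proof.
move=> As; rewrite /pulled_field (mul_pullback_mx flow _ (AN' As)).
by rewrite (tmap_flow_back flow _ (AN As) (AN' As)) /local_field (cinv_orbit (AN As)).
Qed.

Lemma tmap_flow_symplectic s u v : A s ->
  mxform (omega x) (tmap (Phi (- s)) (Phi s x) u) (tmap (Phi (- s)) (Phi s x) v) =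
  sform (Phi s x) u v.
Proof.
move=> As; have N1 := AN As; have N2 := AN' As.
have [_ _ /(_ s As)[_ _ _ [eps se Ne]]] := AU.
rewrite !(tmap_flow_back flow _ N1 N2) -local_form_base -{1}(local_flow_back flow N1 N2).
rewrite (flow_symplectic H_smooth flow ac _ _ se Ne) -local_formE /form_in_chart (cinv_orbit N1).
have [cz ez] := cinv_mem (local_flow_img N1); rewrite (cinv_orbit N1) in cz ez.
by rewrite -ez !to_chartK.
Qed.

Lemma pulled_field_smooth Y : open U -> smooth_field U Y -> msmooth A (pulled_field Y).
Proof.
move=> oU sY; apply: msmoothM => //; last exact: (pullback_mx_smooth flow oA AN AN').
have sB := smooth_field_local oU ac sY.
by move=> i j; apply: (smooth_on_comp_rV oA (sB i j) AC); exact: (orbit_smooth flow oA AN).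
Qed.

Lemma pulled_field0 Y : pulled_field Y 0 = Y x.
Proof.
by rewrite /pulled_field (pullback_mx0 flow) mulmx1 (local_flow0 flow cy0) local_field_base.
Qed.

Lemma pulled_field_derive Y : open U -> smooth_field U Y ->
  mderive (pulled_field Y) 0 = lie_bracket (ham H) Y x.
Proof.
move=> oU sY; have sB := smooth_field_local oU ac sY.
apply: (etrans (pulled_field_derive0 flow oA A0 AN AN' AC sB)).
rewrite local_field_base.
have oC : open (cimg c U) by exact: cimg_open_sub.
have By0 : cimg c U y0 by have := AC A0; rewrite (local_flow0 flow cy0).
have BV : cimg c U `<=` cimg c setT by move=> y /cimgE[].
have sX : msmooth (cimg c U) (local_field (ham H) c).
  by move=> i j; exact: (smooth_onS BV (local_field_smooth flow ac i j)).
exact: (esym (lie_bracket_chart oC By0 sX sB)).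
Qed.

Lemma jacobi_curve0 : jacobi_curve Phi D x 0 = D x.
Proof.
apply/vspaceP => v; rewrite /jacobi_curve oppr0 (flow0 flow).
have N0 := AN A0; have N0' := AN' A0.
have tE u : tmap (Phi 0) x u = u.
  have := tmap_flow_back flow u N0 N0'; rewrite oppr0 (flow0 flow) => ->.
  by rewrite (local_flow0 flow cy0) (space_derive0 flow ac _ cy0) to_chart_self.
have lE u : linfun (tmap (Phi 0) x) u = u by rewrite -[RHS]tE /tmap lfunE.
apply/memv_imgP/idP => [[u ? ->]|vD]; first by rewrite lE.
by exists v => //; rewrite lE.
Qed.

End Window.

Variables (U : set W) (A : set R^o).
Hypothesis AU : orbit_window U A.
Let oA : open A. Proof. by have [] := AU. Qed.
Let A0 : A 0. Proof. by have [] := AU. Qed.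
Let AUx s : A s -> U (Phi s x). Proof. by move=> As; have [_ _ /(_ s As)[]] := AU. Qed.
Variables (n : nat) (Y : 'I_n -> W -> 'rV[R]_m).
Hypotheses (oU : open U) (sY : forall i, smooth_field U (Y i)).
Hypothesis Yb : forall y, U y -> basis_of (D y) [tuple Y i y | i < n].

Definition jacobi_frame (s : R^o) : 'M[R]_(n, m) := \matrix_i pulled_field (Y i) s.
Local Notation Lam := jacobi_frame.

Lemma frame_memP y v : U y -> v \in D y <-> exists p : 'rV[R]_n, v = \sum_i p 0 i *: Y i y.
Proof.
move=> Uy; have b := Yb Uy; split=> [vD|[p ->]].
  exists (\row_i coord [tuple Y i y | i < n] i v).
  rewrite {1}(coord_basis b vD); apply: eq_bigr => i _.
  by rewrite mxE -tnth_nth tnth_mktuple.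
apply: memv_suml => i _; apply: memvZ; apply: (basis_mem b).
by apply/tnthP; exists i; rewrite tnth_mktuple.
Qed.

Lemma jacobi_frame_smooth : msmooth A Lam.
Proof.
move=> i j; under eq_fun do rewrite mxE; exact: (pulled_field_smooth AU oU (sY i) 0 j).
Qed.

Lemma mul_jacobi_frame s p : A s ->
  p *m Lam s = tmap (Phi (- s)) (Phi s x) (\sum_i p 0 i *: Y i (Phi s x)).
Proof.
move=> As; rewrite mulmx_sum_row /tmap linear_sum; apply: eq_bigr => i _.
by rewrite linearZ rowK (pulled_fieldE AU _ As).
Qed.

Lemma jacobi_curve_memP s : A s ->
  forall v, v \in jacobi_curve Phi D x s <-> exists p, v = p *m Lam s.
Proof.
move=> As v; have Us := AUx As.
have lE u : linfun (tmap (Phi (- s)) (Phi s x)) u = tmap (Phi (- s)) (Phi s x) u.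
  by rewrite /tmap lfunE.
split=> [/memv_imgP[u /(frame_memP _ Us)[p ->] ->]|[p ->]].
  by exists p; rewrite lE mul_jacobi_frame.
apply/memv_imgP; exists (\sum_i p 0 i *: Y i (Phi s x)); last by rewrite lE mul_jacobi_frame.
by apply/(frame_memP _ Us); exists p.
Qed.

Lemma jacobi_frame_form s p (Z : W -> 'rV[R]_m) : A s -> Z (Phi s x) \in D (Phi s x) ->
  mxform (omega x) (pulled_field Z s) (p *m Lam s) = 0.
Proof.
move=> As ZD; rewrite (pulled_fieldE AU _ As) (mul_jacobi_frame _ As) (tmap_flow_symplectic AU _ _ As).
apply: ((D_lag.2 (Phi s x)).2 _ (memvf _)).1 => //.
by apply/(frame_memP _ (AUx As)); exists p.
Qed.

Lemma jacobi_frame_iso s : A s -> Lam s *m omega x *m (Lam s)^T = 0.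
Proof.
move=> As; apply/matrixP => i j; rewrite [RHS]mxE.
have YD : Y i (Phi s x) \in D (Phi s x).
  apply: (basis_mem (Yb (AUx As))); by apply/tnthP; exists i; rewrite tnth_mktuple.
have := jacobi_frame_form (delta_mx 0 j) As YD.
rewrite -rowE /mxform => <-.
rewrite mxE [RHS]mxE; apply: eq_bigr => k _; congr (_ * _); last by rewrite !mxE.
by rewrite -[pulled_field _ _](rowK (fun i => pulled_field (Y i) s)) -row_mul [RHS]mxE.
Qed.

Lemma jacobi_frame0 i : row i (Lam 0) = Y i x.
Proof. by rewrite rowK pulled_field0. Qed.

Lemma jacobi_frame_free : row_free (Lam 0).
Proof.
have Ux : U x by have := AUx A0; rewrite (flow0 flow).
have /basis_free/freeP fr := Yb Ux.
apply: inj_row_free => p p0; apply/rowP => i; rewrite mxE.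
apply: (fr (fun i => p 0 i)); rewrite -[RHS]p0 mulmx_sum_row.
by apply: eq_bigr => j _; rewrite jacobi_frame0 -tnth_nth tnth_mktuple.
Qed.

(** [Qform] uses a section [Z] of its own choice, not the frame combination with coefficients [p].
    Pulled back, both lie in the isotropic Jacobi curve; differentiating their zero pairing at 0,
    where they agree, identifies the derivative of the frame paired with [v] with the bracket of [Z]
    paired with [v]. *)
Lemma jacobi_frame_gt0 p : monotone_increasing H D -> p != 0 ->
  0 < mxform (omega x) (p *m mderive Lam 0) (p *m Lam 0).
Proof.
move=> mon pn0; have Ux : U x by have := AUx A0; rewrite (flow0 flow).
set v := p *m Lam 0.
have vn0 : v != 0.
  by apply: contra pn0 => /eqP E; apply/eqP/(row_free_inj jacobi_frame_free); rewrite -/v E mul0mx.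
have vE : v = \sum_i p 0 i *: Y i x.
  by rewrite /v mulmx_sum_row; apply: eq_bigr => i _; rewrite jacobi_frame0.
have vD : v \in D x by apply/(frame_memP _ Ux); exists p.
have := mon x v vD vn0; rewrite /Qform; case: xgetP => [Z _ [Zx [U' [oU' U'x sZ ZD]]]|]; last first.
  (* The default section is excluded: the constant combination of the local frame is a section
     through [v]. *)
  move=> /(_ (fun y => \sum_i p 0 i *: Y i y))[]; split; first by rewrite vE.
  exists U; split => //; first exact: smooth_field_comb.
  by move=> y Uy; apply/frame_memP => //; exists p.
set z := lie_bracket _ _ _ => Q0.
have sZ' : smooth_field (U `&` U') Z.
  by move=> d ad; apply: smooth_onS (sZ d ad) => y [w [dw [_ Uw]] <-]; exists w.
have oUU' : open (U `&` U') by exact: openI.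
(* The chosen section is controlled only on its own neighbourhood [U'], so a second window is
   needed, and the pairing is differentiated on the intersection of the two. *)
have [A' AU'] := orbit_window_exists oUU' (conj Ux U'x).
have [oA' A'0 AP'] := AU'.
have dZ := pulled_field_derive AU' oUU' sZ'; rewrite -/z in dZ.
have sZA := pulled_field_smooth AU' oUU' sZ'.
pose B := A `&` A'.
have oB : open B by exact: openI.
have B0 : B 0 by split.
have cB a b (M : 'M[R]_(a, b)) : msmooth B (fun=> M) by exact: msmooth_cst.
have sZB : msmooth B (pulled_field Z) by move=> i j; apply: smooth_onS (sZA i j) => s [].
have sLB : msmooth B Lam by move=> i j; apply: smooth_onS (jacobi_frame_smooth i j) => s [].
have orth : \forall s \near (0 : R^o), pulled_field Z s *m omega x *m (p *m Lam s)^T = 0.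
  apply: filterS (near_open oB B0) => s [As A's].
  have [_ _ [_ U'z] _] := AP' s A's.
  by apply/matrixP => i j; rewrite !ord1 [RHS]mxE; exact: (jacobi_frame_form p As (ZD _ U'z)).
have := near_eq_mderive orth; rewrite mderive_cst.
have sZO : msmooth B (fun s => pulled_field Z s *m omega x) by exact: msmoothM.
have sL1 : msmooth B (fun s => p *m Lam s) by exact: msmoothM.
rewrite (mderiveM B0 sZO (msmooth_tr sL1)) (mderiveM B0 sZB (cB _ _ (omega x))) mderive_tr.
rewrite (mderiveM B0 (cB _ _ p) sLB) !mderive_cst mulmx0 addr0 mul0mx add0r dZ pulled_field0 Zx -/v.
move=> /(congr1 (fun M : 'M[R]_1 => M 0 0)); rewrite /= mxE [RHS]mxE.
rewrite -!/(mxform _ _ _) [X in _ + X](mxform_skew _ _ (omega_skew x)) => /eqP.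
by rewrite subr_eq0 => /eqP <-.
Qed.

End JacobiCurve.

Lemma common_ker_sorth (R : realType) (m : nat) (W : symplectic_manifold R m) (s : nat)
    (g : 'I_s -> W -> R) (x : W) : common_ker g x = sorth (sform x) (ham_tuple g x).
Proof.
rewrite /common_ker /sorth big_tuple; apply: eq_bigr => i _; rewrite tnth_mktuple.
by congr (lker (linfun _)); apply/funext => v; exact: hamP.
Qed.

Theorem corollary2 (R : realType) (m : nat) (W : symplectic_manifold R m)
    (H : W -> R) (D : W -> {vspace 'rV[R]_m})
    (Om : set (R^o * W)) (Phi : R -> W -> W)
    (s : nat) (g : 'I_s -> W -> R) (x : W)
    (H_smooth : smooth_fun setT H)
    (D_lagrangian : lagrangian_distribution D)
    (Phi_flow : is_flow (ham H) Om Phi)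
    (D_monotone : monotone_increasing H D)
    (g_integrals : involutive_first_integrals H g)
    (D_transversal : (D x :&: span (ham_tuple g x))%VS = 0%VS) :
  let E := (common_ker g x :&: D x)%VS in
  let r := dist_curvature_form Phi D x in
  let rG := reduced_dist_curvature_form Phi D g x in
  let diff := fun v => rG v - r v in
  (forall v, v \in E -> r v <= rG v) /\
  [/\ quadratic_on E diff,
      forall v, v \in E -> 0 <= diff v
    & (quad_rank E diff <= s)%N].
Proof.
have [D_sub D_lag] := D_lagrangian.
have [U [n [Y [oU Ux sY Yb]]]] := D_sub x.
have [A AU] := orbit_window_exists Phi_flow oU Ux.
have [oA A0 _] := AU.
have C0 := jacobi_curve0 D Phi_flow AU.
have liso u v : u \in ham_tuple g x -> v \in ham_tuple g x -> mxform (omega x) u v = 0.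
  have [_ _ gg] := g_integrals.
  move=> /tnthP[i ->] /tnthP[j ->]; rewrite !tnth_mktuple.
  by rewrite -(gg i j x) /poisson hamP.
have Clag : lagrangian fullv (mxform (omega x)) (jacobi_curve Phi D x 0) by rewrite C0; exact: D_lag.
have Cl0 : (jacobi_curve Phi D x 0 :&: span (ham_tuple g x))%VS = 0%VS by rewrite C0.
have [] := moving_frame_comparison (omega_skew x) (omega_nondegenerate x) oA A0
  (jacobi_frame_smooth Phi_flow AU oU sY) (jacobi_frame_free Phi_flow AU Yb)
  (jacobi_curve_memP Phi_flow AU Yb) (jacobi_frame_iso H_smooth D_lagrangian Phi_flow AU Yb)
  (fun p => jacobi_frame_gt0 H_smooth D_lagrangian Phi_flow AU oU sY Yb (p := p) D_monotone) Clag liso Cl0.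
rewrite C0 size_tuple capvC -/(sform x) -common_ker_sorth => h1 h2 h3.
split; last exact: (And3 h1 h2 h3).
by move=> v vE; have := h2 v vE; rewrite subr_ge0.
Qed.
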